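(* Let $q,q'\in\mathbb Z$ and $M\in\mathbb N$. If $q\notin\{0,1,\dots,M-1\}$ or $q'\notin\{0,1,\dots,M-1\}$, then there is (up to multiplication by a non-zero constant) exactly one $M$-th order bilinear differential pairing between sections of $\mathcal O(q)$ and sections of $\mathcal O(q')$ on the Riemann sphere $\mathbb{CP}_1$ that is invariant with respect to Moebius transformations. This pairing $P:\mathcal O(q)\times\mathcal O(q')\to\mathcal O(q+q'-2M)$ is given by $$P(f,g)(z)=\sum_{j=0}^{M}\gamma_{M,j}\left(\frac{d^{j}f}{dz^{j}}(z)\right)\left(\frac{d^{M-j}g}{dz^{M-j}}(z)\right),\qquad \gamma_{M,j}=(-1)^{j}\binom{M}{j}\prod_{i=j}^{M-1}(q-i)\prod_{i=M-j}^{M-1}(q'-i).$$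
   Context: $\mathcal O(q)$ is the $q$-th power of the hyperplane section bundle $\mathcal O(1)$ on $\mathbb{CP}_1$. A (local) holomorphic section of $\mathcal O(q)$ is a pair $f=\{f_1,f_2\}$ of holomorphic functions of one variable, defined on appropriate open sets, related by $f_1(z)=\zeta^{-q}f_2(\zeta)$ for $\zeta=-1/z$. The group $\mathrm{SL}_2\mathbb C$ acts on sections of $\mathcal O(q)$: for $\phi=\begin{pmatrix}a&b\\c&d\end{pmatrix}$, $(\phi f_1)(z)=(d-bz)^{q}f_1\left(\frac{az-c}{d-bz}\right)$ and $(\phi f_2)(\zeta)=(c\zeta+a)^q f_2\left(\frac{d\zeta+b}{c\zeta+a}\right)$. A bilinear differential pairing $P:\mathcal O(q)\times\mathcal O(q')\to\mathcal O(p)$ is given in the chart $z$ by a finite sum $P(f,g)_1(z)=\sum_{i,j}a_{ij}(z)f_1^{(i)}(z)g_1^{(j)}(z)$ with functions $a_{ij}$, and analogously by an expression in the chart $\zeta$ for $P(f,g)_2$, such that $P(f,g)_1(z)=\zeta^{-p}P(f,g)_2(\zeta)$ for $\zeta=-1/z$. It is invariant if $P(\phi f,\phi g)=\phi P(f,g)$ for all $\phi\in\mathrm{SL}_2\mathbb C$. An invariant pairing is of order $M$ if $p=q+q'-2M$ (invariance then forces it to be a constant coefficient combination of the terms with $i+j=M$, by the same formula in both charts). In the claim $f,g$ stand for the functions representing the sections in a chart. Empty products equal $1$. *)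

(* Defs.v *)
From Stdlib Require Import Reals ZArith List.
From Coquelicot Require Import Coquelicot.

Local Open Scope C_scope.

(** Junk value [/ 0 ^ n] for [w = 0] and a negative exponent; all uses below
    have a nonzero base. *)
Definition Cpowz (w : C) (n : Z) : C :=
  match n with
  | Z0 => 1
  | Zpos p => w ^ Pos.to_nat p
  | Zneg p => / (w ^ Pos.to_nat p)
  end.

Definition holomorphic_on (U : C -> Prop) (f : C -> C) : Prop :=
  forall z : C, U z -> @ex_derive C_AbsRing C_NormedModule f z.

Fixpoint C_derive_n (f : C -> C) (n : nat) (z : C) : C :=
  match n with
  | O => f z
  | S k => C_derive (C_derive_n f k) z
  end.

(** CP_1 is two copies of C, with coordinates z and zeta, glued along
    zeta = -1/z.  The raw data of a local section are an open set of CP_1, given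
    by its traces [dom1], [dom2] in the charts z, zeta, and the representing
    functions [fun1], [fun2], whose values outside the domains are irrelevant
    (see [is_section] and [sec_eq]). *)
Record local_data : Type := LocalData {
  dom1 : C -> Prop;
  dom2 : C -> Prop;
  fun1 : C -> C;
  fun2 : C -> C
}.

Definition is_section (q : Z) (f : local_data) : Prop :=
  @open C_UniformSpace (dom1 f) /\
  @open C_UniformSpace (dom2 f) /\
  (forall z : C, z <> 0 -> (dom1 f z <-> dom2 f (- 1 / z))) /\
  holomorphic_on (dom1 f) (fun1 f) /\
  holomorphic_on (dom2 f) (fun2 f) /\
  (forall z : C, z <> 0 -> dom1 f z ->
     fun1 f z = Cpowz (- 1 / z) (- q) * fun2 f (- 1 / z)).

Definition sec_eq (f g : local_data) : Prop :=
  (forall z : C, dom1 f z <-> dom1 g z) /\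
  (forall z : C, dom2 f z <-> dom2 g z) /\
  (forall z : C, dom1 f z -> fun1 f z = fun1 g z) /\
  (forall z : C, dom2 f z -> fun2 f z = fun2 g z).

Definition scale (k : C) (f : local_data) : local_data :=
  LocalData (dom1 f) (dom2 f) (fun z => k * fun1 f z) (fun z => k * fun2 f z).

Record SL2C : Type := MkSL2C {
  ma : C; mb : C; mc : C; md : C;
  SL2C_det : ma * md - mb * mc = 1
}.

(** The domain of the transformed section is the preimage of the domain of [f]
    under z |-> (a z - c) / (d - b z), i.e. zeta |-> (d zeta + b) / (c zeta + a).
    Where the denominator vanishes, the image is the point at infinity of the
    chart in use, that is the origin of the other chart; there the value is
    obtained by rewriting [f] in the other chart, e.g. at d - b z = 0, from
    f_1(w) = omega^(-q) f_2(omega), omega = (d - b z) / (c - a z):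
    (d - b z)^q f_1((a z - c) / (d - b z))
      = (c - a z)^q f_2((d - b z) / (c - a z)) = (c - a z)^q f_2(0). *)
Definition act (q : Z) (phi : SL2C) (f : local_data) : local_data :=
  let a := ma phi in let b := mb phi in let c := mc phi in let d := md phi in
  {| dom1 := fun z =>
       if Ceq_dec (d - b * z) 0 then dom2 f 0
       else dom1 f ((a * z - c) / (d - b * z));
     dom2 := fun zeta =>
       if Ceq_dec (c * zeta + a) 0 then dom1 f 0
       else dom2 f ((d * zeta + b) / (c * zeta + a));
     fun1 := fun z =>
       if Ceq_dec (d - b * z) 0 then Cpowz (c - a * z) q * fun2 f 0
       else Cpowz (d - b * z) q * fun1 f ((a * z - c) / (d - b * z));
     fun2 := fun zeta =>
       if Ceq_dec (c * zeta + a) 0 then Cpowz (d * zeta + b) q * fun1 f 0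
       else Cpowz (c * zeta + a) q * fun2 f ((d * zeta + b) / (c * zeta + a)) |}.

(** sum_{0 <= i, j <= N} a_ij(z) f^(i)(z) g^(j)(z); [sum_n u N] has N + 1 terms. *)
Definition bidiff_expr (N : nat) (a : nat -> nat -> C -> C) (f g : C -> C)
    (z : C) : C :=
  @sum_n C_AbelianMonoid (fun i =>
    @sum_n C_AbelianMonoid (fun j =>
      a i j z * C_derive_n f i z * C_derive_n g j z) N) N.

(** The coefficients [a], [b] are arbitrary functions: no regularity is asked of
    them beyond the fact that [P f g] is a (holomorphic) section of O(p). *)
Definition is_bidiff_pairing (q q' p : Z)
    (P : local_data -> local_data -> local_data) : Prop :=
  (forall f g, is_section q f -> is_section q' g ->
     is_section p (P f g) /\
     (forall z, dom1 (P f g) z <-> dom1 f z /\ dom1 g z) /\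
     (forall zeta, dom2 (P f g) zeta <-> dom2 f zeta /\ dom2 g zeta)) /\
  exists (N : nat) (a b : nat -> nat -> C -> C),
    forall f g, is_section q f -> is_section q' g ->
      (forall z, dom1 (P f g) z ->
         fun1 (P f g) z = bidiff_expr N a (fun1 f) (fun1 g) z) /\
      (forall zeta, dom2 (P f g) zeta ->
         fun2 (P f g) zeta = bidiff_expr N b (fun2 f) (fun2 g) zeta).

Definition is_invariant (q q' p : Z)
    (P : local_data -> local_data -> local_data) : Prop :=
  forall (phi : SL2C) (f g : local_data), is_section q f -> is_section q' g ->
    sec_eq (P (act q phi f) (act q' phi g)) (act p phi (P f g)).

Definition is_invariant_pairing_of_order (M : nat) (q q' p : Z)
    (P : local_data -> local_data -> local_data) : Prop :=
  is_bidiff_pairing q q' p P /\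
  is_invariant q q' p P /\
  p = (q + q' - 2 * Z.of_nat M)%Z.

Definition is_nonzero_pairing (q q' : Z)
    (P : local_data -> local_data -> local_data) : Prop :=
  exists f g, is_section q f /\ is_section q' g /\
    ((exists z, dom1 (P f g) z /\ fun1 (P f g) z <> 0) \/
     (exists zeta, dom2 (P f g) zeta /\ fun2 (P f g) zeta <> 0)).

(** prod_{i = m}^{n - 1} u i, equal to 1 when n <= m. *)
Definition prod_range (m n : nat) (u : nat -> R) : R :=
  fold_right Rmult 1%R (map u (seq m (n - m))).

Definition gamma (q q' : Z) (M j : nat) : R :=
  ((-1) ^ j * Binomial.C M j
   * prod_range j M (fun i => IZR q - INR i)
   * prod_range (M - j) M (fun i => IZR q' - INR i))%R.

Definition transvectant_expr (q q' : Z) (M : nat) (f g : C -> C) (z : C) : C :=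
  @sum_n C_AbelianMonoid (fun j =>
    RtoC (gamma q q' M j) * C_derive_n f j z * C_derive_n g (M - j) z) M.

Definition transvectant (q q' : Z) (M : nat) (f g : local_data) : local_data :=
  {| dom1 := fun z => dom1 f z /\ dom1 g z;
     dom2 := fun zeta => dom2 f zeta /\ dom2 g zeta;
     fun1 := transvectant_expr q q' M (fun1 f) (fun1 g);
     fun2 := transvectant_expr q q' M (fun2 f) (fun2 g) |}.

(* Main.v *)
Require Import Defs.
From Stdlib Require Import Reals ZArith Lra Lia List Classical ClassicalEpsilon.
From Coquelicot Require Import Coquelicot.

(** A section of O(q) is a function H on an open cone in C^2 minus the origin,
    homogeneous of degree q, with f_1(z) = H(z, 1) and f_2(zeta) = H(-1, zeta)
    ([hom_fun]).  In these terms SL_2 acts by linear substitution, and the two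
    charts, the transition map and the points sent to infinity all amount to
    restricting H to an affine line t |-> (al t + be, ga t + de) of determinant
    al de - be ga = 1.  Gluing and invariance of the transvectant T thus become
    a single change of variable: if F(t) = (ga t + de)^q f(w(t)) and
    G(t) = (ga t + de)^q' g(w(t)) with w = (al t + be) / (ga t + de), then
    T(F, G) = (ga t + de)^(q + q' - 2M) T(f, g)(w)  ([transvectant_moebius]).

    To prove it, use w' = (ga t + de)^(-2): by induction F^(k) is the sum of
    A(k,i) ga^(k-i) (ga t + de)^(q-k-i) f^(i)(w) over i <= k
    ([moebius_derive_n]), where A(k,i) = binom(k,i) (q-i) ... (q-k+1)
    ([moebius_coef_explicit]).  In T(F, G) the coefficient of f^(i) g^(l) is
    then, up to powers of ga t + de and ga, the sum over j of
    gamma_j A(j,i) A'(M-j,l).  The products over q and q' in gamma_j complete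
    those in A and A' to products independent of j, and what remains is an
    alternating sum of binomial coefficients of M-i-l.  It vanishes unless
    i + l = M ([gamma_coef_sum]).

    For uniqueness, an invariant pairing is tested on the monomials (z - w)^k.
    Translations force constant coefficients, the dilation z |-> z/4 kills those
    with i + j <> M, and z |-> z/(z + 1) gives
    (j+1)(q-j) c_(j+1) + (M-j)(q'-(M-j-1)) c_j = 0
    for the coefficient c_j of f^(j) g^(M-j) ([invariant_coefficients]).  If q is
    not in {0, ..., M-1} the first factor never vanishes and c_0 determines c;
    if q' is not, the second never vanishes and c_M does.  The sequence gamma
    solves the recurrence, and its entry in question is nonzero, so c is
    a multiple of gamma ([recurrence_proportional]).

    Sections are only assumed complex differentiable, so that T(f, g) is even
    defined because the derivative of a holomorphic function is holomorphic
    ([holomorphic_derive]).  By Goursat's bisection argument ([goursat]) and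
    removal of a point of continuity, f(z) K(z) is the integral of f(w)/(w - z)
    around a square, K(z) being that of 1/(w - z) ([cauchy_formula]).  Both
    integrals can be differentiated twice under the integral sign, and K does
    not vanish at the centre ([frame_kernel_integral_neq_0]), so f is, near the
    centre, a quotient of twice differentiable functions. *)

Local Open Scope C_scope.

(** * Complex derivatives and the modulus *)

Notation is_Cderive := (@is_derive C_AbsRing C_NormedModule).
Notation ex_Cderive := (@ex_derive C_AbsRing C_NormedModule).
Notation Ccontinuous := (@continuous C_UniformSpace C_UniformSpace).

Lemma locally_Cmod (z : C) (P : C -> Prop) :
  locally (T := C_UniformSpace) z P <->
  exists d : R, (0 < d)%R /\ forall w, (Cmod (w - z) < d)%R -> P w.
Proof.
  rewrite (locally_C z P).
  split.
  - intros [d H]. exists d. split; [apply cond_pos|]. intros w Hw. apply H. exact Hw.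
  - intros [d [Hd H]]. exists (mkposreal d Hd). intros w Hw. apply H. exact Hw.
Qed.

(** The epsilon-delta form of the derivative, with the modulus on both sides; all
    estimates are made in this form. *)
Lemma is_Cderive_Cmod (f : C -> C) (z l : C) :
  is_Cderive f z l <->
  forall e : R, (0 < e)%R -> exists d : R, (0 < d)%R /\ forall w, (Cmod (w - z) < d)%R ->
    (Cmod (f w - f z - l * (w - z)) <= e * Cmod (w - z))%R.
Proof.
  split.
  - intros [_ H] e He.
    specialize (H z (fun P HP => HP) (mkposreal e He)).
    apply locally_C in H. apply (proj1 (locally_Cmod z _)) in H.
    destruct H as [d [Hd H]]. exists d. split; [exact Hd|].
    intros w Hw. specialize (H w Hw). simpl in H.
    change (norm (minus (minus (f w) (f z)) (scal (minus w z) l)))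
      with (Cmod ((f w - f z) - (w - z) * l)) in H.
    rewrite (Cmult_comm l). exact H.
  - intros H. split; [apply is_linear_scal_l|].
    intros x Hx e.
    apply (is_filter_lim_locally_unique (V := AbsRing_NormedModule C_AbsRing)) in Hx. subst x.
    apply locally_C. apply (proj2 (locally_Cmod z _)).
    destruct (H e (cond_pos e)) as [d [Hd H']]. exists d. split; [exact Hd|].
    intros w Hw. specialize (H' w Hw).
    change (Cmod ((f w - f z) - (w - z) * l) <= e * Cmod (w - z))%R.
    rewrite (Cmult_comm (w - z)). exact H'.
Qed.

Lemma Ccontinuous_Cmod (f : C -> C) (z : C) :
  Ccontinuous f z <->
  forall e : R, (0 < e)%R -> exists d : R, (0 < d)%R /\ forall w, (Cmod (w - z) < d)%R ->
    (Cmod (f w - f z) < e)%R.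
Proof.
  split.
  - intros H e He.
    specialize (H (fun w => Cmod (w - f z) < e)%R).
    apply (proj1 (locally_Cmod z _)). apply H.
    apply (proj2 (locally_Cmod (f z) _)). exists e. split; [exact He|]. tauto.
  - intros H P HP.
    apply (proj1 (locally_Cmod (f z) _)) in HP. destruct HP as [e [He HP]].
    apply (proj2 (locally_Cmod z _)).
    destruct (H e He) as [d [Hd H']]. exists d; split; [exact Hd|]. auto.
Qed.

Lemma ex_Cderive_continuous (f : C -> C) (z : C) :
  ex_Cderive f z -> Ccontinuous f z.
Proof.
  intros [l H]. apply Ccontinuous_Cmod. intros e He.
  destruct (proj1 (is_Cderive_Cmod f z l) H 1%R Rlt_0_1) as [d [Hd H']].
  assert (HK : (0 < Cmod l + 1)%R) by (pose proof (Cmod_ge_0 l); lra).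
  exists (Rmin d (e / (Cmod l + 1))). split.
  { apply Rmin_pos; [exact Hd|]. apply Rdiv_lt_0_compat; lra. }
  intros w Hw.
  specialize (H' w (Rlt_le_trans _ _ _ Hw (Rmin_l _ _))).
  pose proof (Rlt_le_trans _ _ _ Hw (Rmin_r _ _)) as Hw2.
  replace (f w - f z) with ((f w - f z - l * (w - z)) + l * (w - z)) by ring.
  eapply Rle_lt_trans; [apply Cmod_triangle|]. rewrite Cmod_mult.
  apply Rlt_div_r in Hw2; lra.
Qed.

Lemma is_Cderive_C_derive (f : C -> C) z : ex_Cderive f z -> is_Cderive f z (C_derive f z).
Proof. apply (C_derive_correct f z 0). Qed.

Lemma is_Cderive_ext_loc (f g : C -> C) z l :
  locally (T := C_UniformSpace) z (fun w => f w = g w) -> is_Cderive f z l -> is_Cderive g z l.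
Proof.
  intros H. apply is_derive_ext_loc. apply locally_C. exact H.
Qed.

Lemma is_Cderive_plus (f g : C -> C) z l m :
  is_Cderive f z l -> is_Cderive g z m -> is_Cderive (fun w => f w + g w) z (l + m).
Proof. intros; apply (is_derive_plus (V := C_NormedModule) f g z l m); assumption. Qed.

(** The uniform structure of the absolute value and the product structure on the
    target give the same derivatives, since both use the modulus as norm. *)
Lemma is_Cderive_ring (f : C -> C) (z l : C) :
  @is_derive C_AbsRing (AbsRing_NormedModule C_AbsRing) f z l <-> is_Cderive f z l.
Proof.
  split; intros [_ H]; (split; [apply is_linear_scal_l | exact H]).
Qed.

Lemma is_Cderive_mult (f g : C -> C) z l m :
  is_Cderive f z l -> is_Cderive g z m ->
  is_Cderive (fun w => f w * g w) z (l * g z + f z * m).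
Proof.
  intros Hf Hg.
  apply is_Cderive_ring.
  apply (is_derive_mult (K := C_AbsRing) f g z l m);
    [now apply is_Cderive_ring | now apply is_Cderive_ring | exact Cmult_comm].
Qed.

Lemma is_Cderive_const (c z : C) : is_Cderive (fun _ => c) z (RtoC 0).
Proof. apply (is_derive_const (V := C_NormedModule)). Qed.

Lemma is_Cderive_id (z : C) : is_Cderive (fun w => w) z (RtoC 1).
Proof. apply is_Cderive_ring, (is_derive_id (K := C_AbsRing)). Qed.

Lemma is_Cderive_comp (f g : C -> C) z l m :
  is_Cderive f (g z) l -> is_Cderive g z m ->
  is_Cderive (fun w => f (g w)) z (m * l).
Proof.
  intros Hf Hg. apply (is_derive_comp (V := C_NormedModule) f g z l m Hf).
  now apply is_Cderive_ring.
Qed.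

Lemma is_Cderive_minus (f g : C -> C) z l m :
  is_Cderive f z l -> is_Cderive g z m -> is_Cderive (fun w => f w - g w) z (l - m).
Proof. intros; apply (is_derive_minus (V := C_NormedModule) f g z l m); assumption. Qed.

Lemma is_Cderive_cmult (c : C) (f : C -> C) z l :
  is_Cderive f z l -> is_Cderive (fun w => c * f w) z (c * l).
Proof.
  intros H. replace (c * l) with (0 * f z + c * l) by ring.
  apply (is_Cderive_mult (fun _ => c) f); [apply is_Cderive_const | exact H].
Qed.

Lemma is_Cderive_inv (z : C) : z <> 0 -> is_Cderive Cinv z (- / (z * z)).
Proof.
  intros Hz. apply is_Cderive_Cmod. intros e He.
  pose proof (proj1 (Cmod_gt_0 z) Hz) as Hm. set (m := Cmod z) in *.
  exists (Rmin (m / 2) (e * m * m * m / 2)). split.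
  { assert (0 < e * m * m * m)%R by (repeat apply Rmult_lt_0_compat; assumption).
    apply Rmin_pos; lra. }
  intros w Hw.
  pose proof (Rlt_le_trans _ _ _ Hw (Rmin_l _ _)) as H1.
  pose proof (Rlt_le_trans _ _ _ Hw (Rmin_r _ _)) as H2. clear Hw.
  assert (Hw2 : (m / 2 < Cmod w)%R).
  { assert (m <= Cmod w + Cmod (w - z))%R; [|lra].
    unfold m. rewrite <- (Cmod_opp (w - z)).
    replace z with (w + - (w - z)) at 1 by ring. apply Cmod_triangle. }
  assert (Hw0 : w <> 0) by (apply Cmod_gt_0; lra).
  replace (/ w - / z - - / (z * z) * (w - z)) with ((w - z) * (w - z) * / (w * (z * z)))
    by (field; auto).
  rewrite !Cmod_mult, Cmod_inv, !Cmod_mult; [|repeat apply Cmult_neq_0; assumption].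
  fold m. set (h := Cmod (w - z)) in *. set (k := Cmod w) in *.
  assert (0 <= h)%R by apply Cmod_ge_0.
  rewrite (Rmult_comm e), Rmult_assoc. apply Rmult_le_compat_l; [assumption|].
  assert (0 < k * (m * m))%R by (repeat apply Rmult_lt_0_compat; lra).
  apply Rle_div_l; [lra|].
  apply Rle_trans with (e * m * m * m / 2)%R; [lra|].
  replace (e * m * m * m / 2)%R with (e * ((m / 2) * (m * m)))%R by field.
  apply Rmult_le_compat_l; [lra|]. apply Rmult_le_compat_r; [nra|lra].
Qed.

Lemma is_Cderive_eq (f : C -> C) (z l m : C) : is_Cderive f z l -> l = m -> is_Cderive f z m.
Proof. now intros H <-. Qed.

(** * Integrals along horizontal and vertical segments *)

Notation is_CInt := (@is_RInt C_R_NormedModule).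
Notation CInt := (@RInt C_R_CompleteNormedModule).
Notation path_continuous := (@continuous R_UniformSpace C_UniformSpace).
Notation path_derive := (@is_derive R_AbsRing C_R_NormedModule).

Lemma CInt_correct (f : R -> C) (a b : R) :
  (a <= b)%R -> (forall t, (a <= t <= b)%R -> path_continuous f t) ->
  is_CInt f a b (CInt f a b).
Proof.
  intros Hab H. apply (RInt_correct (V := C_R_CompleteNormedModule)).
  apply (ex_RInt_continuous (V := C_R_CompleteNormedModule)).
  rewrite Rmin_left, Rmax_right by assumption. exact H.
Qed.

Lemma is_CInt_unique (f : R -> C) (a b : R) (l : C) :
  is_CInt f a b l -> CInt f a b = l.
Proof. apply (is_RInt_unique (V := C_R_CompleteNormedModule)). Qed.

Lemma is_CInt_minus (f g : R -> C) a b l m :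
  is_CInt f a b l -> is_CInt g a b m -> is_CInt (fun t => f t - g t) a b (l - m).
Proof. apply (is_RInt_minus (V := C_R_NormedModule)). Qed.

Lemma is_CInt_fst (f : R -> C) a b l :
  is_CInt f a b l -> is_RInt (fun t => fst (f t)) a b (fst l).
Proof. apply (is_RInt_fct_extend_fst (U := R_NormedModule) (V := R_NormedModule)). Qed.

Lemma is_CInt_snd (f : R -> C) a b l :
  is_CInt f a b l -> is_RInt (fun t => snd (f t)) a b (snd l).
Proof. apply (is_RInt_fct_extend_snd (U := R_NormedModule) (V := R_NormedModule)). Qed.

Lemma is_CInt_cmult (c : C) (f : R -> C) a b l :
  is_CInt f a b l -> is_CInt (fun t => c * f t) a b (c * l).
Proof.
  intros H. pose proof (is_CInt_fst _ _ _ _ H) as H1. pose proof (is_CInt_snd _ _ _ _ H) as H2.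
  apply (is_RInt_fct_extend_pair (U := R_NormedModule) (V := R_NormedModule)); simpl.
  - apply (is_RInt_minus (V := R_NormedModule));
      apply (is_RInt_scal (V := R_NormedModule)); assumption.
  - apply (is_RInt_plus (V := R_NormedModule));
      apply (is_RInt_scal (V := R_NormedModule)); assumption.
Qed.

Lemma is_CInt_bound (f : R -> C) a b l (K : R) :
  (a <= b)%R -> (forall t, (a <= t <= b)%R -> (Cmod (f t) <= K)%R) -> is_CInt f a b l ->
  (Cmod l <= (b - a) * K)%R.
Proof.
  intros Hab HK H. rewrite Cmod_norm.
  apply (norm_RInt_le_const (V := C_R_NormedModule) f a b l K Hab); [|exact H].
  intros t Ht. rewrite <- Cmod_norm. auto.
Qed.

Definition in_rect (x1 x2 y1 y2 : R) (w : C) : Prop :=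
  (x1 <= fst w <= x2 /\ y1 <= snd w <= y2)%R.

Definition hpath (f : C -> C) (y t : R) : C := f (t, y).
Definition vpath (f : C -> C) (x t : R) : C := f (x, t).

Lemma hpath_continuous (f : C -> C) (x y : R) :
  Ccontinuous f (x, y) -> path_continuous (hpath f y) x.
Proof.
  intros H.
  apply (continuous_comp (U := R_UniformSpace) (V := C_UniformSpace) (W := C_UniformSpace)
    (fun t => (t, y)) f x); [|exact H].
  apply (continuous_comp_2 (U := R_UniformSpace) (V := R_UniformSpace) (W := R_UniformSpace) (X := C_UniformSpace)
    (fun t => t) (fun _ => y) (fun a b => (a, b))).
  - apply continuous_id.
  - apply continuous_const.
  - apply (continuous_ext (U := prod_UniformSpace R_UniformSpace R_UniformSpace) (fun p => p)).
    + now intros [].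
    + apply continuous_id.
Qed.

Lemma vpath_continuous (f : C -> C) (x y : R) :
  Ccontinuous f (x, y) -> path_continuous (vpath f x) y.
Proof.
  intros H.
  apply (continuous_comp (U := R_UniformSpace) (V := C_UniformSpace) (W := C_UniformSpace)
    (fun t => (x, t)) f y); [|exact H].
  apply (continuous_comp_2 (U := R_UniformSpace) (V := R_UniformSpace) (W := R_UniformSpace) (X := C_UniformSpace)
    (fun _ => x) (fun t => t) (fun a b => (a, b))).
  - apply continuous_const.
  - apply continuous_id.
  - apply (continuous_ext (U := prod_UniformSpace R_UniformSpace R_UniformSpace) (fun p => p)).
    + now intros [].
    + apply continuous_id.
Qed.

(** Chain rule along a line with direction [v]: it turns complex primitives into
    real-variable ones, to which the fundamental theorem applies. *)
Lemma path_derive_line (F : C -> C) (l p v : C) (g : R -> C) (t : R) :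
  (forall s, g s = p + s * v) ->
  is_Cderive F (g t) l -> path_derive (fun s => F (g s)) t (v * l).
Proof.
  intros Hg HF.
  split; [apply is_linear_scal_l|].
  intros t' Ht' e.
  apply (is_filter_lim_locally_unique (V := AbsRing_NormedModule R_AbsRing)) in Ht'. subst t'.
  destruct (proj1 (is_Cderive_Cmod F (g t) l) HF (e / (Cmod v + 1))%R) as [d [Hd H]].
  { apply Rdiv_lt_0_compat; [apply cond_pos|]. pose proof (Cmod_ge_0 v); lra. }
  pose proof (Cmod_ge_0 v) as Hv0.
  assert (Hd' : (0 < d / (Cmod v + 1))%R) by (apply Rdiv_lt_0_compat; lra).
  exists (mkposreal _ Hd'). intros s Hs.
  change (Rabs (s - t) < d / (Cmod v + 1))%R in Hs.
  assert (Hd1 : g s - g t = RtoC (s - t) * v).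
  { rewrite !Hg, RtoC_minus. ring. }
  assert (Hm : Cmod (g s - g t) = (Rabs (s - t) * Cmod v)%R).
  { rewrite Hd1, Cmod_mult, Cmod_R. reflexivity. }
  specialize (H (g s)). rewrite Hm in H.
  pose proof (Rabs_pos (s - t)) as Hp.
  assert (Hlt : (Rabs (s - t) * Cmod v < d)%R).
  { apply Rlt_div_r in Hs; [|lra]. nra. }
  specialize (H Hlt).
  change (@norm R_AbsRing C_R_NormedModule
    (minus (minus (F (g s)) (F (g t))) (scal (s - t)%R (v * l)%C)) <= e * Rabs (s - t))%R.
  rewrite <- Cmod_norm. rewrite scal_R_Cmult.
  change (Cmod ((F (g s) - F (g t)) - RtoC (s - t) * (v * l))%C <= e * Rabs (s - t))%R.
  replace (RtoC (s - t) * (v * l)) with (l * (g s - g t)) by (rewrite Hd1; ring).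
  eapply Rle_trans; [exact H|].
  pose proof (cond_pos e).
  unfold Rdiv. rewrite Rmult_assoc. apply Rmult_le_compat_l; [lra|].
  rewrite Rmult_comm. apply Rle_div_l; [lra|]. nra.
Qed.

(** * Integrals around rectangles and Goursat's theorem *)

Lemma Cmod_Ci : Cmod Ci = 1%R.
Proof.
  unfold Cmod, Ci; simpl. replace (0 * (0 * 1) + 1 * (1 * 1))%R with 1%R by ring. apply sqrt_1.
Qed.

Lemma RtoC_neq_0 (r : R) : r <> 0%R -> RtoC r <> 0.
Proof. intros H E. apply H. now apply RtoC_inj. Qed.

(** The integral of f(w) dw counterclockwise around the boundary of a rectangle;
    on vertical sides dw = i dy. *)
Definition rect_int (f : C -> C) (x1 x2 y1 y2 : R) : C :=
  CInt (hpath f y1) x1 x2 + Ci * CInt (vpath f x2) y1 y2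
  - CInt (hpath f y2) x1 x2 - Ci * CInt (vpath f x1) y1 y2.

Definition rect_continuous (f : C -> C) (x1 x2 y1 y2 : R) : Prop :=
  forall w, in_rect x1 x2 y1 y2 w -> Ccontinuous f w.

Lemma hpath_int (f : C -> C) x1 x2 y1 y2 a b y :
  rect_continuous f x1 x2 y1 y2 -> (x1 <= a)%R -> (a <= b)%R -> (b <= x2)%R -> (y1 <= y <= y2)%R ->
  is_CInt (hpath f y) a b (CInt (hpath f y) a b).
Proof.
  intros H Ha Hab Hb Hy. apply CInt_correct; [assumption|].
  intros t Ht. apply hpath_continuous, H. split; simpl; lra.
Qed.

Lemma vpath_int (f : C -> C) x1 x2 y1 y2 a b x :
  rect_continuous f x1 x2 y1 y2 -> (y1 <= a)%R -> (a <= b)%R -> (b <= y2)%R -> (x1 <= x <= x2)%R ->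
  is_CInt (vpath f x) a b (CInt (vpath f x) a b).
Proof.
  intros H Ha Hab Hb Hy. apply CInt_correct; [assumption|].
  intros t Ht. apply vpath_continuous, H. split; simpl; lra.
Qed.

Lemma CInt_Chasles (f : R -> C) a b c l m :
  is_CInt f a b l -> is_CInt f b c m -> CInt f a c = l + m.
Proof.
  intros H1 H2. apply is_CInt_unique.
  apply (is_RInt_Chasles (V := C_R_NormedModule) f a b c l m H1 H2).
Qed.

Lemma rect_int_split_x (f : C -> C) x1 xm x2 y1 y2 :
  (x1 <= xm)%R -> (xm <= x2)%R -> (y1 <= y2)%R -> rect_continuous f x1 x2 y1 y2 ->
  rect_int f x1 x2 y1 y2 = rect_int f x1 xm y1 y2 + rect_int f xm x2 y1 y2.
Proof.
  intros H1 H2 Hy H. unfold rect_int.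
  rewrite (CInt_Chasles (hpath f y1) x1 xm x2 _ _
    (hpath_int f x1 x2 y1 y2 x1 xm y1 H ltac:(lra) H1 H2 ltac:(lra))
    (hpath_int f x1 x2 y1 y2 xm x2 y1 H H1 H2 ltac:(lra) ltac:(lra))).
  rewrite (CInt_Chasles (hpath f y2) x1 xm x2 _ _
    (hpath_int f x1 x2 y1 y2 x1 xm y2 H ltac:(lra) H1 H2 ltac:(lra))
    (hpath_int f x1 x2 y1 y2 xm x2 y2 H H1 H2 ltac:(lra) ltac:(lra))).
  ring.
Qed.

Lemma rect_int_split_y (f : C -> C) x1 x2 y1 ym y2 :
  (x1 <= x2)%R -> (y1 <= ym)%R -> (ym <= y2)%R -> rect_continuous f x1 x2 y1 y2 ->
  rect_int f x1 x2 y1 y2 = rect_int f x1 x2 y1 ym + rect_int f x1 x2 ym y2.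
Proof.
  intros Hx H1 H2 H. unfold rect_int.
  rewrite (CInt_Chasles (vpath f x1) y1 ym y2 _ _
    (vpath_int f x1 x2 y1 y2 y1 ym x1 H ltac:(lra) H1 H2 ltac:(lra))
    (vpath_int f x1 x2 y1 y2 ym y2 x1 H H1 H2 ltac:(lra) ltac:(lra))).
  rewrite (CInt_Chasles (vpath f x2) y1 ym y2 _ _
    (vpath_int f x1 x2 y1 y2 y1 ym x2 H ltac:(lra) H1 H2 ltac:(lra))
    (vpath_int f x1 x2 y1 y2 ym y2 x2 H H1 H2 ltac:(lra) ltac:(lra))).
  ring.
Qed.

(** Linearity and bounds are stated for functions continuous at the boundary only,
    because the Cauchy kernel 1/(w - z) has its pole inside. *)
Definition on_frame (x1 x2 y1 y2 : R) (w : C) : Prop :=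
  in_rect x1 x2 y1 y2 w /\ (fst w = x1 \/ fst w = x2 \/ snd w = y1 \/ snd w = y2).

Definition frame_continuous (f : C -> C) (x1 x2 y1 y2 : R) : Prop :=
  forall w, on_frame x1 x2 y1 y2 w -> Ccontinuous f w.

Lemma rect_frame_continuous (f : C -> C) x1 x2 y1 y2 :
  rect_continuous f x1 x2 y1 y2 -> frame_continuous f x1 x2 y1 y2.
Proof. intros H w [Hw _]. now apply H. Qed.

Lemma hframe_int (f : C -> C) x1 x2 y1 y2 y :
  (x1 <= x2)%R -> (y1 <= y2)%R -> frame_continuous f x1 x2 y1 y2 -> y = y1 \/ y = y2 ->
  is_CInt (hpath f y) x1 x2 (CInt (hpath f y) x1 x2).
Proof.
  intros Hx Hy H Hy'. apply CInt_correct; [assumption|].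
  intros t Ht. apply hpath_continuous, H. split; [split|]; simpl; intuition lra.
Qed.

Lemma vframe_int (f : C -> C) x1 x2 y1 y2 x :
  (x1 <= x2)%R -> (y1 <= y2)%R -> frame_continuous f x1 x2 y1 y2 -> x = x1 \/ x = x2 ->
  is_CInt (vpath f x) y1 y2 (CInt (vpath f x) y1 y2).
Proof.
  intros Hx Hy H Hx'. apply CInt_correct; [assumption|].
  intros t Ht. apply vpath_continuous, H. split; [split|]; simpl; intuition lra.
Qed.

Lemma rect_int_ext (f g : C -> C) x1 x2 y1 y2 :
  (x1 <= x2)%R -> (y1 <= y2)%R ->
  (forall w, on_frame x1 x2 y1 y2 w -> f w = g w) ->
  rect_int f x1 x2 y1 y2 = rect_int g x1 x2 y1 y2.
Proof.
  intros Hx Hy H. unfold rect_int.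
  assert (Eh : forall y, y = y1 \/ y = y2 -> CInt (hpath f y) x1 x2 = CInt (hpath g y) x1 x2).
  { intros y Hy'. apply (RInt_ext (V := C_R_CompleteNormedModule)).
    rewrite Rmin_left, Rmax_right by assumption.
    intros t Ht. apply H. split; [split|]; simpl; intuition lra. }
  assert (Ev : forall x, x = x1 \/ x = x2 -> CInt (vpath f x) y1 y2 = CInt (vpath g x) y1 y2).
  { intros x Hx'. apply (RInt_ext (V := C_R_CompleteNormedModule)).
    rewrite Rmin_left, Rmax_right by assumption.
    intros t Ht. apply H. split; [split|]; simpl; intuition lra. }
  rewrite !Eh, !Ev by tauto. ring.
Qed.

Lemma rect_int_minus (f g : C -> C) x1 x2 y1 y2 :
  (x1 <= x2)%R -> (y1 <= y2)%R -> frame_continuous f x1 x2 y1 y2 -> frame_continuous g x1 x2 y1 y2 ->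
  rect_int (fun w => f w - g w) x1 x2 y1 y2 = rect_int f x1 x2 y1 y2 - rect_int g x1 x2 y1 y2.
Proof.
  intros Hx Hy Hf Hg. unfold rect_int.
  assert (Eh : forall y, y = y1 \/ y = y2 -> CInt (hpath (fun w => f w - g w) y) x1 x2
     = CInt (hpath f y) x1 x2 - CInt (hpath g y) x1 x2).
  { intros y Hy'. apply is_CInt_unique.
    apply (is_CInt_minus (hpath f y) (hpath g y)); apply (hframe_int _ x1 x2 y1 y2); assumption. }
  assert (Ev : forall x, x = x1 \/ x = x2 -> CInt (vpath (fun w => f w - g w) x) y1 y2
     = CInt (vpath f x) y1 y2 - CInt (vpath g x) y1 y2).
  { intros x Hx'. apply is_CInt_unique.
    apply (is_CInt_minus (vpath f x) (vpath g x)); apply (vframe_int _ x1 x2 y1 y2); assumption. }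
  rewrite !Eh, !Ev by tauto. ring.
Qed.

Lemma rect_int_cmult (c : C) (f : C -> C) x1 x2 y1 y2 :
  (x1 <= x2)%R -> (y1 <= y2)%R -> frame_continuous f x1 x2 y1 y2 ->
  rect_int (fun w => c * f w) x1 x2 y1 y2 = c * rect_int f x1 x2 y1 y2.
Proof.
  intros Hx Hy Hf. unfold rect_int.
  assert (Eh : forall y, y = y1 \/ y = y2 -> CInt (hpath (fun w => c * f w) y) x1 x2
     = c * CInt (hpath f y) x1 x2).
  { intros y Hy'. apply is_CInt_unique.
    apply (is_CInt_cmult c (hpath f y)); apply (hframe_int _ x1 x2 y1 y2); assumption. }
  assert (Ev : forall x, x = x1 \/ x = x2 -> CInt (vpath (fun w => c * f w) x) y1 y2
     = c * CInt (vpath f x) y1 y2).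
  { intros x Hx'. apply is_CInt_unique.
    apply (is_CInt_cmult c (vpath f x)); apply (vframe_int _ x1 x2 y1 y2); assumption. }
  rewrite !Eh, !Ev by tauto. ring.
Qed.

Lemma rect_int_bound (f : C -> C) x1 x2 y1 y2 (K : R) :
  (x1 <= x2)%R -> (y1 <= y2)%R -> frame_continuous f x1 x2 y1 y2 ->
  (forall w, on_frame x1 x2 y1 y2 w -> (Cmod (f w) <= K)%R) ->
  (Cmod (rect_int f x1 x2 y1 y2) <= 2 * ((x2 - x1) + (y2 - y1)) * K)%R.
Proof.
  intros Hx Hy Hf HK. unfold rect_int.
  assert (Eh : forall y, y = y1 \/ y = y2 -> (Cmod (CInt (hpath f y) x1 x2) <= (x2 - x1) * K)%R).
  { intros y Hy'. apply (is_CInt_bound (hpath f y)); [assumption| |apply (hframe_int _ x1 x2 y1 y2); assumption].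
    intros t Ht. apply HK. split; [split|]; simpl; intuition lra. }
  assert (Ev : forall x, x = x1 \/ x = x2 -> (Cmod (Ci * CInt (vpath f x) y1 y2) <= (y2 - y1) * K)%R).
  { intros x Hx'. rewrite Cmod_mult, Cmod_Ci, Rmult_1_l.
    apply (is_CInt_bound (vpath f x)); [assumption| |apply (vframe_int _ x1 x2 y1 y2); assumption].
    intros t Ht. apply HK. split; [split|]; simpl; intuition lra. }
  pose proof (Eh y1 ltac:(tauto)). pose proof (Eh y2 ltac:(tauto)).
  pose proof (Ev x1 ltac:(tauto)). pose proof (Ev x2 ltac:(tauto)).
  unfold Cminus.
  eapply Rle_trans; [apply Cmod_triangle|]. rewrite Cmod_opp.
  eapply Rle_trans; [apply Rplus_le_compat_r, Cmod_triangle|]. rewrite Cmod_opp.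
  eapply Rle_trans; [apply Rplus_le_compat_r, Rplus_le_compat_r, Cmod_triangle|].
  lra.
Qed.

(** The four sides telescope: each contributes the difference of the primitive at
    two corners. *)
Lemma rect_int_primitive (F f : C -> C) x1 x2 y1 y2 :
  (x1 <= x2)%R -> (y1 <= y2)%R -> rect_continuous f x1 x2 y1 y2 ->
  (forall w, in_rect x1 x2 y1 y2 w -> is_Cderive F w (f w)) ->
  rect_int f x1 x2 y1 y2 = 0.
Proof.
  intros Hx Hy Hf HF. unfold rect_int.
  assert (Eh : forall y, (y1 <= y <= y2)%R -> CInt (hpath f y) x1 x2 = F (x2, y) - F (x1, y)).
  { intros y Hy'. apply is_CInt_unique.
    apply (is_RInt_derive (V := C_R_CompleteNormedModule) (fun t => F (t, y)) (hpath f y));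
      rewrite Rmin_left, Rmax_right by assumption; intros t Ht.
    - pose proof (path_derive_line F (f (t, y)) (0, y)%R 1 (fun t => (t, y)) t) as P.
      rewrite Cmult_1_l in P. apply P.
      + intros s. unfold Cplus, Cmult, RtoC; simpl. f_equal; ring.
      + apply HF. split; simpl; lra.
    - apply hpath_continuous, Hf. split; simpl; lra. }
  assert (Ev : forall x, (x1 <= x <= x2)%R -> Ci * CInt (vpath f x) y1 y2 = F (x, y2) - F (x, y1)).
  { intros x Hx'. rewrite <- (is_CInt_unique (fun t => Ci * vpath f x t) y1 y2 (Ci * CInt (vpath f x) y1 y2)).
    2: { apply is_CInt_cmult. eapply vpath_int; try eassumption; lra. }
    apply is_CInt_unique.
    apply (is_RInt_derive (V := C_R_CompleteNormedModule) (fun t => F (x, t)) (fun t => Ci * vpath f x t));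
      rewrite Rmin_left, Rmax_right by assumption; intros t Ht.
    - apply (path_derive_line F (f (x, t)) (x, 0)%R Ci (fun t => (x, t)) t).
      + intros s. unfold Cplus, Cmult, RtoC, Ci; simpl. f_equal; ring.
      + apply HF. split; simpl; lra.
    - apply (vpath_continuous (fun w => Ci * f w)).
      assert (Hc : Ccontinuous f (x, t)) by (apply Hf; split; simpl; lra).
      apply (continuous_comp (U := C_UniformSpace) (V := C_UniformSpace) (W := C_UniformSpace) f (fun w => Ci * w)); [exact Hc|].
      apply ex_Cderive_continuous. exists (Ci * 1). apply is_Cderive_cmult, is_Cderive_id. }
  rewrite !Eh, !Ev by lra. ring.
Qed.

Lemma sub_rect_continuous (f : C -> C) x1 x2 y1 y2 a1 a2 b1 b2 :
  rect_continuous f x1 x2 y1 y2 -> (x1 <= a1)%R -> (a2 <= x2)%R -> (y1 <= b1)%R -> (b2 <= y2)%R ->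
  rect_continuous f a1 a2 b1 b2.
Proof. intros H ? ? ? ? w [Hw1 Hw2]. apply H. split; lra. Qed.

(** The bisection argument behind compactness: if a property can be assembled from
    the four quarters but fails for the whole rectangle, it fails for a nested
    sequence of quarters, which shrinks to a point and contradicts the local
    hypothesis there. *)
Lemma rect_induction (P : R -> R -> R -> R -> Prop) (x1 x2 y1 y2 : R) :
  (x1 <= x2)%R -> (y1 <= y2)%R ->
  (forall a1 a2 b1 b2,
     (x1 <= a1)%R -> (a1 <= a2)%R -> (a2 <= x2)%R -> (y1 <= b1)%R -> (b1 <= b2)%R -> (b2 <= y2)%R ->
     P a1 ((a1 + a2) / 2) b1 ((b1 + b2) / 2) -> P ((a1 + a2) / 2) a2 b1 ((b1 + b2) / 2) ->
     P a1 ((a1 + a2) / 2) ((b1 + b2) / 2) b2 -> P ((a1 + a2) / 2) a2 ((b1 + b2) / 2) b2 ->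
     P a1 a2 b1 b2)%R ->
  (forall px py, (x1 <= px <= x2)%R -> (y1 <= py <= y2)%R ->
     exists d, (0 < d)%R /\ forall a1 a2 b1 b2,
     (x1 <= a1)%R -> (a1 <= px <= a2)%R -> (a2 <= x2)%R -> (y1 <= b1)%R -> (b1 <= py <= b2)%R ->
     (b2 <= y2)%R ->
     (a2 - a1 < d)%R -> (b2 - b1 < d)%R -> P a1 a2 b1 b2) ->
  P x1 x2 y1 y2.
Proof.
  intros Hx Hy Hstep Hloc. apply NNPP. intros HN.
  set (w := (x2 - x1)%R). set (h := (y2 - y1)%R).
  (* lower left corners of n-th generation subrectangles on which [P] fails *)
  set (Q := fun (n : nat) (ab : R * R) =>
    (x1 <= fst ab)%R /\ (fst ab + w / 2 ^ n <= x2)%R /\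
    (y1 <= snd ab)%R /\ (snd ab + h / 2 ^ n <= y2)%R /\
    ~ P (fst ab) (fst ab + w / 2 ^ n)%R (snd ab) (snd ab + h / 2 ^ n)%R).
  assert (Hw : forall n, (0 <= w / 2 ^ n)%R).
  { intros n. apply Rcomplements.Rdiv_le_0_compat; [unfold w; lra|]. apply pow_lt; lra. }
  assert (Hh : forall n, (0 <= h / 2 ^ n)%R).
  { intros n. apply Rcomplements.Rdiv_le_0_compat; [unfold h; lra|]. apply pow_lt; lra. }
  assert (Ew : forall (k : R) n, (k / 2 ^ n = 2 * (k / 2 ^ (S n)))%R).
  { intros k n. simpl. field. apply pow_nonzero; lra. }
  assert (next : forall n ab, Q n ab -> exists ab',
    Q (S n) ab' /\ (fst ab <= fst ab' /\ fst ab' + w / 2 ^ (S n) <= fst ab + w / 2 ^ n)%R /\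
    (snd ab <= snd ab' /\ snd ab' + h / 2 ^ (S n) <= snd ab + h / 2 ^ n)%R).
  { intros n [a b] (Q1 & Q2 & Q3 & Q4 & Q5). simpl in Q1, Q2, Q3, Q4, Q5.
    apply NNPP. intros Hno. apply Q5.
    pose proof (Hw (S n)) as W1. pose proof (Hh (S n)) as W2.
    pose proof (Ew w n) as E1. pose proof (Ew h n) as E2.
    set (w' := (w / 2 ^ (S n))%R) in *. set (h' := (h / 2 ^ (S n))%R) in *.
    assert (Hno' : forall a' b', (a <= a' /\ a' + w' <= a + w / 2 ^ n)%R ->
      (b <= b' /\ b' + h' <= b + h / 2 ^ n)%R ->
      P a' (a' + w')%R b' (b' + h')%R).
    { intros a' b' Ha Hb. apply NNPP. intros HP. apply Hno. exists (a', b').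
      split; [unfold Q|]; cbn [fst snd]; fold w' h'; [|lra].
      repeat split; try lra. exact HP. }
    apply Hstep; try lra.
    - replace ((a + (a + w / 2 ^ n)) / 2)%R with (a + w')%R by lra.
      replace ((b + (b + h / 2 ^ n)) / 2)%R with (b + h')%R by lra.
      apply Hno'; lra.
    - replace ((a + (a + w / 2 ^ n)) / 2)%R with (a + w')%R by lra.
      replace ((b + (b + h / 2 ^ n)) / 2)%R with (b + h')%R by lra.
      replace (a + w / 2 ^ n)%R with (a + w' + w')%R by lra.
      apply Hno'; lra.
    - replace ((a + (a + w / 2 ^ n)) / 2)%R with (a + w')%R by lra.
      replace ((b + (b + h / 2 ^ n)) / 2)%R with (b + h')%R by lra.
      replace (b + h / 2 ^ n)%R with (b + h' + h')%R by lra.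
      apply Hno'; lra.
    - replace ((a + (a + w / 2 ^ n)) / 2)%R with (a + w')%R by lra.
      replace ((b + (b + h / 2 ^ n)) / 2)%R with (b + h')%R by lra.
      replace (a + w / 2 ^ n)%R with (a + w' + w')%R by lra.
      replace (b + h / 2 ^ n)%R with (b + h' + h')%R by lra.
      apply Hno'; lra. }
  (* a failing quarter is chosen at each step *)
  set (nxt := fun n ab => epsilon (inhabits (0, 0)%R) (fun ab' =>
    Q (S n) ab' /\ (fst ab <= fst ab' /\ fst ab' + w / 2 ^ (S n) <= fst ab + w / 2 ^ n)%R /\
    (snd ab <= snd ab' /\ snd ab' + h / 2 ^ (S n) <= snd ab + h / 2 ^ n)%R)).
  set (u := fix u n := match n with O => (x1, y1) | S n => nxt n (u n) end).
  assert (HQ : forall n, Q n (u n)).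
  { induction n as [|n IH].
    - unfold Q; simpl.
      replace (x1 + w / 1)%R with x2 by (unfold w; field).
      replace (y1 + h / 1)%R with y2 by (unfold h; field).
      repeat split; try lra. exact HN.
    - exact (proj1 (epsilon_spec (inhabits (0, 0)%R) _ (next n (u n) IH))). }
  assert (Hn : forall n,
    (fst (u n) <= fst (u (S n)) /\ fst (u (S n)) + w / 2 ^ (S n) <= fst (u n) + w / 2 ^ n)%R /\
    (snd (u n) <= snd (u (S n)) /\ snd (u (S n)) + h / 2 ^ (S n) <= snd (u n) + h / 2 ^ n)%R).
  { intros n. exact (proj2 (epsilon_spec (inhabits (0, 0)%R) _ (next n (u n) (HQ n)))). }
  (* nested intervals have a common point: the supremum of the left ends *)
  assert (nested : forall (s : nat -> R) (k : R),
    (forall n, 0 <= k / 2 ^ n)%R ->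
    (forall n, s n <= s (S n) /\ s (S n) + k / 2 ^ (S n) <= s n + k / 2 ^ n)%R ->
    exists p, forall n, (s n <= p <= s n + k / 2 ^ n)%R).
  { intros s k Hk Hs.
    assert (mono : forall n m, (s n <= s (n + m)%nat)%R /\
       (s (n + m)%nat + k / 2 ^ (n + m) <= s n + k / 2 ^ n)%R).
    { intros n m. induction m as [|m IH].
      - rewrite Nat.add_0_r. lra.
      - rewrite Nat.add_succ_r. specialize (Hs (n + m)%nat). lra. }
    assert (cross : forall n m, (s n <= s m + k / 2 ^ m)%R).
    { intros n m. destruct (Nat.le_ge_cases n m) as [L|L].
      - pose proof (mono n (m - n)%nat) as E. replace (n + (m - n))%nat with m in E by lia.
        specialize (Hk m). lra.
      - pose proof (mono m (n - m)%nat) as E. replace (m + (n - m))%nat with n in E by lia.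
        specialize (Hk n). lra. }
    destruct (completeness (fun x => exists n, x = s n)) as [p [Hp1 Hp2]].
    - exists (s 0%nat + k / 2 ^ 0)%R. intros x [n ->]. apply cross.
    - exists (s 0%nat). now exists 0%nat.
    - exists p. intros n. split.
      + apply Hp1. now exists n.
      + apply Hp2. intros x [m ->]. apply cross. }
  destruct (nested (fun n => fst (u n)) w Hw (fun n => proj1 (Hn n))) as [px Hpx].
  destruct (nested (fun n => snd (u n)) h Hh (fun n => proj2 (Hn n))) as [py Hpy].
  destruct (Hloc px py) as [d [Hd Hloc']].
  { specialize (Hpx 0%nat). simpl in Hpx. unfold w in Hpx. lra. }
  { specialize (Hpy 0%nat). simpl in Hpy. unfold h in Hpy. lra. }
  assert (small : exists n, (w / 2 ^ n < d)%R /\ (h / 2 ^ n < d)%R).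
  { assert (Hwh : (0 <= w + h)%R) by (unfold w, h; lra).
    destruct (pow_lt_1_zero (1 / 2) ltac:(rewrite Rabs_pos_eq; lra) (d / (w + h + 1)))
      as [n Hn2]; [apply Rdiv_lt_0_compat; lra|].
    exists n. specialize (Hn2 n (Nat.le_refl n)).
    assert (E : ((1 / 2) ^ n = / 2 ^ n)%R).
    { rewrite <- pow_inv. f_equal. lra. }
    rewrite E in Hn2.
    assert (H2 : (0 < / 2 ^ n)%R) by (apply Rinv_0_lt_compat, pow_lt; lra).
    rewrite Rabs_pos_eq in Hn2 by lra.
    apply Rlt_div_r in Hn2; [|lra].
    assert (0 <= w)%R by (unfold w; lra). assert (0 <= h)%R by (unfold h; lra).
    unfold Rdiv. split; nra. }
  destruct small as [n [Sw Sh]].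
  destruct (HQ n) as (Q1 & Q2 & Q3 & Q4 & Q5). apply Q5.
  apply Hloc'; try assumption; try lra; [apply Hpx|apply Hpy].
Qed.

Lemma in_rect_dist x1 x2 y1 y2 p w :
  in_rect x1 x2 y1 y2 p -> in_rect x1 x2 y1 y2 w ->
  (Cmod (w - p) <= (x2 - x1) + (y2 - y1))%R.
Proof.
  intros [H1 H2] [H3 H4].
  replace (w - p) with (RtoC (fst w - fst p) + Ci * RtoC (snd w - snd p)).
  2: { apply injective_projections; simpl; ring. }
  eapply Rle_trans; [apply Cmod_triangle|].
  rewrite Cmod_mult, !Cmod_R.
  rewrite Cmod_Ci.
  rewrite Rmult_1_l. apply Rplus_le_compat; apply Rabs_le; lra.
Qed.

(** Used to let an auxiliary size or an error tend to 0. *)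
Lemma eq_0_of_le_linear (a : R) (K : R) (s0 : R) :
  (0 < s0)%R -> (0 <= a)%R -> (forall s, (0 < s <= s0)%R -> (a <= K * s)%R) -> a = 0%R.
Proof.
  intros Hs Ha H. apply Rle_antisym; [|assumption]. apply Rnot_lt_le. intros Hp.
  assert (HK : (0 < K)%R).
  { specialize (H s0 ltac:(lra)). apply Rnot_le_lt. intros HK. nra. }
  assert (Hq : (0 < a / (2 * K))%R) by (apply Rdiv_lt_0_compat; lra).
  specialize (H (Rmin s0 (a / (2 * K)))).
  assert (H1 : (0 < Rmin s0 (a / (2 * K)) <= s0)%R).
  { split; [now apply Rmin_pos | apply Rmin_l]. }
  specialize (H H1).
  assert (H2 : (K * Rmin s0 (a / (2 * K)) <= K * (a / (2 * K)))%R).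
  { apply Rmult_le_compat_l; [lra|apply Rmin_r]. }
  replace (K * (a / (2 * K)))%R with (a / 2)%R in H2 by (field; lra). lra.
Qed.

(** The bound e (width + height)^2 passes from quarters to the whole because
    halving the sides divides it by four.  Near a point p it holds since f differs
    from an affine function, whose integral is 0, by at most e/2 |w - p|. *)
Lemma goursat (f : C -> C) x1 x2 y1 y2 :
  (x1 <= x2)%R -> (y1 <= y2)%R ->
  (forall w, in_rect x1 x2 y1 y2 w -> ex_Cderive f w) ->
  rect_int f x1 x2 y1 y2 = 0.
Proof.
  intros Hx Hy Hf.
  assert (Hc : rect_continuous f x1 x2 y1 y2).
  { intros w Hw. apply ex_Cderive_continuous, Hf, Hw. }
  assert (Hsmall : forall e, (0 < e)%R ->
    (Cmod (rect_int f x1 x2 y1 y2) <= e * (((x2 - x1) + (y2 - y1)) * ((x2 - x1) + (y2 - y1))))%R).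
  { intros e He.
    apply (rect_induction (fun a1 a2 b1 b2 =>
      (Cmod (rect_int f a1 a2 b1 b2) <= e * (((a2 - a1) + (b2 - b1)) * ((a2 - a1) + (b2 - b1))))%R)); try assumption.
    - intros a1 a2 b1 b2 ? ? ? ? ? ? P1 P2 P3 P4.
      set (am := ((a1 + a2) / 2)%R) in *. set (bm := ((b1 + b2) / 2)%R) in *.
      assert (a1 <= am <= a2)%R by (unfold am; lra).
      assert (b1 <= bm <= b2)%R by (unfold bm; lra).
      rewrite (rect_int_split_x f a1 am a2) by
        (try lra; apply (sub_rect_continuous f x1 x2 y1 y2); assumption || lra).
      rewrite (rect_int_split_y f a1 am b1 bm b2) by
        (try lra; apply (sub_rect_continuous f x1 x2 y1 y2); assumption || lra).
      rewrite (rect_int_split_y f am a2 b1 bm b2) by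
        (try lra; apply (sub_rect_continuous f x1 x2 y1 y2); assumption || lra).
      eapply Rle_trans; [apply Cmod_triangle|].
      eapply Rle_trans; [apply Rplus_le_compat; apply Cmod_triangle|].
      set (s := ((a2 - a1) + (b2 - b1))%R) in *.
      replace (am - a1 + (bm - b1))%R with (s / 2)%R in P1 by (unfold s, am, bm; lra).
      replace (a2 - am + (bm - b1))%R with (s / 2)%R in P2 by (unfold s, am, bm; lra).
      replace (am - a1 + (b2 - bm))%R with (s / 2)%R in P3 by (unfold s, am, bm; lra).
      replace (a2 - am + (b2 - bm))%R with (s / 2)%R in P4 by (unfold s, am, bm; lra).
      lra.
    - intros px py Hpx Hpy. pose (p := (px, py) : C).
      assert (Hl : exists l : C, is_Cderive f p l) by (apply Hf; split; assumption).
      destruct Hl as [l Hl].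
      destruct (proj1 (is_Cderive_Cmod f p l) Hl (e / 2)%R ltac:(lra)) as [d [Hd Hb]].
      exists (d / 2)%R. split; [lra|].
      intros a1 a2 b1 b2 ? ? ? ? ? ? Ha Hb'.
      (* the affine approximation, which has a quadratic primitive *)
      set (g := fun w => f p + l * (w - p)).
      assert (Hg : forall w, is_Cderive g w l).
      { intros w. unfold g. apply (is_Cderive_eq _ _ (0 + l * (1 - 0))); [|ring].
        apply is_Cderive_plus; [apply is_Cderive_const|].
        apply is_Cderive_cmult, is_Cderive_minus; [apply is_Cderive_id|apply is_Cderive_const]. }
      assert (Hgc : rect_continuous g a1 a2 b1 b2).
      { intros w _. apply ex_Cderive_continuous. exists l. apply Hg. }
      assert (Hfc : rect_continuous f a1 a2 b1 b2)
        by (apply (sub_rect_continuous f x1 x2 y1 y2); assumption || lra).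
      assert (Hg0 : rect_int g a1 a2 b1 b2 = 0).
      { apply (rect_int_primitive (fun w => f p * w + l * ((w - p) * (w - p) * / 2))); try lra; try assumption.
        intros w _. unfold g.
        apply (is_Cderive_eq _ _ (f p * 1 + l * (((1 - 0) * (w - p) + (w - p) * (1 - 0)) * / 2 + (w - p) * (w - p) * 0))).
        2: { field. }
        apply is_Cderive_plus; [apply is_Cderive_cmult, is_Cderive_id|].
        apply is_Cderive_cmult.
        apply (is_Cderive_mult (fun w => (w - p) * (w - p)) (fun _ => / 2)); [|apply is_Cderive_const].
        apply (is_Cderive_mult (fun w => w - p) (fun w => w - p));
          (apply is_Cderive_minus; [apply is_Cderive_id|apply is_Cderive_const]). }
      replace (rect_int f a1 a2 b1 b2) with (rect_int (fun w => f w - g w) a1 a2 b1 b2).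
      2: { rewrite rect_int_minus, Hg0 by (assumption || lra || now apply rect_frame_continuous). ring. }
      set (s := ((a2 - a1) + (b2 - b1))%R) in *.
      replace (e * (s * s))%R with (2 * s * (e / 2 * s))%R by field.
      apply rect_int_bound; try lra.
      + intros w [Hw _]. apply ex_Cderive_continuous.
        destruct (Hf w) as [m Hm]; [destruct Hw; split; lra|].
        exists (m - l). apply is_Cderive_minus; [exact Hm|apply Hg].
      + intros w [Hw _].
        assert (Hd' : (Cmod (w - p) <= s)%R).
        { apply in_rect_dist; [|exact Hw]. split; simpl; lra. }
        unfold g. replace (f w - (f p + l * (w - p))) with (f w - f p - l * (w - p)) by ring.
        eapply Rle_trans; [apply Hb; unfold s in Hd'; lra|].
        apply Rmult_le_compat_l; lra. }
  apply Cmod_eq_0.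
  apply (eq_0_of_le_linear _ (((x2 - x1) + (y2 - y1)) * ((x2 - x1) + (y2 - y1))) 1 Rlt_0_1 (Cmod_ge_0 _)).
  intros s [Hs _]. rewrite Rmult_comm. now apply Hsmall.
Qed.

(** * Cauchy's integral formula on a rectangle *)

Definition in_open_rect (x1 x2 y1 y2 : R) (w : C) : Prop :=
  (x1 < fst w < x2 /\ y1 < snd w < y2)%R.

(** Cutting out a square of half side s around [z] leaves four rectangles on which
    [goursat] applies; by continuity of [g] at [z] the remaining integral is
    O(s). *)
Lemma goursat_except_point (g : C -> C) x1 x2 y1 y2 (z : C) :
  in_open_rect x1 x2 y1 y2 z -> rect_continuous g x1 x2 y1 y2 ->
  (forall w, in_rect x1 x2 y1 y2 w -> w <> z -> ex_Cderive g w) ->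
  rect_int g x1 x2 y1 y2 = 0.
Proof.
  intros [[Hz1 Hz2] [Hz3 Hz4]] Hc Hd.
  set (zx := fst z) in *. set (zy := snd z) in *.
  assert (Hg : forall a1 a2 b1 b2, (x1 <= a1)%R -> (a1 <= a2)%R -> (a2 <= x2)%R ->
     (y1 <= b1)%R -> (b1 <= b2)%R -> (b2 <= y2)%R ->
     (a2 < zx \/ zx < a1 \/ b2 < zy \/ zy < b1)%R -> rect_int g a1 a2 b1 b2 = 0).
  { intros a1 a2 b1 b2 ? ? ? ? ? ? Hout. apply goursat; try assumption.
    intros w [Hw1 Hw2]. apply Hd; [split; lra|].
    intros ->. fold zx in Hw1. fold zy in Hw2. lra. }
  assert (Hs : forall s, (0 < s)%R -> (s <= zx - x1)%R -> (s <= x2 - zx)%R -> (s <= zy - y1)%R ->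
     (s <= y2 - zy)%R ->
     rect_int g x1 x2 y1 y2 = rect_int g (zx - s) (zx + s) (zy - s) (zy + s)).
  { intros s Hs0 Hs1 Hs2 Hs3 Hs4.
    rewrite (rect_int_split_x g x1 (zx - s) x2) by (assumption || lra).
    rewrite (Hg x1 (zx - s)%R) by lra.
    rewrite (rect_int_split_x g (zx - s) (zx + s) x2) by
      (lra || apply (sub_rect_continuous g x1 x2 y1 y2); assumption || lra).
    rewrite (Hg (zx + s)%R x2) by lra.
    rewrite (rect_int_split_y g (zx - s) (zx + s) y1 (zy - s) y2) by
      (lra || apply (sub_rect_continuous g x1 x2 y1 y2); assumption || lra).
    rewrite (Hg (zx - s)%R (zx + s)%R y1 (zy - s)%R) by lra.
    rewrite (rect_int_split_y g (zx - s) (zx + s) (zy - s) (zy + s) y2) by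
      (lra || apply (sub_rect_continuous g x1 x2 y1 y2); assumption || lra).
    rewrite (Hg (zx - s)%R (zx + s)%R (zy + s)%R y2) by lra.
    ring. }
  assert (Hzc : Ccontinuous g z).
  { apply Hc. split; fold zx zy; lra. }
  destruct (proj1 (Ccontinuous_Cmod g z) Hzc 1%R Rlt_0_1) as [d [Hd0 Hgd]].
  (* half sides up to d/5 keep the square, of width plus height 4 s, within distance d of [z] *)
  set (s0 := Rmin (d / 5) (Rmin (Rmin (zx - x1) (x2 - zx)) (Rmin (zy - y1) (y2 - zy)))).
  assert (Hs0 : (0 < s0)%R) by (unfold s0; repeat apply Rmin_pos; lra).
  assert (B : (s0 <= d / 5 /\ s0 <= zx - x1 /\ s0 <= x2 - zx /\ s0 <= zy - y1 /\ s0 <= y2 - zy)%R).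
  { unfold s0. repeat split.
    - apply Rmin_l.
    - eapply Rle_trans; [apply Rmin_r|]. eapply Rle_trans; [apply Rmin_l|]. apply Rmin_l.
    - eapply Rle_trans; [apply Rmin_r|]. eapply Rle_trans; [apply Rmin_l|]. apply Rmin_r.
    - eapply Rle_trans; [apply Rmin_r|]. eapply Rle_trans; [apply Rmin_r|]. apply Rmin_l.
    - eapply Rle_trans; [apply Rmin_r|]. eapply Rle_trans; [apply Rmin_r|]. apply Rmin_r. }
  apply Cmod_eq_0. apply (eq_0_of_le_linear _ (8 * (Cmod (g z) + 1))%R s0 Hs0 (Cmod_ge_0 _)).
  intros s Hss. rewrite (Hs s) by lra.
  replace (8 * (Cmod (g z) + 1) * s)%R
    with (2 * ((zx + s - (zx - s)) + (zy + s - (zy - s))) * (Cmod (g z) + 1))%R by ring.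
  apply rect_int_bound; try lra.
  - apply rect_frame_continuous. apply (sub_rect_continuous g x1 x2 y1 y2); assumption || lra.
  - intros w [Hw _].
    assert (Hwz : (Cmod (w - z) < d)%R).
    { eapply Rle_lt_trans; [eapply in_rect_dist; [|exact Hw]|].
      - split; fold zx zy; lra.
      - lra. }
    specialize (Hgd w Hwz).
    replace (g w) with ((g w - g z) + g z) by ring.
    eapply Rle_trans; [apply Cmod_triangle|]. lra.
Qed.

(** Boundedness is inherited from quarters and holds near each point. *)
Lemma continuous_on_rect_bounded (f : C -> C) x1 x2 y1 y2 :
  (x1 <= x2)%R -> (y1 <= y2)%R -> rect_continuous f x1 x2 y1 y2 ->
  exists K, (0 <= K)%R /\ forall w, in_rect x1 x2 y1 y2 w -> (Cmod (f w) <= K)%R.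
Proof.
  intros Hx Hy Hc.
  apply (rect_induction (fun a1 a2 b1 b2 => exists K, (0 <= K)%R /\
    forall w, in_rect a1 a2 b1 b2 w -> (Cmod (f w) <= K)%R)); try assumption.
  - intros a1 a2 b1 b2 _ _ _ _ _ _ [K1 [P1 H1]] [K2 [P2 H2]] [K3 [P3 H3]] [K4 [P4 H4]].
    exists (K1 + K2 + K3 + K4)%R. split; [lra|]. intros w [Hw1 Hw2].
    destruct (Rle_dec (fst w) ((a1 + a2) / 2)); destruct (Rle_dec (snd w) ((b1 + b2) / 2)).
    + specialize (H1 w ltac:(split; lra)). lra.
    + specialize (H3 w ltac:(split; lra)). lra.
    + specialize (H2 w ltac:(split; lra)). lra.
    + specialize (H4 w ltac:(split; lra)). lra.
  - intros px py Hpx Hpy. pose (p := (px, py) : C).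
    destruct (proj1 (Ccontinuous_Cmod f p) (Hc p ltac:(split; assumption)) 1%R Rlt_0_1) as [d [Hd H]].
    exists (d / 2)%R. split; [lra|]. intros a1 a2 b1 b2 ? ? ? ? ? ? ? ?.
    exists (Cmod (f p) + 1)%R. split; [pose proof (Cmod_ge_0 (f p)); lra|].
    intros w Hw.
    assert (Hwd : (Cmod (w - p) < d)%R).
    { eapply Rle_lt_trans; [eapply in_rect_dist; [|exact Hw]|].
      - split; simpl; lra.
      - lra. }
    specialize (H w Hwd). replace (f w) with ((f w - f p) + f p) by ring.
    eapply Rle_trans; [apply Cmod_triangle|]. lra.
Qed.

Lemma ex_Cderive_mult (f g : C -> C) z :
  ex_Cderive f z -> ex_Cderive g z -> ex_Cderive (fun w => f w * g w) z.
Proof. intros [l Hl] [m Hm]. eexists. apply is_Cderive_mult; eassumption. Qed.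

Lemma is_Cderive_inv_comp (f : C -> C) z l :
  f z <> 0 -> is_Cderive f z l -> is_Cderive (fun w => / f w) z (- l / (f z * f z)).
Proof.
  intros H0 Hf. eapply is_Cderive_eq.
  - apply (is_Cderive_comp Cinv f z); [apply is_Cderive_inv, H0 | exact Hf].
  - field. assumption.
Qed.

Lemma ex_Cderive_inv (f : C -> C) z :
  f z <> 0 -> ex_Cderive f z -> ex_Cderive (fun w => / f w) z.
Proof. intros H0 [l Hl]. eexists. apply is_Cderive_inv_comp; eassumption. Qed.

Lemma ex_Cderive_minus (f g : C -> C) z :
  ex_Cderive f z -> ex_Cderive g z -> ex_Cderive (fun w => f w - g w) z.
Proof. intros [l Hl] [m Hm]. eexists. apply is_Cderive_minus; eassumption. Qed.

Lemma ex_Cderive_const c z : ex_Cderive (fun _ => c) z.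
Proof. eexists. apply is_Cderive_const. Qed.

Lemma ex_Cderive_id z : ex_Cderive (fun w => w) z.
Proof. eexists. apply is_Cderive_id. Qed.

Lemma ex_Cderive_ext_loc (f g : C -> C) z :
  locally (T := C_UniformSpace) z (fun w => f w = g w) -> ex_Cderive f z -> ex_Cderive g z.
Proof. intros H [l Hl]. exists l. now apply (is_Cderive_ext_loc f). Qed.

Lemma ex_Cderive_cauchy_kernel (z w : C) : w <> z -> ex_Cderive (fun w => / (w - z)) w.
Proof.
  intros H. apply (ex_Cderive_inv (fun w => w - z)); [now apply Cminus_eq_contra|].
  apply ex_Cderive_minus; [apply ex_Cderive_id|apply ex_Cderive_const].
Qed.

Lemma Cmod_pos_sub (z w : C) : w <> z -> (0 < Cmod (w - z))%R.
Proof. intros H. apply Cmod_gt_0. now apply Cminus_eq_contra. Qed.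

Lemma on_frame_neq x1 x2 y1 y2 z w :
  in_open_rect x1 x2 y1 y2 z -> on_frame x1 x2 y1 y2 w -> w <> z.
Proof. intros [H1 H2] [_ H3] ->. lra. Qed.

(** The difference quotient (f(w) - f(z))/(w - z), completed by f'(z), is continuous
    at [z] and differentiable elsewhere, so its integral vanishes.  The integral of
    1/(w - z) is kept as a factor and never evaluated. *)
Lemma cauchy_formula (f : C -> C) x1 x2 y1 y2 (z : C) :
  in_open_rect x1 x2 y1 y2 z ->
  (forall w, in_rect x1 x2 y1 y2 w -> ex_Cderive f w) ->
  rect_int (fun w => f w * / (w - z)) x1 x2 y1 y2
  = f z * rect_int (fun w => / (w - z)) x1 x2 y1 y2.
Proof.
  intros Hz Hf. pose proof Hz as [[Hz1 Hz2] [Hz3 Hz4]].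
  assert (Hl : exists l : C, is_Cderive f z l) by (apply Hf; split; lra).
  destruct Hl as [l Hl].
  set (g := fun w => if Ceq_dec w z then l else (f w - f z) * / (w - z)).
  assert (Hgd : forall w, in_rect x1 x2 y1 y2 w -> w <> z -> ex_Cderive g w).
  { intros w Hw Hwz.
    apply (ex_Cderive_ext_loc (fun w => (f w - f z) * / (w - z))).
    - apply (proj2 (locally_Cmod w _)). exists (Cmod (w - z)). split; [now apply Cmod_pos_sub|].
      intros v Hv. unfold g. destruct (Ceq_dec v z) as [->|]; [|reflexivity].
      rewrite <- Cmod_opp in Hv. replace (- (z - w)) with (w - z) in Hv by ring. lra.
    - apply ex_Cderive_mult.
      + apply ex_Cderive_minus; [now apply Hf|apply ex_Cderive_const].
      + now apply ex_Cderive_cauchy_kernel. }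
  assert (Hgc : rect_continuous g x1 x2 y1 y2).
  { intros w Hw. destruct (Ceq_dec w z) as [->|Hwz].
    - apply Ccontinuous_Cmod. intros e He.
      destruct (proj1 (is_Cderive_Cmod f z l) Hl (e / 2)%R ltac:(lra)) as [d [Hd H]].
      exists d. split; [exact Hd|]. intros w' Hw'.
      unfold g. destruct (Ceq_dec z z) as [_|N]; [|now elim N].
      destruct (Ceq_dec w' z) as [->|Hne].
      + replace (l - l) with (RtoC 0) by ring. rewrite Cmod_0. exact He.
      + assert (Hne' : w' - z <> 0) by now apply Cminus_eq_contra.
        replace ((f w' - f z) * / (w' - z) - l) with ((f w' - f z - l * (w' - z)) * / (w' - z))
          by (field; assumption).
        rewrite Cmod_mult, Cmod_inv by assumption.
        pose proof (Cmod_pos_sub z w' Hne) as Hp.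
        apply Rle_lt_trans with (e / 2)%R; [|lra].
        apply Rle_div_l; [lra|]. now apply H.
    - apply ex_Cderive_continuous. now apply Hgd. }
  assert (H0 := goursat_except_point g x1 x2 y1 y2 z Hz Hgc Hgd).
  assert (Hkc : frame_continuous (fun w => / (w - z)) x1 x2 y1 y2).
  { intros w Hw. apply ex_Cderive_continuous.
    apply ex_Cderive_cauchy_kernel. eapply on_frame_neq; eassumption. }
  assert (Hfc : frame_continuous (fun w => f w * / (w - z)) x1 x2 y1 y2).
  { intros w Hw. apply ex_Cderive_continuous. apply ex_Cderive_mult; [apply Hf, Hw|].
    apply ex_Cderive_cauchy_kernel. eapply on_frame_neq; eassumption. }
  assert (Hfzc : frame_continuous (fun w => f z * / (w - z)) x1 x2 y1 y2).
  { intros w Hw. apply ex_Cderive_continuous. apply ex_Cderive_mult; [apply ex_Cderive_const|].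
    apply ex_Cderive_cauchy_kernel. eapply on_frame_neq; eassumption. }
  rewrite <- rect_int_cmult by (assumption || lra).
  rewrite (rect_int_ext g (fun w => f w * / (w - z) - f z * / (w - z))) in H0; try lra.
  - rewrite rect_int_minus in H0 by (assumption || lra).
    apply Ceq_minus. exact H0.
  - intros w Hw. unfold g. destruct (Ceq_dec w z) as [E|E].
    + exfalso. revert E. eapply on_frame_neq; eassumption.
    + ring.
Qed.

(** * Derivatives of holomorphic functions are holomorphic *)

Lemma Ccontinuous_mult (f g : C -> C) z :
  Ccontinuous f z -> Ccontinuous g z -> Ccontinuous (fun w => f w * g w) z.
Proof.
  intros Hf Hg. apply Ccontinuous_Cmod. intros e He.
  set (A := (Cmod (f z) + 1)%R). set (B := (Cmod (g z) + 1)%R).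
  assert (HA : (0 < A)%R) by (unfold A; pose proof (Cmod_ge_0 (f z)); lra).
  assert (HB : (0 < B)%R) by (unfold B; pose proof (Cmod_ge_0 (g z)); lra).
  assert (Hea : (0 < Rmin 1 (e / (2 * B)))%R) by (apply Rmin_pos; [lra|apply Rdiv_lt_0_compat; lra]).
  assert (Heb : (0 < e / (2 * A))%R) by (apply Rdiv_lt_0_compat; lra).
  destruct (proj1 (Ccontinuous_Cmod f z) Hf _ Hea) as [d1 [Hd1 H1]].
  destruct (proj1 (Ccontinuous_Cmod g z) Hg _ Heb) as [d2 [Hd2 H2]].
  exists (Rmin d1 d2). split; [now apply Rmin_pos|]. intros w Hw.
  specialize (H1 w (Rlt_le_trans _ _ _ Hw (Rmin_l _ _))).
  specialize (H2 w (Rlt_le_trans _ _ _ Hw (Rmin_r _ _))).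
  pose proof (Rlt_le_trans _ _ _ H1 (Rmin_l _ _)) as H1a.
  pose proof (Rlt_le_trans _ _ _ H1 (Rmin_r _ _)) as H1b.
  assert (HfA : (Cmod (f w) < A)%R).
  { unfold A. replace (f w) with ((f w - f z) + f z) by ring.
    eapply Rle_lt_trans; [apply Cmod_triangle|]. lra. }
  replace (f w * g w - f z * g z) with (f w * (g w - g z) + (f w - f z) * g z) by ring.
  eapply Rle_lt_trans; [apply Cmod_triangle|]. rewrite !Cmod_mult.
  pose proof (Cmod_ge_0 (f w)). pose proof (Cmod_ge_0 (g z)).
  pose proof (Cmod_ge_0 (g w - g z)). pose proof (Cmod_ge_0 (f w - f z)).
  assert (Cmod (f w) * Cmod (g w - g z) <= A * Cmod (g w - g z))%R by (apply Rmult_le_compat_r; lra).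
  assert (A * Cmod (g w - g z) < A * (e / (2 * A)))%R by (apply Rmult_lt_compat_l; lra).
  assert (Cmod (f w - f z) * Cmod (g z) <= e / (2 * B) * B)%R.
  { apply Rmult_le_compat; try lra. unfold B. lra. }
  replace (A * (e / (2 * A)))%R with (e / 2)%R in * by (field; lra).
  replace (e / (2 * B) * B)%R with (e / 2)%R in * by (field; lra).
  lra.
Qed.

Lemma kernel_continuous (phi k : C -> C) x1 x2 y1 y2 (z : C) :
  frame_continuous phi x1 x2 y1 y2 -> (forall u : C, u <> 0 -> ex_Cderive k u) ->
  in_open_rect x1 x2 y1 y2 z ->
  frame_continuous (fun w => phi w * k (w - z)) x1 x2 y1 y2.
Proof.
  intros Hphi Hk Hz w Hw. apply Ccontinuous_mult; [now apply Hphi|].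
  apply ex_Cderive_continuous.
  destruct (Hk (w - z)) as [l Hl]; [apply Cminus_eq_contra; eapply on_frame_neq; eassumption|].
  exists ((1 - 0) * l). apply (is_Cderive_comp k (fun w => w - z)); [exact Hl|].
  apply is_Cderive_minus; [apply is_Cderive_id|apply is_Cderive_const].
Qed.

(** A single radius serves both to bound the kernel on the boundary and to keep
    moved points inside. *)
Lemma frame_distance x1 x2 y1 y2 (z : C) :
  in_open_rect x1 x2 y1 y2 z ->
  exists r, (0 < r)%R /\ (forall w, on_frame x1 x2 y1 y2 w -> (r <= Cmod (w - z))%R) /\
    (forall w, (Cmod (w - z) < r)%R -> in_open_rect x1 x2 y1 y2 w).
Proof.
  intros [[Hz1 Hz2] [Hz3 Hz4]].
  set (r := Rmin (Rmin (fst z - x1) (x2 - fst z)) (Rmin (snd z - y1) (y2 - snd z))).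
  assert (B : (r <= fst z - x1 /\ r <= x2 - fst z /\ r <= snd z - y1 /\ r <= y2 - snd z)%R).
  { unfold r. repeat split.
    - eapply Rle_trans; [apply Rmin_l|]. apply Rmin_l.
    - eapply Rle_trans; [apply Rmin_l|]. apply Rmin_r.
    - eapply Rle_trans; [apply Rmin_r|]. apply Rmin_l.
    - eapply Rle_trans; [apply Rmin_r|]. apply Rmin_r. }
  assert (Hfs : forall w, (Rabs (fst w - fst z) <= Cmod (w - z) /\ Rabs (snd w - snd z) <= Cmod (w - z))%R).
  { intros w. pose proof (Rmax_Cmod (w - z)) as M. simpl in M. split.
    - eapply Rle_trans; [|exact M]. apply Rmax_l.
    - eapply Rle_trans; [|exact M]. apply Rmax_r. }
  exists r. split; [unfold r; repeat apply Rmin_pos; lra|]. split.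
  - intros w [_ Hw]. destruct (Hfs w) as [F S].
    pose proof (Rle_abs (fst w - fst z)). pose proof (Rle_abs (snd w - snd z)).
    pose proof (Rle_abs (- (fst w - fst z))) as A1. pose proof (Rle_abs (- (snd w - snd z))) as A2.
    rewrite Rabs_Ropp in A1, A2. lra.
  - intros w Hw. destruct (Hfs w) as [F S].
    pose proof (Rle_abs (fst w - fst z)). pose proof (Rle_abs (snd w - snd z)).
    pose proof (Rle_abs (- (fst w - fst z))) as A1. pose proof (Rle_abs (- (snd w - snd z))) as A2.
    rewrite Rabs_Ropp in A1, A2. split; lra.
Qed.

(** [k'] is the derivative in z of [k] (w - z), up to an error of second order that is
    uniform away from the pole; this uniformity is what differentiation under the
    integral sign consumes. *)
Definition kernel_pair (k k' : C -> C) : Prop :=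
  (forall u : C, u <> 0 -> ex_Cderive k u) /\ (forall u : C, u <> 0 -> ex_Cderive k' u) /\
  forall r, (0 < r)%R -> exists B, (0 <= B)%R /\ forall u h : C, (r <= Cmod u)%R -> (Cmod h <= r / 2)%R ->
    (Cmod (k (u - h)%C - k u - h * k' u)%C <= B * (Cmod h * Cmod h))%R.

Definition kernel_int (phi k : C -> C) (x1 x2 y1 y2 : R) (z : C) : C :=
  rect_int (fun w => phi w * k (w - z)) x1 x2 y1 y2.

(** Differentiation under the integral sign: integrate the second-order bound of
    [kernel_pair] over the boundary. *)
Lemma kernel_int_derive (phi k k' : C -> C) x1 x2 y1 y2 (z : C) :
  rect_continuous phi x1 x2 y1 y2 -> kernel_pair k k' -> in_open_rect x1 x2 y1 y2 z ->
  is_Cderive (kernel_int phi k x1 x2 y1 y2) z (kernel_int phi k' x1 x2 y1 y2 z).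
Proof.
  intros Hphi (Hk & Hk' & Hkk) Hz. pose proof Hz as [[Hz1 Hz2] [Hz3 Hz4]].
  destruct (frame_distance _ _ _ _ _ Hz) as (r & Hr & Hfr & Hin).
  destruct (Hkk r Hr) as (B & HB & HkB).
  destruct (continuous_on_rect_bounded phi x1 x2 y1 y2 ltac:(lra) ltac:(lra) Hphi) as (K & HK & HphiK).
  pose proof (rect_frame_continuous _ _ _ _ _ Hphi) as Hphi'.
  set (L := (2 * ((x2 - x1) + (y2 - y1)))%R). assert (HL : (0 <= L)%R) by (unfold L; lra).
  assert (HLKB := Rmult_le_pos _ _ HL (Rmult_le_pos _ _ HK HB)).
  apply is_Cderive_Cmod. unfold kernel_int. intros e He.
  exists (Rmin (r / 2) (e / (L * (K * B) + 1))). split.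
  { apply Rmin_pos; [lra|]. apply Rdiv_lt_0_compat; lra. }
  intros z' Hz'.
  pose proof (Rlt_le_trans _ _ _ Hz' (Rmin_l _ _)) as D1.
  pose proof (Rlt_le_trans _ _ _ Hz' (Rmin_r _ _)) as D2. clear Hz'.
  assert (Hzo' : in_open_rect x1 x2 y1 y2 z') by (apply Hin; lra).
  pose proof (kernel_continuous phi k _ _ _ _ z Hphi' Hk Hz) as C1.
  pose proof (kernel_continuous phi k _ _ _ _ z' Hphi' Hk Hzo') as C2.
  pose proof (kernel_continuous phi k' _ _ _ _ z Hphi' Hk' Hz) as C3.
  assert (C12 : frame_continuous (fun w => phi w * k (w - z') - phi w * k (w - z)) x1 x2 y1 y2).
  { intros w Hw. apply (continuous_minus (V := C_R_NormedModule) (U := C_UniformSpace)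
      (fun w => phi w * k (w - z')) (fun w => phi w * k (w - z)) w);
      [now apply C2|now apply C1]. }
  set (h := z' - z) in *.
  assert (C3h : frame_continuous (fun w => h * (phi w * k' (w - z))) x1 x2 y1 y2).
  { intros w Hw. apply Ccontinuous_mult; [apply ex_Cderive_continuous, ex_Cderive_const|now apply C3]. }
  rewrite (Cmult_comm _ h).
  rewrite <- rect_int_minus by (assumption || lra).
  rewrite <- rect_int_cmult by (assumption || lra).
  rewrite <- rect_int_minus by (assumption || lra).
  eapply Rle_trans.
  - apply (rect_int_bound _ _ _ _ _ (K * (B * (Cmod h * Cmod h)))%R); try lra.
    + intros w Hw. apply (continuous_minus (V := C_R_NormedModule) (U := C_UniformSpace)
        (fun w => phi w * k (w - z') - phi w * k (w - z)) (fun w => h * (phi w * k' (w - z))) w);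
        [now apply C12|now apply C3h].
    + intros w Hw.
      replace (phi w * k (w - z') - phi w * k (w - z) - h * (phi w * k' (w - z)))
        with (phi w * (k ((w - z) - h) - k (w - z) - h * k' (w - z))).
      2: { replace (w - z - h) with (w - z') by (unfold h; ring). ring. }
      rewrite Cmod_mult. apply Rmult_le_compat; try apply Cmod_ge_0.
      * apply HphiK, Hw.
      * apply HkB; [now apply Hfr | lra].
  - fold L. pose proof (Cmod_ge_0 h).
    replace (L * (K * (B * (Cmod h * Cmod h))))%R with (L * (K * B) * Cmod h * Cmod h)%R by ring.
    apply Rmult_le_compat_r; [assumption|].
    apply Rlt_div_r in D2; [|lra]. lra.
Qed.

Lemma kernel_pair_1 : kernel_pair (fun u => / u) (fun u => / (u * u)).
Proof.
  split; [|split].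
  - intros u Hu. apply (ex_Cderive_inv (fun u => u)); [assumption|apply ex_Cderive_id].
  - intros u Hu. apply (ex_Cderive_inv (fun u => u * u)); [now apply Cmult_neq_0|].
    apply ex_Cderive_mult; apply ex_Cderive_id.
  - intros r Hr. exists (2 / (r * r * r))%R.
    split. { apply Rcomplements.Rdiv_le_0_compat; [lra|]. repeat apply Rmult_lt_0_compat; assumption. }
    intros u h Hu Hh.
    assert (Huh : (r / 2 <= Cmod (u - h))%R).
    { assert (Cmod u <= Cmod (u - h) + Cmod h)%R; [|lra].
      replace u with ((u - h) + h) at 1 by ring. apply Cmod_triangle. }
    assert (Hu0 : u <> 0) by (apply Cmod_gt_0; lra).
    assert (Huh0 : u - h <> 0) by (apply Cmod_gt_0; lra).
    replace (/ (u - h) - / u - h * / (u * u)) with ((h * h) * / ((u - h) * (u * u))) by (field; auto).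
    rewrite !Cmod_mult, Cmod_inv, !Cmod_mult by (repeat apply Cmult_neq_0; assumption).
    rewrite Rmult_comm. pose proof (Cmod_ge_0 h).
    apply Rmult_le_compat_r; [now apply Rmult_le_pos|].
    replace (2 / (r * r * r))%R with (/ (r / 2 * (r * r)))%R by (field; lra).
    apply Rinv_le_contravar; [repeat apply Rmult_lt_0_compat; lra|].
    repeat (apply Rmult_le_compat; try lra). nra.
Qed.

Lemma kernel_pair_2 : kernel_pair (fun u => / (u * u)) (fun u => 2 * / (u * u * u)).
Proof.
  split; [|split].
  - intros u Hu. apply (ex_Cderive_inv (fun u => u * u)); [now apply Cmult_neq_0|].
    apply ex_Cderive_mult; apply ex_Cderive_id.
  - intros u Hu. apply (ex_Cderive_mult (fun _ => RtoC 2)); [apply ex_Cderive_const|].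
    apply (ex_Cderive_inv (fun u => u * u * u)); [now repeat apply Cmult_neq_0|].
    apply (ex_Cderive_mult (fun u => u * u)); [apply ex_Cderive_mult|]; apply ex_Cderive_id.
  - intros r Hr. exists (12 / (r * r * r * r) + 4 / (r * r * r * r))%R.
    assert (Hr4 : (0 < r * r * r * r)%R) by (repeat apply Rmult_lt_0_compat; assumption).
    split. { apply Rplus_le_le_0_compat; apply Rcomplements.Rdiv_le_0_compat; lra. }
    intros u h Hu Hh.
    assert (Huh : (r / 2 <= Cmod (u - h))%R).
    { assert (Cmod u <= Cmod (u - h) + Cmod h)%R; [|lra].
      replace u with ((u - h) + h) at 1 by ring. apply Cmod_triangle. }
    assert (Hu0 : u <> 0) by (apply Cmod_gt_0; lra).
    assert (Huh0 : u - h <> 0) by (apply Cmod_gt_0; lra).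
    replace (/ ((u - h) * (u - h)) - / (u * u) - h * (2 * / (u * u * u)))
      with ((h * h) * (3 * / ((u - h) * (u - h) * (u * u)) + - (2 * h * / ((u - h) * (u - h) * (u * u * u)))))
      by (field; auto).
    rewrite Cmod_mult, Rmult_comm. rewrite (Cmod_mult h h). pose proof (Cmod_ge_0 h).
    apply Rmult_le_compat_r; [now apply Rmult_le_pos|].
    eapply Rle_trans; [apply Cmod_triangle|]. rewrite Cmod_opp.
    rewrite !Cmod_mult, !Cmod_inv, !Cmod_mult by (repeat apply Cmult_neq_0; assumption).
    rewrite !Cmod_R, !Rabs_pos_eq by lra.
    assert (Q : (r / 2 * (r / 2) <= Cmod (u - h) * Cmod (u - h))%R) by (apply Rmult_le_compat; lra).
    assert (Q1 : (0 < r / 2 * (r / 2))%R) by (apply Rmult_lt_0_compat; lra).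
    assert (Q2 : (r * r <= Cmod u * Cmod u)%R) by (apply Rmult_le_compat; lra).
    assert (Q3 : (0 < r * r)%R) by (apply Rmult_lt_0_compat; lra).
    apply Rplus_le_compat.
    + replace (12 / (r * r * r * r))%R with (3 * / (r / 2 * (r / 2) * (r * r)))%R by (field; lra).
      apply Rmult_le_compat_l; [lra|].
      apply Rinv_le_contravar; [now apply Rmult_lt_0_compat|].
      apply Rmult_le_compat; lra.
    + replace (4 / (r * r * r * r))%R with (2 * (r / 2) * / (r / 2 * (r / 2) * (r * r * r)))%R by (field; lra).
      assert (Q5 : (0 < r / 2 * (r / 2) * (r * r * r))%R) by (repeat apply Rmult_lt_0_compat; lra).
      assert (Q6 : (r / 2 * (r / 2) * (r * r * r) <= Cmod (u - h) * Cmod (u - h) * (Cmod u * Cmod u * Cmod u))%R).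
      { apply Rmult_le_compat; try lra; [repeat apply Rmult_le_pos; lra|].
        apply Rmult_le_compat; lra. }
      apply Rmult_le_compat; try lra.
      * left. apply Rinv_0_lt_compat. lra.
      * apply Rinv_le_contravar; assumption.
Qed.

(** Positivity of the imaginary part survives integration; the factor [c] will be the
    direction of a side. *)
Lemma CInt_snd_pos (c : C) (g : R -> C) a b :
  (a < b)%R -> (forall t, (a <= t <= b)%R -> path_continuous g t) ->
  (forall t, (a < t < b)%R -> (0 < snd (c * g t)%C)%R) ->
  (0 < snd (c * CInt g a b)%C)%R.
Proof.
  intros Hab Hc Hp.
  pose proof (CInt_correct g a b ltac:(lra) Hc) as HI.
  pose proof (is_CInt_snd _ _ _ _ (is_CInt_cmult c _ _ _ _ HI)) as HI2.
  rewrite <- (is_RInt_unique _ _ _ _ HI2).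
  apply RInt_gt_0; [assumption|assumption|].
  intros t Ht.
  assert (Ht' : path_continuous g t) by (apply Hc; lra).
  apply (continuous_comp (U := R_UniformSpace) (V := C_UniformSpace) (W := R_UniformSpace)
    (fun t => c * g t) snd).
  - apply (continuous_comp (U := R_UniformSpace) (V := C_UniformSpace) (W := C_UniformSpace)
      g (fun w => c * w)); [exact Ht'|].
    apply ex_Cderive_continuous, ex_Cderive_mult; [apply ex_Cderive_const|apply ex_Cderive_id].
  - destruct (c * g t)%C as [p q]. apply (continuous_snd (U := R_UniformSpace) (V := R_UniformSpace)).
Qed.

(** For a square centred at [z], dw/(w - z) has positive imaginary part along each
    side (the argument increases), hence so has the integral. *)
Lemma frame_kernel_integral_neq_0 (z : C) (r : R) :
  (0 < r)%R ->
  rect_int (fun w => / (w - z)) (fst z - r) (fst z + r) (snd z - r) (snd z + r) <> 0.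
Proof.
  intros Hr E.
  set (x1 := (fst z - r)%R) in *. set (x2 := (fst z + r)%R) in *.
  set (y1 := (snd z - r)%R) in *. set (y2 := (snd z + r)%R) in *.
  assert (Hz : in_open_rect x1 x2 y1 y2 z) by (unfold x1, x2, y1, y2; split; simpl; lra).
  assert (Hkc : frame_continuous (fun w => / (w - z)) x1 x2 y1 y2).
  { intros w Hw. apply ex_Cderive_continuous.
    apply ex_Cderive_cauchy_kernel. eapply on_frame_neq; eassumption. }
  assert (Hx : (x1 < x2)%R) by (unfold x1, x2; lra).
  assert (Hy : (y1 < y2)%R) by (unfold y1, y2; lra).
  assert (Hden : forall a b, (a <> 0 \/ b <> 0 -> 0 < a * (a * 1) + b * (b * 1))%R).
  { intros a b [H|H].
    - assert (0 < a * a)%R by nra. nra.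
    - assert (0 < b * b)%R by nra. nra. }
  assert (P1 : (0 < snd (1 * CInt (hpath (fun w => / (w - z)) y1) x1 x2)%C)%R).
  { apply CInt_snd_pos; [assumption| |].
    - intros t Ht. apply hpath_continuous, Hkc. split; [split|]; simpl; intuition lra.
    - intros t Ht. rewrite Cmult_1_l. unfold hpath. simpl.
      apply Rdiv_lt_0_compat; [unfold y1; lra|]. apply Hden. right. unfold y1; lra. }
  assert (P2 : (0 < snd (Ci * CInt (vpath (fun w => / (w - z)) x2) y1 y2)%C)%R).
  { apply CInt_snd_pos; [assumption| |].
    - intros t Ht. apply vpath_continuous, Hkc. split; [split|]; simpl; intuition lra.
    - intros t Ht. unfold vpath. simpl.
      rewrite Rmult_0_l, Rmult_1_l, Rplus_0_l.
      apply Rdiv_lt_0_compat; [unfold x2; lra|]. apply Hden. left. unfold x2; lra. }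
  assert (P3 : (0 < snd (- (1) * CInt (hpath (fun w => / (w - z)) y2) x1 x2)%C)%R).
  { apply CInt_snd_pos; [assumption| |].
    - intros t Ht. apply hpath_continuous, Hkc. split; [split|]; simpl; intuition lra.
    - intros t Ht. unfold hpath. simpl.
      match goal with |- (0 < ?A * (?B / ?D) + _)%R => replace (A * (B / D))%R with ((-B) / D)%R by (unfold Rdiv; ring) end.
      rewrite Ropp_0, Rmult_0_l, Rplus_0_r.
      apply Rdiv_lt_0_compat; [unfold y2; lra|]. apply Hden. right. unfold y2; lra. }
  assert (P4 : (0 < snd (- Ci * CInt (vpath (fun w => / (w - z)) x1) y1 y2)%C)%R).
  { apply CInt_snd_pos; [assumption| |].
    - intros t Ht. apply vpath_continuous, Hkc. split; [split|]; simpl; intuition lra.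
    - intros t Ht. unfold vpath. simpl.
      match goal with |- (0 < _ + ?A * (?B / ?D))%R => replace (A * (B / D))%R with ((-B) / D)%R by (unfold Rdiv; ring) end.
      rewrite Ropp_0, Rmult_0_l, Rplus_0_l.
      apply Rdiv_lt_0_compat; [unfold x1; lra|]. apply Hden. left. unfold x1; lra. }
  assert (S := f_equal snd E). unfold rect_int in S.
  set (I1 := CInt (hpath _ y1) x1 x2) in *. set (I2 := CInt (vpath _ x2) y1 y2) in *.
  set (I3 := CInt (hpath _ y2) x1 x2) in *. set (I4 := CInt (vpath _ x1) y1 y2) in *.
  replace (I1 + Ci * I2 - I3 - Ci * I4) with (1 * I1 + Ci * I2 + - (1) * I3 + - Ci * I4) in S by ring.
  assert (snd (1 * I1 + Ci * I2 + - (1) * I3 + - Ci * I4)%C =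
    snd (1 * I1)%C + snd (Ci * I2)%C + snd (- (1) * I3)%C + snd (- Ci * I4)%C)%R by reflexivity.
  assert (snd (RtoC 0) = 0%R) by reflexivity. lra.
Qed.

(** Near the centre of a small square f = Phi/K with Phi and K given by integrals of
    the Cauchy kernel.  Hence f' is an expression in Phi, K and their first
    derivatives, all of which are differentiable. *)
Theorem holomorphic_derive (U : C -> Prop) (f : C -> C) :
  @open C_UniformSpace U -> holomorphic_on U f -> holomorphic_on U (C_derive f).
Proof.
  intros HU Hf z0 Hz0.
  destruct (proj1 (locally_Cmod z0 U) (HU z0 Hz0)) as [d [Hd HUd]].
  (* points of a square of half side d/8 are at most 4 d/8 from its centre *)
  set (r := (d / 8)%R). assert (Hr : (0 < r)%R) by (unfold r; lra).
  set (x1 := (fst z0 - r)%R). set (x2 := (fst z0 + r)%R).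
  set (y1 := (snd z0 - r)%R). set (y2 := (snd z0 + r)%R).
  assert (Hz : in_open_rect x1 x2 y1 y2 z0) by (unfold x1, x2, y1, y2; split; simpl; lra).
  assert (Hfr : forall w, in_rect x1 x2 y1 y2 w -> ex_Cderive f w).
  { intros w Hw. apply Hf, HUd.
    eapply Rle_lt_trans; [eapply in_rect_dist; [|exact Hw]|].
    - destruct Hz; split; lra.
    - unfold x1, x2, y1, y2, r. lra. }
  assert (Hfc : rect_continuous f x1 x2 y1 y2).
  { intros w Hw. now apply ex_Cderive_continuous, Hfr. }
  set (Phi := fun phi k : C -> C => kernel_int phi k x1 x2 y1 y2).
  set (one := fun _ : C => RtoC 1).
  assert (H1c : rect_continuous one x1 x2 y1 y2).
  { intros w _. apply ex_Cderive_continuous, ex_Cderive_const. }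
  set (k1 := fun u : C => / u). set (k2 := fun u : C => / (u * u)).
  set (k3 := fun u : C => 2 * / (u * u * u)).
  assert (D1 : forall phi z, rect_continuous phi x1 x2 y1 y2 -> in_open_rect x1 x2 y1 y2 z ->
    is_Cderive (Phi phi k1) z (Phi phi k2 z)).
  { intros phi z Hphi Hzz. exact (kernel_int_derive phi k1 k2 x1 x2 y1 y2 z Hphi kernel_pair_1 Hzz). }
  assert (D2 : forall phi z, rect_continuous phi x1 x2 y1 y2 -> in_open_rect x1 x2 y1 y2 z ->
    is_Cderive (Phi phi k2) z (Phi phi k3 z)).
  { intros phi z Hphi Hzz. exact (kernel_int_derive phi k2 k3 x1 x2 y1 y2 z Hphi kernel_pair_2 Hzz). }
  set (K := Phi one k1).
  assert (HK0 : K z0 <> 0).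
  { unfold K, Phi, kernel_int. rewrite (rect_int_ext _ (fun w => / (w - z0))).
    - now apply frame_kernel_integral_neq_0.
    - unfold x1, x2; lra.
    - unfold y1, y2; lra.
    - intros w _. unfold one, k1. ring. }
  assert (HfK : forall z, in_open_rect x1 x2 y1 y2 z -> Phi f k1 z = f z * K z).
  { intros z Hzz. unfold Phi at 1, kernel_int, k1. rewrite cauchy_formula by assumption.
    f_equal. unfold K, Phi, kernel_int. apply rect_int_ext; [unfold x1, x2; lra|unfold y1, y2; lra|].
    intros w _. unfold one, k1. ring. }
  assert (HKc : Ccontinuous K z0).
  { apply ex_Cderive_continuous. eexists. now apply D1. }
  destruct (proj1 (Ccontinuous_Cmod K z0) HKc (Cmod (K z0)) (proj1 (Cmod_gt_0 _) HK0)) as [d1 [Hd1 HKd]].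
  destruct (frame_distance _ _ _ _ _ Hz) as (r2 & Hr2 & _ & Hin).
  set (d2 := Rmin d1 r2). assert (Hd2 : (0 < d2)%R) by now apply Rmin_pos.
  (* on this disc the quotient Phi/K makes sense *)
  assert (HN : forall z, (Cmod (z - z0) < d2)%R -> in_open_rect x1 x2 y1 y2 z /\ K z <> 0).
  { intros z Hzz. split.
    - apply Hin. eapply Rlt_le_trans; [exact Hzz|apply Rmin_r].
    - intros E. assert (T : (Cmod (K z - K z0) < Cmod (K z0))%R).
      { apply HKd. eapply Rlt_le_trans; [exact Hzz|apply Rmin_l]. }
      rewrite E in T. replace (0 - K z0) with (- K z0) in T by ring. rewrite Cmod_opp in T. lra. }
  assert (Hnear : forall z, (Cmod (z - z0) < d2)%R ->
    locally (T := C_UniformSpace) z (fun w => (Cmod (w - z0) < d2)%R)).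
  { intros z Hzz. apply (proj2 (locally_Cmod z _)). exists (d2 - Cmod (z - z0))%R. split; [lra|].
    intros w Hw. replace (w - z0) with ((w - z) + (z - z0)) by ring.
    eapply Rle_lt_trans; [apply Cmod_triangle|]. lra. }
  assert (Hder : forall z, (Cmod (z - z0) < d2)%R ->
    C_derive f z = Phi f k2 z * / K z + Phi f k1 z * (- Phi one k2 z / (K z * K z))).
  { intros z Hzz. apply is_C_derive_unique. destruct (HN z Hzz) as [Hzr HKz].
    apply (is_Cderive_ext_loc (fun z => Phi f k1 z * / K z)).
    - eapply filter_imp; [|apply (Hnear z Hzz)]. intros w Hw. destruct (HN w Hw) as [Hwr HKw].
      rewrite HfK by assumption. field. assumption.
    - apply (is_Cderive_eq _ _ (Phi f k2 z * / K z + Phi f k1 z * (- Phi one k2 z / (K z * K z)))); [|reflexivity].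
      exact (is_Cderive_mult (Phi f k1) (fun z => / K z) z _ _ (D1 f z Hfc Hzr)
        (is_Cderive_inv_comp K z _ HKz (D1 one z H1c Hzr))). }
  apply (ex_Cderive_ext_loc (fun z => Phi f k2 z * / K z - Phi f k1 z * (Phi one k2 z * / (K z * K z)))).
  - apply (proj2 (locally_Cmod z0 _)). exists d2. split; [assumption|]. intros w Hw.
    rewrite Hder by assumption. destruct (HN w Hw) as [_ HKw]. field. assumption.
  - assert (X1 : ex_Cderive (Phi f k2) z0) by (eexists; now apply D2).
    assert (X2 : ex_Cderive (Phi f k1) z0) by (eexists; now apply D1).
    assert (X3 : ex_Cderive (Phi one k2) z0) by (eexists; now apply D2).
    assert (X4 : ex_Cderive K z0) by (eexists; now apply D1).
    apply ex_Cderive_minus.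
    + apply ex_Cderive_mult; [assumption|now apply ex_Cderive_inv].
    + apply ex_Cderive_mult; [assumption|]. apply ex_Cderive_mult; [assumption|].
      apply (ex_Cderive_inv (fun z => K z * K z)); [now apply Cmult_neq_0|now apply ex_Cderive_mult].
Qed.

(** * Finite sums of complex numbers *)

Notation Csum := (@sum_n C_AbelianMonoid).

Lemma Csum_0 (a : nat -> C) : Csum a 0 = a 0%nat :> C.
Proof. apply (sum_O (G := C_AbelianMonoid)). Qed.

Lemma Csum_S (a : nat -> C) n : Csum a (S n) = Csum a n + a (S n) :> C.
Proof. apply (sum_Sn (G := C_AbelianMonoid)). Qed.

Lemma Csum_ext (a b : nat -> C) n :
  (forall i, (i <= n)%nat -> a i = b i) -> Csum a n = Csum b n :> C.
Proof. apply (sum_n_ext_loc (G := C_AbelianMonoid)). Qed.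

Lemma Csum_plus (a b : nat -> C) n : Csum (fun i => a i + b i) n = Csum a n + Csum b n :> C.
Proof. apply (sum_n_plus (G := C_AbelianMonoid)). Qed.

Lemma Csum_mult_l (c : C) (a : nat -> C) n : c * Csum a n = Csum (fun i => c * a i) n :> C.
Proof.
  induction n as [|n IH]; [now rewrite !Csum_0|].
  rewrite !Csum_S, Cmult_plus_distr_l, IH. reflexivity.
Qed.

Lemma Csum_mult_r (c : C) (a : nat -> C) n : Csum a n * c = Csum (fun i => a i * c) n :> C.
Proof.
  rewrite Cmult_comm, Csum_mult_l. apply Csum_ext. intros. apply Cmult_comm.
Qed.

Lemma Csum_switch (a : nat -> nat -> C) n m :
  Csum (fun i => Csum (a i) m) n = Csum (fun j => Csum (fun i => a i j) n) m :> C.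
Proof. apply (sum_n_switch (G := C_AbelianMonoid)). Qed.

Lemma Csum_shift (a : nat -> C) n : Csum a (S n) = a 0%nat + Csum (fun i => a (S i)) n :> C.
Proof.
  induction n as [|n IH]; [now rewrite Csum_S, !Csum_0|].
  rewrite Csum_S, IH, Csum_S. ring.
Qed.

Lemma Csum_zero (a : nat -> C) n : (forall i, (i <= n)%nat -> a i = 0) -> Csum a n = 0 :> C.
Proof.
  intros H. induction n as [|n IH]; [rewrite Csum_0; auto|].
  rewrite Csum_S, IH, H by auto. ring.
Qed.

(** Together with [Csum_trim_lo], this cuts a sum down to the range where its terms
    can be nonzero. *)
Lemma Csum_trim_hi (a : nat -> C) n l :
  (forall j, (n < j <= n + l)%nat -> a j = 0) -> Csum a (n + l) = Csum a n :> C.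
Proof.
  intros H. induction l as [|l IH]; [now rewrite Nat.add_0_r|].
  rewrite Nat.add_succ_r, Csum_S, IH, H; [ring | lia |].
  intros j Hj. apply H. lia.
Qed.

Lemma Csum_trim_lo (a : nat -> C) i n :
  (forall j, (j < i)%nat -> a j = 0) -> Csum a (i + n) = Csum (fun m => a (i + m)%nat) n :> C.
Proof.
  intros H. induction n as [|n IH].
  - rewrite Nat.add_0_r, Csum_0, Nat.add_0_r.
    destruct i as [|i]; [apply Csum_0|].
    rewrite Csum_S, Csum_zero; [ring|]. intros; apply H; lia.
  - rewrite Nat.add_succ_r, !Csum_S, IH, Nat.add_succ_r. reflexivity.
Qed.

Lemma Csum_single (a : nat -> C) n k :
  (k <= n)%nat -> (forall i, (i <= n)%nat -> i <> k -> a i = 0) -> Csum a n = a k :> C.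
Proof.
  intros Hk H. induction n as [|n IH].
  - replace k with 0%nat by lia. apply Csum_0.
  - rewrite Csum_S. destruct (Nat.eq_dec k (S n)) as [->|E].
    + rewrite Csum_zero; [ring|]. intros i Hi. apply H; lia.
    + rewrite IH, (H (S n)); try lia; [ring|]. intros i Hi. apply H; lia.
Qed.

Lemma is_Cderive_Csum (F F' : nat -> C -> C) n z :
  (forall i, (i <= n)%nat -> is_Cderive (F i) z (F' i z)) ->
  is_Cderive (fun w => Csum (fun i => F i w) n) z (Csum (fun i => F' i z) n).
Proof.
  intros H. induction n as [|n IH].
  - rewrite Csum_0. apply (is_Cderive_ext_loc (F 0%nat)); [|now apply H].
    apply filter_forall. intros w. now rewrite Csum_0.
  - rewrite Csum_S. apply (is_Cderive_ext_loc (fun w => Csum (fun i => F i w) n + F (S n) w)).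
    + apply filter_forall. intros w. now rewrite Csum_S.
    + apply is_Cderive_plus; [apply IH; auto|now apply H].
Qed.

(** * Integer powers *)

Lemma Cpowz_of_nat (w : C) n : Cpowz w (Z.of_nat n) = w ^ n.
Proof.
  destruct n as [|n]; [reflexivity|].
  change (Z.of_nat (S n)) with (Zpos (Pos.of_succ_nat n)). simpl.
  now rewrite SuccNat2Pos.id_succ.
Qed.

Lemma Cpowz_opp_of_nat (w : C) n : Cpowz w (- Z.of_nat n) = / w ^ n.
Proof.
  destruct n as [|n].
  - simpl. field.
  - change (Z.of_nat (S n)) with (Zpos (Pos.of_succ_nat n)). simpl.
    now rewrite SuccNat2Pos.id_succ.
Qed.

Lemma Cpowz_succ (w : C) n : w <> 0 -> Cpowz w (Z.succ n) = w * Cpowz w n.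
Proof.
  intros Hw. destruct (Z_le_gt_dec 0 n) as [Hn|Hn].
  - rewrite <- (Z2Nat.id n Hn), <- Nat2Z.inj_succ, !Cpowz_of_nat. apply Cpow_S.
  - replace n with (- Z.of_nat (S (Z.to_nat (- n - 1))))%Z by lia.
    replace (Z.succ (- Z.of_nat (S (Z.to_nat (- n - 1)))))%Z with (- Z.of_nat (Z.to_nat (- n - 1)))%Z by lia.
    rewrite !Cpowz_opp_of_nat, Cpow_S. field. split; [now apply Cpow_nz|assumption].
Qed.

(** Identities between invertible quantities can be moved from n to n + 1 and back,
    so one step handles positive and negative exponents alike. *)
Lemma Z_succ_ind (P : Z -> Prop) :
  P 0%Z -> (forall n, P n <-> P (Z.succ n)) -> forall n, P n.
Proof.
  intros H0 HS. apply Z.bi_induction; try assumption. now intros x y ->.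
Qed.

Lemma Cpowz_nz (w : C) n : w <> 0 -> Cpowz w n <> 0.
Proof.
  intros Hw. destruct n as [|p|p]; simpl.
  - apply C1_nz.
  - now apply Cpow_nz.
  - intros E. apply C1_nz.
    rewrite <- (Cinv_r (w ^ Pos.to_nat p)), E by now apply Cpow_nz. ring.
Qed.

Lemma Cpowz_add (w : C) n m : w <> 0 -> Cpowz w (n + m) = Cpowz w n * Cpowz w m.
Proof.
  intros Hw. revert n. apply Z_succ_ind.
  - simpl. ring.
  - intros n. rewrite Z.add_succ_l, !Cpowz_succ by assumption. split; intros H.
    + rewrite H. ring.
    + apply (f_equal (Cmult (/ w))) in H. rewrite !Cmult_assoc in H.
      now rewrite Cinv_l, !Cmult_1_l in H by assumption.
Qed.

Lemma Cpowz_mult (w v : C) n : w <> 0 -> v <> 0 -> Cpowz (w * v) n = Cpowz w n * Cpowz v n.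
Proof.
  intros Hw Hv. assert (Hwv : w * v <> 0) by now apply Cmult_neq_0.
  revert n. apply Z_succ_ind.
  - simpl. ring.
  - intros n. rewrite !Cpowz_succ by assumption. split; intros H.
    + rewrite H. ring.
    + apply (f_equal (Cmult (/ (w * v)))) in H.
      rewrite Cmult_assoc, Cinv_l, Cmult_1_l in H by assumption. rewrite H. field. auto.
Qed.

Lemma Cpowz_opp (w : C) n : w <> 0 -> Cpowz w (- n) = / Cpowz w n.
Proof.
  intros Hw. assert (H : Cpowz w (- n) * Cpowz w n = 1).
  { rewrite <- Cpowz_add by assumption. now rewrite Z.add_opp_diag_l. }
  pose proof (Cpowz_nz w n Hw).
  rewrite <- (Cmult_1_r (Cpowz w (- n))), <- (Cinv_r (Cpowz w n)), Cmult_assoc, H by assumption. ring.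
Qed.

Lemma Cpowz_inv (w : C) n : w <> 0 -> Cpowz (/ w) n = / Cpowz w n.
Proof.
  intros Hw. assert (Hw' : / w <> 0).
  { intros E. apply C1_nz. rewrite <- (Cinv_r w), E by assumption. ring. }
  pose proof (Cpowz_nz w n Hw).
  assert (H1 : forall n, Cpowz 1 n = 1).
  { apply Z_succ_ind; [reflexivity|]. intros m. rewrite Cpowz_succ by apply C1_nz.
    now rewrite Cmult_1_l. }
  assert (E : Cpowz w n * Cpowz (/ w) n = 1).
  { rewrite <- Cpowz_mult by assumption. rewrite Cinv_r by assumption. apply H1. }
  rewrite <- (Cmult_1_l (Cpowz (/ w) n)), <- (Cinv_l (Cpowz w n)), <- Cmult_assoc, E by assumption. ring.
Qed.

Lemma is_Cderive_Cpowz (w : C) n :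
  w <> 0 -> is_Cderive (fun v => Cpowz v n) w (RtoC (IZR n) * Cpowz w (n - 1)).
Proof.
  intros Hw. revert n. apply Z_succ_ind.
  - apply (is_Cderive_eq _ _ 0); [exact (is_Cderive_const 1 w) | ring].
  - assert (Hloc : locally (T := C_UniformSpace) w (fun v : C => v <> 0)).
    { apply (proj2 (locally_Cmod w _)). exists (Cmod w). split; [now apply Cmod_gt_0|].
      intros v Hv ->. replace (0 - w) with (- w) in Hv by ring. rewrite Cmod_opp in Hv. lra. }
    intros n. replace (Z.succ n - 1)%Z with n by lia.
    assert (En : Cpowz w n = w * Cpowz w (n - 1)).
    { rewrite <- Cpowz_succ by assumption. f_equal. lia. }
    rewrite succ_IZR. rewrite RtoC_plus. split; intros H.
    + apply (is_Cderive_ext_loc (fun v => v * Cpowz v n)).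
      { eapply filter_imp; [|exact Hloc]. intros v Hv. now rewrite Cpowz_succ. }
      eapply is_Cderive_eq; [apply is_Cderive_mult; [apply is_Cderive_id|exact H]|].
      cbv beta. rewrite En. ring.
    + apply (is_Cderive_ext_loc (fun v => / v * Cpowz v (Z.succ n))).
      { eapply filter_imp; [|exact Hloc]. intros v Hv. rewrite Cpowz_succ by assumption. field. assumption. }
      eapply is_Cderive_eq; [apply is_Cderive_mult; [apply is_Cderive_inv; assumption|exact H]|].
      cbv beta. rewrite Cpowz_succ, En by assumption. field. assumption.
Qed.

(** * Iterated derivatives *)

Lemma holomorphic_derive_n (U : C -> Prop) (f : C -> C) n :
  @open C_UniformSpace U -> holomorphic_on U f -> holomorphic_on U (C_derive_n f n).
Proof.
  intros HU Hf. induction n as [|n IH]; [exact Hf|]. now apply holomorphic_derive.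
Qed.

Lemma is_Cderive_C_derive_n (U : C -> Prop) (f : C -> C) n z :
  @open C_UniformSpace U -> holomorphic_on U f -> U z ->
  is_Cderive (C_derive_n f n) z (C_derive_n f (S n) z).
Proof.
  intros HU Hf Hz. apply is_Cderive_C_derive. now apply (holomorphic_derive_n U f n HU Hf).
Qed.

(** Iterated derivatives are computed by exhibiting a sequence in which each function
    is the derivative of the previous one. *)
Lemma C_derive_n_unique (U : C -> Prop) (f : C -> C) (F : nat -> C -> C) :
  @open C_UniformSpace U -> (forall z, U z -> f z = F 0%nat z) ->
  (forall n z, U z -> is_Cderive (F n) z (F (S n) z)) ->
  forall n z, U z -> C_derive_n f n z = F n z.
Proof.
  intros HU H0 HS n. induction n as [|n IH]; [exact H0|].
  intros z Hz. simpl. apply is_C_derive_unique.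
  apply (is_Cderive_ext_loc (F n)); [|now apply HS].
  eapply filter_imp; [|exact (HU z Hz)]. intros w Hw. symmetry. now apply IH.
Qed.

(** * Coefficients in the derivatives of a transformed function *)

(** The coefficient of (ga t + de)^(q-k-i) ga^(k-i) f^(i)(w) in the k-th derivative of
    (ga t + de)^q f(w).  The recursion is the product rule: differentiating the
    power of ga t + de contributes the factor q - k - i, differentiating f^(i)
    shifts the index. *)
Fixpoint moebius_coef (q : Z) (k i : nat) : R :=
  match k with
  | O => match i with O => 1 | S _ => 0 end
  | S k' => (IZR q - INR k' - INR i) * moebius_coef q k' i
            + match i with O => 0 | S i' => moebius_coef q k' i' end
  end%R.

Lemma moebius_coef_gt q k i : (k < i)%nat -> moebius_coef q k i = 0%R.
Proof.
  revert i. induction k as [|k IH]; intros i Hi.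
  - destruct i; [lia|reflexivity].
  - simpl. rewrite IH by lia. destruct i as [|i]; [lia|]. rewrite IH by lia. ring.
Qed.

Lemma moebius_coef_diag q k : moebius_coef q k k = 1%R.
Proof.
  induction k as [|k IH]; [reflexivity|].
  cbn [moebius_coef]. rewrite moebius_coef_gt, IH by lia. ring.
Qed.

Lemma prod_range_last m n u : (m <= n)%nat -> prod_range m (S n) u = (prod_range m n u * u n)%R.
Proof.
  intros H. unfold prod_range. replace (S n - m)%nat with (S (n - m)) by lia.
  rewrite seq_S, map_app. simpl. replace (m + (n - m))%nat with n by lia.
  generalize (map u (seq m (n - m))). intros l.
  induction l as [|x l IH]; simpl; [ring|]. rewrite IH. ring.
Qed.

Lemma prod_range_first m n u : (m < n)%nat -> prod_range m n u = (u m * prod_range (S m) n u)%R.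
Proof.
  intros H. unfold prod_range. replace (n - m)%nat with (S (n - S m)) by lia. reflexivity.
Qed.

Lemma prod_range_empty m n u : (n <= m)%nat -> prod_range m n u = 1%R.
Proof. intros H. unfold prod_range. now replace (n - m)%nat with 0%nat by lia. Qed.

Lemma prod_range_split m n p u :
  (m <= n)%nat -> (n <= p)%nat -> (prod_range m n u * prod_range n p u = prod_range m p u)%R.
Proof.
  intros Hm Hp. replace p with (n + (p - n))%nat by lia.
  induction (p - n)%nat as [|k IH].
  - rewrite Nat.add_0_r, (prod_range_empty n n) by lia. ring.
  - rewrite Nat.add_succ_r, !prod_range_last, <- IH by lia. ring.
Qed.

(** The closed form binom(i+m, i) (q-i) ... (q-i-m+1), with denominators cleared. *)
Lemma moebius_coef_explicit q m : forall i,
  (INR (fact m) * INR (fact i) * moebius_coef q (i + m) i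
   = INR (fact (i + m)) * prod_range i (i + m) (fun l => IZR q - INR l))%R.
Proof.
  induction m as [|m IHm]; intros i.
  - rewrite Nat.add_0_r, moebius_coef_diag, prod_range_empty by lia. simpl. ring.
  - induction i as [|i IHi].
    + specialize (IHm 0%nat). simpl Nat.add in *.
      rewrite prod_range_last by lia. cbn [moebius_coef].
      rewrite fact_simpl, mult_INR. simpl (fact 0) in *. simpl (INR 0) in *. simpl (INR 1) in *.
      transitivity (INR (S m) * (IZR q - INR m) * (INR (fact m) * 1 * moebius_coef q m 0))%R; [ring|].
      rewrite IHm. ring.
    + specialize (IHm (S i)).
      replace (S i + S m)%nat with (S (i + S m)) by lia.
      replace (S i + m)%nat with (i + S m)%nat in IHm by lia.
      rewrite prod_range_first in IHi by lia.
      rewrite prod_range_last by lia.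
      set (P := prod_range (S i) (i + S m) (fun l => IZR q - INR l)%R) in *.
      cbn [moebius_coef].
      set (k := (i + S m)%nat) in *.
      set (A := moebius_coef q k (S i)) in *. set (B := moebius_coef q k i) in *.
      rewrite (fact_simpl k), mult_INR.
      assert (E1 : INR (fact (S m)) = (INR (S m) * INR (fact m))%R) by (now rewrite fact_simpl, mult_INR).
      assert (E2 : INR (fact (S i)) = (INR (S i) * INR (fact i))%R) by (now rewrite fact_simpl, mult_INR).
      transitivity ((IZR q - INR k - INR (S i)) * INR (S m) * (INR (fact m) * INR (fact (S i)) * A)
        + INR (S i) * (INR (fact (S m)) * INR (fact i) * B))%R.
      { rewrite E1, E2. ring. }
      rewrite IHm, IHi.
      replace (INR (S k)) with (INR i + INR m + 2)%R by (unfold k; rewrite !S_INR, plus_INR, S_INR; ring).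
      replace (INR k) with (INR i + INR m + 1)%R by (unfold k; rewrite plus_INR, S_INR; ring).
      rewrite !S_INR. ring.
Qed.

Lemma RtoC_sum_f_R0 (a : nat -> R) n : RtoC (sum_f_R0 a n) = Csum (fun i => RtoC (a i)) n.
Proof.
  induction n as [|n IH]; [now rewrite Csum_0|].
  rewrite Csum_S, <- IH. simpl. now rewrite RtoC_plus.
Qed.

Lemma alternating_binomial_sum n :
  (0 < n)%nat -> sum_f_R0 (fun m => (-1) ^ m * Binomial.C n m)%R n = 0%R.
Proof.
  intros Hn. transitivity ((-1 + 1) ^ n)%R.
  - rewrite binomial. apply sum_eq. intros i _. rewrite pow1. ring.
  - replace (-1 + 1)%R with 0%R by ring. now apply pow_i.
Qed.

(** The products over q from i to j-1 and from j to M-1 (and likewise over q')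
    combine, as do the multinomial factors, so that apart from a constant only
    (-1)^m binom(n, m) depends on j = i + m. *)
Lemma gamma_coef_term q q' i l n m :
  (m <= n)%nat ->
  let M := (i + n + l)%nat in
  (gamma q q' M (i + m) * moebius_coef q (i + m) i * moebius_coef q' (M - (i + m)) l
   = (INR (fact M) / (INR (fact i) * INR (fact l) * INR (fact n)) * (-1) ^ i
      * prod_range i M (fun s => IZR q - INR s) * prod_range l M (fun s => IZR q' - INR s))
     * ((-1) ^ m * Binomial.C n m))%R.
Proof.
  intros Hm M. unfold gamma.
  replace (M - (i + m))%nat with (l + (n - m))%nat by (unfold M; lia).
  pose proof (moebius_coef_explicit q m i) as E1.
  pose proof (moebius_coef_explicit q' (n - m) l) as E2.
  rewrite <- (prod_range_split i (i + m) M) by (unfold M; lia).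
  rewrite <- (prod_range_split l (l + (n - m)) M) by (unfold M; lia).
  set (A1 := moebius_coef q (i + m) i) in *. set (A2 := moebius_coef q' (l + (n - m)) l) in *.
  set (P1 := prod_range i (i + m) _) in *. set (P2 := prod_range l (l + (n - m)) _) in *.
  set (Q1 := prod_range (i + m) M _). set (Q2 := prod_range (l + (n - m)) M _).
  unfold Binomial.C.
  replace (M - (i + m))%nat with (l + (n - m))%nat by (unfold M; lia).
  pose proof (INR_fact_neq_0 i). pose proof (INR_fact_neq_0 l). pose proof (INR_fact_neq_0 n).
  pose proof (INR_fact_neq_0 m). pose proof (INR_fact_neq_0 (n - m)).
  pose proof (INR_fact_neq_0 (i + m)). pose proof (INR_fact_neq_0 (l + (n - m))).
  assert (F1 : A1 = (INR (fact (i + m)) * P1 / (INR (fact m) * INR (fact i)))%R).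
  { rewrite <- E1. field. auto. }
  assert (F2 : A2 = (INR (fact (l + (n - m))) * P2 / (INR (fact (n - m)) * INR (fact l)))%R).
  { rewrite <- E2. field. auto. }
  rewrite F1, F2, pow_add. field. repeat split; assumption.
Qed.

(** For i + l < M the terms of [gamma_coef_term] add up to a multiple of
    (1 - 1)^(M-i-l); for i + l > M every term has a vanishing factor. *)
Lemma gamma_coef_sum q q' M i l :
  (i <= M)%nat -> (l <= M)%nat ->
  Csum (fun j => RtoC (gamma q q' M j * moebius_coef q j i * moebius_coef q' (M - j) l)) M
  = (if Nat.eq_dec (i + l) M then RtoC (gamma q q' M i) else RtoC 0) :> C.
Proof.
  intros Hi Hl. destruct (Nat.eq_dec (i + l) M) as [E|E].
  - rewrite (Csum_single _ M i Hi).
    2: { intros j Hj Hne. destruct (Nat.lt_ge_cases j i).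
      - rewrite (moebius_coef_gt q j i) by assumption. f_equal; ring.
      - rewrite (moebius_coef_gt q' (M - j) l) by lia. f_equal; ring. }
    f_equal. replace (M - i)%nat with l by lia. rewrite !moebius_coef_diag. ring.
  - destruct (Nat.lt_ge_cases M (i + l)) as [L|L].
    + apply Csum_zero. intros j Hj. destruct (Nat.lt_ge_cases j i).
      * rewrite (moebius_coef_gt q j i) by assumption. f_equal; ring.
      * rewrite (moebius_coef_gt q' (M - j) l) by lia. f_equal; ring.
    + set (n := (M - i - l)%nat).
      assert (EM : M = (i + n + l)%nat) by (unfold n; lia).
      clearbody n. subst M.
      rewrite Csum_trim_hi.
      2: { intros j Hj. rewrite (moebius_coef_gt q' (i + n + l - j) l) by lia. f_equal; ring. }
      rewrite Csum_trim_lo.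
      2: { intros j Hj. rewrite (moebius_coef_gt q j i) by assumption. f_equal; ring. }
      erewrite Csum_ext.
      2: { intros m Hm. rewrite (gamma_coef_term q q' i l n m Hm), RtoC_mult. reflexivity. }
      rewrite <- Csum_mult_l, <- RtoC_sum_f_R0, alternating_binomial_sum by lia. ring.
Qed.

(** * Covariance of the transvectant under Moebius changes of variable *)

Definition moebius (al be ga de : C) (t : C) : C := (al * t + be) / (ga * t + de).

Lemma is_Cderive_affine (ga de t : C) : is_Cderive (fun s => ga * s + de) t ga.
Proof.
  apply (is_Cderive_eq _ _ (ga * 1 + 0)); [|ring].
  apply (is_Cderive_plus (fun s => ga * s) (fun _ => de)); [|apply is_Cderive_const].
  apply (is_Cderive_cmult ga (fun s => s)), is_Cderive_id.
Qed.

Lemma is_Cderive_moebius al be ga de t :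
  al * de - be * ga = 1 -> ga * t + de <> 0 ->
  is_Cderive (moebius al be ga de) t (/ ((ga * t + de) * (ga * t + de))).
Proof.
  intros Hdet Ht. eapply is_Cderive_eq.
  - apply (is_Cderive_mult (fun s => al * s + be) (fun s => / (ga * s + de)));
      [apply is_Cderive_affine|].
    apply (is_Cderive_inv_comp (fun s => ga * s + de)); [exact Ht|apply is_Cderive_affine].
  - cbv beta. transitivity ((al * de - be * ga) / ((ga * t + de) * (ga * t + de))).
    + field. assumption.
    + rewrite Hdet. field. assumption.
Qed.

(** Induction on [k], with the inverse square of ga t + de as derivative of the
    Moebius map; this is where the determinant enters.  The open set [V] localizes
    the hypothesis on [F], which at exceptional points of a section is only a local
    formula. *)
Lemma moebius_derive_n (V U : C -> Prop) (f F : C -> C) (q : Z) al be ga de :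
  al * de - be * ga = 1 ->
  @open C_UniformSpace U -> holomorphic_on U f -> @open C_UniformSpace V ->
  (forall s, V s -> ga * s + de <> 0 /\ U (moebius al be ga de s) /\
     F s = Cpowz (ga * s + de) q * f (moebius al be ga de s)) ->
  forall k s, V s ->
    C_derive_n F k s = Csum (fun i => RtoC (moebius_coef q k i) * ga ^ (k - i)
      * Cpowz (ga * s + de) (q - Z.of_nat k - Z.of_nat i)
      * C_derive_n f i (moebius al be ga de s)) k.
Proof.
  intros Hdet HU Hf HV HF k s Hs.
  apply (C_derive_n_unique V F (fun k s => Csum (fun i => RtoC (moebius_coef q k i) * ga ^ (k - i)
      * Cpowz (ga * s + de) (q - Z.of_nat k - Z.of_nat i)
      * C_derive_n f i (moebius al be ga de s)) k)); try assumption.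
  - intros t Ht. destruct (HF t Ht) as (_ & _ & ->). rewrite Csum_0. simpl.
    rewrite !Z.sub_0_r. ring.
  - clear k s Hs. intros k t Ht. destruct (HF t Ht) as (H0 & HUt & _).
    set (u := ga * t + de) in *. set (w := moebius al be ga de t) in *.
    eapply is_Cderive_eq.
    + apply (is_Cderive_Csum (fun i s => RtoC (moebius_coef q k i) * ga ^ (k - i)
      * Cpowz (ga * s + de) (q - Z.of_nat k - Z.of_nat i)
      * C_derive_n f i (moebius al be ga de s))
       (fun i s => RtoC (moebius_coef q k i) * ga ^ (k - i)
         * (ga * (RtoC (IZR (q - Z.of_nat k - Z.of_nat i)) * Cpowz (ga * s + de) (q - Z.of_nat k - Z.of_nat i - 1)))
         * C_derive_n f i (moebius al be ga de s)
         + RtoC (moebius_coef q k i) * ga ^ (k - i)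
         * Cpowz (ga * s + de) (q - Z.of_nat k - Z.of_nat i)
         * (/ ((ga * s + de) * (ga * s + de)) * C_derive_n f (S i) (moebius al be ga de s)))).
      intros i Hi.
      apply (is_Cderive_mult (fun s => RtoC (moebius_coef q k i) * ga ^ (k - i)
          * Cpowz (ga * s + de) (q - Z.of_nat k - Z.of_nat i))
        (fun s => C_derive_n f i (moebius al be ga de s))).
      * apply (is_Cderive_cmult (RtoC (moebius_coef q k i) * ga ^ (k - i))).
        apply (is_Cderive_comp (fun v => Cpowz v (q - Z.of_nat k - Z.of_nat i)) (fun s => ga * s + de));
          [now apply is_Cderive_Cpowz|apply is_Cderive_affine].
      * apply (is_Cderive_comp (C_derive_n f i) (moebius al be ga de));
          [now apply (is_Cderive_C_derive_n U)|now apply is_Cderive_moebius].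
    + cbv beta. fold u w. rewrite Csum_plus.
      (* split into the terms from the power of ga t + de and those from f^(i), the
         latter shifted by one *)
      set (B := fun i => Cpowz u (q - Z.of_nat (S k) - Z.of_nat i) * C_derive_n f i w).
      transitivity (Csum (fun i => RtoC ((IZR q - INR k - INR i) * moebius_coef q k i) * ga ^ (S k - i) * B i) (S k)
        + Csum (fun i => RtoC (match i with O => 0 | S i' => moebius_coef q k i' end) * ga ^ (S k - i) * B i) (S k)).
      * f_equal.
        -- rewrite (Csum_S _ k), (moebius_coef_gt q k (S k)), Rmult_0_r, !Cmult_0_l, Cplus_0_r by lia.
           apply Csum_ext. intros i Hi. unfold B.
           replace (S k - i)%nat with (S (k - i)) by lia. rewrite Cpow_S.
           replace (q - Z.of_nat (S k) - Z.of_nat i)%Z with (q - Z.of_nat k - Z.of_nat i - 1)%Z by lia.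
           rewrite !minus_IZR, <- !INR_IZR_INZ, RtoC_mult. ring.
        -- rewrite Csum_shift, !Cmult_0_l, Cplus_0_l.
           apply Csum_ext. intros i Hi. unfold B.
           replace (S k - S i)%nat with (k - i)%nat by lia.
           replace (q - Z.of_nat k - Z.of_nat i)%Z
             with (Z.succ (Z.succ (q - Z.of_nat (S k) - Z.of_nat (S i))))%Z by lia.
           rewrite !Cpowz_succ by assumption. field. assumption.
      * rewrite <- Csum_plus. apply Csum_ext. intros i Hi. unfold B.
        cbn [moebius_coef]. rewrite RtoC_plus. ring.
Qed.

(** The weight q + q' - 2M comes from the terms with i + l = M, where
    (ga t + de)^(q-j-i) (ga t + de)^(q'-(M-j)-l) has exponent q + q' - 2M and no
    power of ga is left; all other terms cancel by [gamma_coef_sum]. *)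
Lemma transvectant_moebius (V U : C -> Prop) (f g F G : C -> C) (q q' : Z) (M : nat) al be ga de :
  al * de - be * ga = 1 ->
  @open C_UniformSpace U -> holomorphic_on U f -> holomorphic_on U g -> @open C_UniformSpace V ->
  (forall s, V s -> ga * s + de <> 0 /\ U (moebius al be ga de s) /\
     F s = Cpowz (ga * s + de) q * f (moebius al be ga de s) /\
     G s = Cpowz (ga * s + de) q' * g (moebius al be ga de s)) ->
  forall s, V s ->
    transvectant_expr q q' M F G s =
    Cpowz (ga * s + de) (q + q' - 2 * Z.of_nat M) * transvectant_expr q q' M f g (moebius al be ga de s).
Proof.
  intros Hdet HU Hf Hg HV HFG s Hs. destruct (HFG s Hs) as (Hu & HUs & _).
  assert (DF := moebius_derive_n V U f F q al be ga de Hdet HU Hf HV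
    ltac:(intros t Ht; destruct (HFG t Ht) as (? & ? & ? & ?); auto)).
  assert (DG := moebius_derive_n V U g G q' al be ga de Hdet HU Hg HV
    ltac:(intros t Ht; destruct (HFG t Ht) as (? & ? & ? & ?); auto)).
  set (u := ga * s + de) in *. set (w := moebius al be ga de s) in *.
  (* extend all inner sums to M, so that the order of summation can be exchanged *)
  assert (Hfull : forall (q : Z) (f F : C -> C) k, (k <= M)%nat ->
     (C_derive_n F k s = Csum (fun i => RtoC (moebius_coef q k i) * ga ^ (k - i)
       * Cpowz u (q - Z.of_nat k - Z.of_nat i) * C_derive_n f i w) k) ->
     C_derive_n F k s = Csum (fun i => RtoC (moebius_coef q k i) * ga ^ (k - i)
       * Cpowz u (q - Z.of_nat k - Z.of_nat i) * C_derive_n f i w) M).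
  { intros q0 f0 F0 k Hk ->. replace M with (k + (M - k))%nat at 1 by lia.
    symmetry. apply Csum_trim_hi. intros j Hj. rewrite moebius_coef_gt by lia. ring. }
  unfold transvectant_expr.
  transitivity (Csum (fun j => Csum (fun i => Csum (fun l =>
     RtoC (gamma q q' M j * moebius_coef q j i * moebius_coef q' (M - j) l)
     * (ga ^ (M - i - l) * Cpowz u (q + q' - Z.of_nat M - Z.of_nat i - Z.of_nat l)
        * C_derive_n f i w * C_derive_n g l w)) M) M) M).
  { apply Csum_ext. intros j Hj.
    rewrite (Hfull q f F j Hj (DF j s Hs)), (Hfull q' g G (M - j)%nat ltac:(lia) (DG (M - j)%nat s Hs)).
    rewrite (Csum_mult_l (RtoC (gamma q q' M j))), Csum_mult_r. apply Csum_ext. intros i Hi.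
    rewrite Csum_mult_l. apply Csum_ext. intros l Hl.
    destruct (Nat.lt_ge_cases j i).
    { rewrite (moebius_coef_gt q j i) by assumption. rewrite Rmult_0_r, Rmult_0_l. ring. }
    destruct (Nat.lt_ge_cases (M - j) l).
    { rewrite (moebius_coef_gt q' (M - j) l) by assumption. rewrite Rmult_0_r. ring. }
    replace (M - i - l)%nat with ((j - i) + (M - j - l))%nat by lia.
    rewrite Cpow_add_r.
    replace (q + q' - Z.of_nat M - Z.of_nat i - Z.of_nat l)%Z
      with ((q - Z.of_nat j - Z.of_nat i) + (q' - Z.of_nat (M - j) - Z.of_nat l))%Z by lia.
    rewrite Cpowz_add, !RtoC_mult by assumption. ring. }
  rewrite Csum_switch.
  transitivity (Csum (fun i => Csum (fun l => Csum (fun j =>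
     RtoC (gamma q q' M j * moebius_coef q j i * moebius_coef q' (M - j) l)) M
     * (ga ^ (M - i - l) * Cpowz u (q + q' - Z.of_nat M - Z.of_nat i - Z.of_nat l)
        * C_derive_n f i w * C_derive_n g l w)) M) M).
  { apply Csum_ext. intros i Hi. rewrite Csum_switch. apply Csum_ext. intros l Hl.
    rewrite Csum_mult_r. reflexivity. }
  rewrite Csum_mult_l. apply Csum_ext. intros i Hi.
  rewrite (Csum_single _ M (M - i)%nat); [|lia|].
  - rewrite gamma_coef_sum by lia.
    destruct (Nat.eq_dec (i + (M - i)) M) as [_|N]; [|lia].
    replace (M - i - (M - i))%nat with 0%nat by lia.
    replace (q + q' - Z.of_nat M - Z.of_nat i - Z.of_nat (M - i))%Z with (q + q' - 2 * Z.of_nat M)%Z by lia.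
    simpl (ga ^ 0). ring.
  - intros l Hl Hne. rewrite gamma_coef_sum by lia.
    destruct (Nat.eq_dec (i + l) M) as [E|_]; [lia|]. ring.
Qed.

(** * Sections as homogeneous functions of two variables *)

(** The cone over the domain of a section: the point of CP_1 with homogeneous
    coordinates (x, y) has z = x/y and zeta = -y/x. *)
Definition hom_dom (f : local_data) (x y : C) : Prop :=
  if Ceq_dec y 0 then dom2 f 0 else dom1 f (x / y).

(** The homogeneous function of degree [q] that represents a section.  For y = 0 its
    value is read in the other chart, as in the action on sections. *)
Definition hom_fun (q : Z) (f : local_data) (x y : C) : C :=
  if Ceq_dec y 0 then Cpowz (- x) q * fun2 f 0 else Cpowz y q * fun1 f (x / y).

Lemma Copp_neq_0 (x : C) : x <> 0 -> - x <> 0.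
Proof. intros H E. apply H. replace x with (- - x) by ring. rewrite E. ring. Qed.

Lemma Cdiv_neq_0 (x y : C) : x <> 0 -> y <> 0 -> x / y <> 0.
Proof.
  intros Hx Hy E. apply Hx. replace x with (x / y * y) by (field; assumption). rewrite E. ring.
Qed.

Lemma Cm1_neq_0 : - 1 <> 0 :> C.
Proof. apply RtoC_neq_0. lra. Qed.

Lemma Cpowz_1 n : Cpowz 1 n = 1.
Proof.
  revert n. apply Z_succ_ind; [reflexivity|]. intros m.
  rewrite Cpowz_succ by apply C1_nz. now rewrite Cmult_1_l.
Qed.

Lemma Cpowz_transition (z : C) q : z <> 0 -> Cpowz (- 1 / z) (- q) = Cpowz (- z) q.
Proof.
  intros Hz. assert (Hz' := Copp_neq_0 z Hz).
  rewrite Cpowz_opp by (apply Cdiv_neq_0; [apply Cm1_neq_0|assumption]).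
  replace (- 1 / z) with (/ (- z)).
  2: { field. assumption. }
  rewrite Cpowz_inv by assumption. field. now apply Cpowz_nz.
Qed.

Lemma hom_dom_chart2 q f (x y : C) :
  is_section q f -> x <> 0 -> (hom_dom f x y <-> dom2 f (y / - x)).
Proof.
  intros (_ & _ & Hd & _) Hx. unfold hom_dom. destruct (Ceq_dec y 0) as [->|Hy].
  - replace (0 / - x) with (RtoC 0); [tauto|]. field. assumption.
  - rewrite Hd by now apply Cdiv_neq_0.
    replace (- 1 / (x / y)) with (y / - x) by (field; auto). tauto.
Qed.

(** The transition law of sections says precisely that both charts define the same
    homogeneous function. *)
Lemma hom_fun_chart2 q f (x y : C) :
  is_section q f -> x <> 0 -> hom_dom f x y ->
  hom_fun q f x y = Cpowz (- x) q * fun2 f (y / - x).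
Proof.
  intros (_ & _ & _ & _ & _ & Ht) Hx. unfold hom_dom, hom_fun. destruct (Ceq_dec y 0) as [->|Hy]; intros H.
  - replace (0 / - x) with (RtoC 0); [reflexivity|]. field. assumption.
  - rewrite Ht by (assumption || now apply Cdiv_neq_0).
    replace (- 1 / (x / y)) with (y / - x) by (field; auto).
    rewrite Cmult_assoc. f_equal.
    rewrite Cpowz_opp, <- Cpowz_inv by (apply Cdiv_neq_0; [assumption|now apply Copp_neq_0]).
    rewrite <- Cpowz_mult; [f_equal; field; auto|assumption|].
    replace (/ (y / - x)) with (- x / y) by (field; auto).
    apply Cdiv_neq_0; [now apply Copp_neq_0|assumption].
Qed.

Lemma hom_dom_scale f (k x y : C) : k <> 0 -> (hom_dom f (k * x) (k * y) <-> hom_dom f x y).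
Proof.
  intros Hk. unfold hom_dom. destruct (Ceq_dec y 0) as [->|Hy].
  - destruct (Ceq_dec (k * 0) 0) as [_|N]; [tauto|]. elim N. ring.
  - destruct (Ceq_dec (k * y) 0) as [N|_].
    + exfalso. revert N. now apply Cmult_neq_0.
    + replace (k * x / (k * y)) with (x / y) by (field; auto). tauto.
Qed.

Lemma hom_fun_scale q f (k x y : C) :
  k <> 0 -> (x <> 0 \/ y <> 0) -> hom_fun q f (k * x) (k * y) = Cpowz k q * hom_fun q f x y.
Proof.
  intros Hk Hxy. unfold hom_fun. destruct (Ceq_dec y 0) as [->|Hy].
  - destruct (Ceq_dec (k * 0) 0) as [_|N]; [|elim N; ring].
    assert (Hx : x <> 0) by tauto.
    replace (- (k * x)) with (k * - x) by ring.
    rewrite Cpowz_mult by (assumption || now apply Copp_neq_0). ring.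
  - destruct (Ceq_dec (k * y) 0) as [N|_].
    + exfalso. revert N. now apply Cmult_neq_0.
    + replace (k * x / (k * y)) with (x / y) by (field; auto).
      rewrite Cpowz_mult by assumption. ring.
Qed.

(** A boolean selects the chart, so that arguments needing one chart around a point
    can be given once for both. *)
Definition chart_dom (ch : bool) (f : local_data) : C -> Prop := if ch then dom1 f else dom2 f.
Definition chart_fun (ch : bool) (f : local_data) : C -> C := if ch then fun1 f else fun2 f.

Lemma chart_open ch q f : is_section q f -> @open C_UniformSpace (chart_dom ch f).
Proof. intros (H1 & H2 & _). now destruct ch. Qed.

Lemma chart_holomorphic ch q f : is_section q f -> holomorphic_on (chart_dom ch f) (chart_fun ch f).
Proof. intros (_ & _ & _ & H1 & H2 & _). now destruct ch. Qed.

Lemma curve_neq_0 (al be ga de t : C) :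
  al * de - be * ga = 1 -> al * t + be <> 0 \/ ga * t + de <> 0.
Proof.
  intros Hdet. destruct (Ceq_dec (ga * t + de) 0) as [E|]; [left|now right].
  intros E'. apply C1_nz. rewrite <- Hdet.
  replace (al * de - be * ga) with (al * (ga * t + de) - ga * (al * t + be)) by ring.
  rewrite E, E'. ring.
Qed.

(** A line of determinant 1 avoids the origin, so near each of its points one
    coordinate is nonzero.  In the corresponding chart the line becomes a Moebius
    map, and the homogeneous function its pull-back with the factor
    (ga' t + de')^q. *)
Lemma curve_chart (al be ga de t : C) :
  al * de - be * ga = 1 ->
  exists (ch : bool) (al' be' ga' de' : C),
    al' * de' - be' * ga' = 1 /\ ga' * t + de' <> 0 /\
    forall q f s, is_section q f -> ga' * s + de' <> 0 ->
      (hom_dom f (al * s + be) (ga * s + de) <-> chart_dom ch f (moebius al' be' ga' de' s)) /\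
      (hom_dom f (al * s + be) (ga * s + de) ->
       hom_fun q f (al * s + be) (ga * s + de)
       = Cpowz (ga' * s + de') q * chart_fun ch f (moebius al' be' ga' de' s)).
Proof.
  intros Hdet. destruct (Ceq_dec (ga * t + de) 0) as [E|E].
  - assert (Hx : al * t + be <> 0) by (destruct (curve_neq_0 al be ga de t Hdet); tauto).
    exists false, ga, de, (- al), (- be). split; [rewrite <- Hdet; ring|].
    assert (Ex : forall s, - al * s + - be = - (al * s + be)) by (intros; ring).
    split; [rewrite Ex; now apply Copp_neq_0|].
    intros q f s Hf Hs. unfold moebius. rewrite Ex in *.
    assert (Hs' : al * s + be <> 0) by (intros N; apply Hs; rewrite N; ring).
    split; [now apply (hom_dom_chart2 q)|]. now apply hom_fun_chart2.
  - exists true, al, be, ga, de. split; [assumption|]. split; [assumption|].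
    intros q f s Hf Hs. unfold hom_dom, hom_fun, moebius.
    destruct (Ceq_dec (ga * s + de) 0) as [N|_]; [now elim Hs|]. simpl. tauto.
Qed.

Lemma locally_moebius (U : C -> Prop) al be ga de t :
  al * de - be * ga = 1 -> @open C_UniformSpace U ->
  ga * t + de <> 0 -> U (moebius al be ga de t) ->
  locally (T := C_UniformSpace) t (fun s => ga * s + de <> 0 /\ U (moebius al be ga de s)).
Proof.
  intros Hdet HU Ht HUt. apply filter_and.
  - assert (Hc : Ccontinuous (fun s => ga * s + de) t).
    { apply ex_Cderive_continuous. eexists. apply is_Cderive_affine. }
    destruct (proj1 (Ccontinuous_Cmod _ _) Hc (Cmod (ga * t + de))) as [d [Hd H]]; [now apply Cmod_gt_0|].
    apply (proj2 (locally_Cmod t _)). exists d. split; [assumption|]. intros s Hs E.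
    specialize (H s Hs). cbv beta in H. rewrite E in H.
    replace (0 - (ga * t + de)) with (- (ga * t + de)) in H by ring. rewrite Cmod_opp in H. lra.
  - assert (Hc : Ccontinuous (moebius al be ga de) t).
    { apply ex_Cderive_continuous. eexists. now apply is_Cderive_moebius. }
    exact (Hc U (HU _ HUt)).
Qed.

Lemma open_moebius (U : C -> Prop) al be ga de :
  al * de - be * ga = 1 -> @open C_UniformSpace U ->
  @open C_UniformSpace (fun s => ga * s + de <> 0 /\ U (moebius al be ga de s)).
Proof. intros Hdet HU t [Ht HUt]. now apply locally_moebius. Qed.

(** With [curve_holomorphic], this gives at once all the regularity of the transformed
    sections, including at points that the transformation sends to infinity. *)
Lemma curve_open q f al be ga de :
  al * de - be * ga = 1 -> is_section q f ->
  @open C_UniformSpace (fun t => hom_dom f (al * t + be) (ga * t + de)).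
Proof.
  intros Hdet Hf t Ht.
  destruct (curve_chart al be ga de t Hdet) as (ch & al' & be' & ga' & de' & Hdet' & Ht' & H).
  eapply filter_imp; [|apply (locally_moebius (chart_dom ch f) al' be' ga' de' t Hdet')].
  - intros s [Hs HUs]. now apply (H q f s Hf Hs).
  - now apply (chart_open ch q).
  - assumption.
  - now apply (H q f t Hf Ht').
Qed.

Lemma curve_holomorphic q f al be ga de :
  al * de - be * ga = 1 -> is_section q f ->
  holomorphic_on (fun t => hom_dom f (al * t + be) (ga * t + de))
    (fun t => hom_fun q f (al * t + be) (ga * t + de)).
Proof.
  intros Hdet Hf t Ht.
  destruct (curve_chart al be ga de t Hdet) as (ch & al' & be' & ga' & de' & Hdet' & Ht' & H).
  apply (ex_Cderive_ext_loc (fun s => Cpowz (ga' * s + de') q * chart_fun ch f (moebius al' be' ga' de' s))).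
  - eapply filter_imp; [|apply (locally_moebius (chart_dom ch f) al' be' ga' de' t Hdet')].
    + intros s [Hs HUs]. symmetry. destruct (H q f s Hf Hs) as [H1 H2]. apply H2. now apply H1.
    + now apply (chart_open ch q).
    + assumption.
    + now apply (H q f t Hf Ht').
  - apply (ex_Cderive_mult (fun s => Cpowz (ga' * s + de') q)).
    + eexists. apply (is_Cderive_comp (fun v => Cpowz v q) (fun s => ga' * s + de'));
        [now apply is_Cderive_Cpowz|apply is_Cderive_affine].
    + destruct (chart_holomorphic ch q f Hf (moebius al' be' ga' de' t)) as [l Hl].
      { now apply (H q f t Hf Ht'). }
      eexists. apply (is_Cderive_comp (chart_fun ch f) (moebius al' be' ga' de'));
        [exact Hl|now apply is_Cderive_moebius].
Qed.

Lemma open_neq_0 : @open C_UniformSpace (fun z : C => z <> 0).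
Proof.
  intros z Hz. apply (proj2 (locally_Cmod z _)). exists (Cmod z). split; [now apply Cmod_gt_0|].
  intros w Hw ->. replace (0 - z) with (- z) in Hw by ring. rewrite Cmod_opp in Hw. lra.
Qed.

Lemma holomorphic_on_sub (U V : C -> Prop) f :
  (forall z, V z -> U z) -> holomorphic_on U f -> holomorphic_on V f.
Proof. intros H Hf z Hz. auto. Qed.

(** * The transvectant is an invariant pairing *)

Lemma transvectant_expr_holomorphic (U : C -> Prop) f g q q' M :
  @open C_UniformSpace U -> holomorphic_on U f -> holomorphic_on U g ->
  holomorphic_on U (transvectant_expr q q' M f g).
Proof.
  intros HU Hf Hg z Hz. unfold transvectant_expr. eexists.
  apply (is_Cderive_Csum (fun j z => RtoC (gamma q q' M j) * C_derive_n f j z * C_derive_n g (M - j) z)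
    (fun j z => RtoC (gamma q q' M j) * C_derive_n f (S j) z * C_derive_n g (M - j) z
      + RtoC (gamma q q' M j) * C_derive_n f j z * C_derive_n g (S (M - j)) z)).
  intros j Hj.
  apply (is_Cderive_mult (fun z => RtoC (gamma q q' M j) * C_derive_n f j z) (C_derive_n g (M - j))).
  - apply is_Cderive_cmult. now apply (is_Cderive_C_derive_n U).
  - now apply (is_Cderive_C_derive_n U).
Qed.

(** The transition map z |-> -1/z is the Moebius map of the matrix (0, 1; -1, 0), so the
    gluing law is an instance of [transvectant_moebius]. *)
Lemma transvectant_section q q' M f g :
  is_section q f -> is_section q' g ->
  is_section (q + q' - 2 * Z.of_nat M) (transvectant q q' M f g).
Proof.
  intros Hf Hg.
  pose proof Hf as (Fo1 & Fo2 & Fd & Fh1 & Fh2 & Ft). pose proof Hg as (Go1 & Go2 & Gd & Gh1 & Gh2 & Gt).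
  split; [now apply open_and|]. split; [now apply open_and|].
  split. { intros z Hz. simpl. now rewrite Fd, Gd. }
  split. { apply transvectant_expr_holomorphic; [now apply open_and| |];
    (eapply holomorphic_on_sub; [|eassumption]); simpl; tauto. }
  split. { apply transvectant_expr_holomorphic; [now apply open_and| |];
    (eapply holomorphic_on_sub; [|eassumption]); simpl; tauto. }
  intros z Hz [Hz1 Hz2]. rewrite Cpowz_transition by assumption.
  assert (Em : forall s : C, s <> 0 -> moebius 0 1 (- (1)) 0 s = - 1 / s).
  { intros s Hs. unfold moebius. field. assumption. }
  assert (Eu : forall s : C, - (1) * s + 0 = - s) by (intros; ring).
  simpl. rewrite (transvectant_moebius (fun s => s <> 0 /\ dom1 f s /\ dom1 g s)
    (fun s => dom2 f s /\ dom2 g s) (fun2 f) (fun2 g) (fun1 f) (fun1 g) q q' M 0 1 (- (1)) 0).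
  - now rewrite Em, Eu.
  - ring.
  - now apply open_and.
  - eapply holomorphic_on_sub; [|exact Fh2]. simpl; tauto.
  - eapply holomorphic_on_sub; [|exact Gh2]. simpl; tauto.
  - apply open_and; [apply open_neq_0|now apply open_and].
  - intros s (Hs & Hs1 & Hs2). rewrite Em, Eu by assumption.
    split; [now apply Copp_neq_0|]. split; [split; [now apply Fd|now apply Gd]|].
    rewrite <- !Cpowz_transition by assumption. auto.
  - auto.
Qed.

(** The transvectant commutes with restriction to a line of determinant 1: choose a
    chart by [curve_chart], the same for f, g and T(f, g), and change variables. *)
Lemma transvectant_curve q q' M f g F G al be ga de :
  al * de - be * ga = 1 -> is_section q f -> is_section q' g ->
  (forall t, hom_dom f (al * t + be) (ga * t + de) -> F t = hom_fun q f (al * t + be) (ga * t + de)) ->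
  (forall t, hom_dom g (al * t + be) (ga * t + de) -> G t = hom_fun q' g (al * t + be) (ga * t + de)) ->
  forall t, hom_dom f (al * t + be) (ga * t + de) -> hom_dom g (al * t + be) (ga * t + de) ->
  transvectant_expr q q' M F G t
  = hom_fun (q + q' - 2 * Z.of_nat M) (transvectant q q' M f g) (al * t + be) (ga * t + de).
Proof.
  intros Hdet Hf Hg HF HG t Htf Htg.
  destruct (curve_chart al be ga de t Hdet) as (ch & al' & be' & ga' & de' & Hdet' & Ht' & H).
  pose proof (transvectant_section q q' M f g Hf Hg) as HT.
  set (U := fun s => chart_dom ch f s /\ chart_dom ch g s).
  assert (HU : @open C_UniformSpace U).
  { apply open_and; [now apply (chart_open ch q)|now apply (chart_open ch q')]. }
  destruct (H q f t Hf Ht') as [Hf1 _]. destruct (H q' g t Hg Ht') as [Hg1 _].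
  destruct (H _ _ t HT Ht') as [HT1 HT2].
  assert (ET : chart_dom ch (transvectant q q' M f g) = U) by now destruct ch.
  assert (EF : chart_fun ch (transvectant q q' M f g)
    = transvectant_expr q q' M (chart_fun ch f) (chart_fun ch g)) by now destruct ch.
  assert (HUt : U (moebius al' be' ga' de' t)) by (split; [now apply Hf1|now apply Hg1]).
  rewrite HT2 by (apply HT1; now rewrite ET). rewrite EF.
  apply (transvectant_moebius (fun s => ga' * s + de' <> 0 /\ U (moebius al' be' ga' de' s)) U);
    try assumption.
  - eapply holomorphic_on_sub; [|apply (chart_holomorphic ch q f Hf)]. unfold U; tauto.
  - eapply holomorphic_on_sub; [|apply (chart_holomorphic ch q' g Hg)]. unfold U; tauto.
  - now apply open_moebius.
  - intros s [Hs [HUf HUg]].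
    destruct (H q f s Hf Hs) as [A1 A2]. destruct (H q' g s Hg Hs) as [B1 B2].
    apply A1 in HUf as HUf'. apply B1 in HUg as HUg'.
    split; [assumption|]. split; [now split|]. split.
    + rewrite HF by assumption. now apply A2.
    + rewrite HG by assumption. now apply B2.
  - now split.
Qed.

Lemma act_dom1 q phi f z :
  dom1 (act q phi f) z <-> hom_dom f (ma phi * z + - mc phi) (- mb phi * z + md phi).
Proof.
  replace (ma phi * z + - mc phi) with (ma phi * z - mc phi) by ring.
  replace (- mb phi * z + md phi) with (md phi - mb phi * z) by ring. reflexivity.
Qed.

(** [phi] acts on homogeneous coordinates by (x, y) |-> (ax - cy, dy - bx).  The line
    here is the image of (z, 1), the one in [act_fun2] that of (-1, zeta). *)
Lemma act_fun1 q phi f z :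
  fun1 (act q phi f) z = hom_fun q f (ma phi * z + - mc phi) (- mb phi * z + md phi).
Proof.
  replace (- mb phi * z + md phi) with (md phi - mb phi * z) by ring.
  unfold hom_fun. replace (- (ma phi * z + - mc phi)) with (mc phi - ma phi * z) by ring.
  replace (ma phi * z + - mc phi) with (ma phi * z - mc phi) by ring. reflexivity.
Qed.

Lemma act_det1 phi : ma phi * md phi - - mc phi * - mb phi = 1.
Proof. rewrite <- (SL2C_det phi). ring. Qed.

Lemma act_det2 phi : - mc phi * mb phi - - ma phi * md phi = 1.
Proof. rewrite <- (SL2C_det phi). ring. Qed.

Lemma act_dom2 q phi f z :
  is_section q f ->
  (dom2 (act q phi f) z <-> hom_dom f (- mc phi * z + - ma phi) (md phi * z + mb phi)).
Proof.
  intros Hf. set (x := mc phi * z + ma phi). set (y := md phi * z + mb phi).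
  replace (- mc phi * z + - ma phi) with (- x) by (unfold x; ring).
  simpl. fold x y. destruct (Ceq_dec x 0) as [E|E].
  - assert (Hy : y <> 0).
    { destruct (curve_neq_0 _ _ _ _ z (act_det2 phi)) as [N|N]; [|exact N].
      exfalso. apply N. replace (- mc phi * z + - ma phi) with (- x) by (unfold x; ring). rewrite E. ring. }
    unfold hom_dom. destruct (Ceq_dec y 0); [contradiction|]. rewrite E.
    replace (- 0 / y) with (RtoC 0) by (field; assumption). tauto.
  - rewrite (hom_dom_chart2 q) by (assumption || now apply Copp_neq_0).
    replace (- - x) with x by ring. tauto.
Qed.

Lemma act_fun2 q phi f z :
  is_section q f -> hom_dom f (- mc phi * z + - ma phi) (md phi * z + mb phi) ->
  fun2 (act q phi f) z = hom_fun q f (- mc phi * z + - ma phi) (md phi * z + mb phi).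
Proof.
  intros Hf. set (x := mc phi * z + ma phi). set (y := md phi * z + mb phi).
  replace (- mc phi * z + - ma phi) with (- x) by (unfold x; ring). intros Hd.
  simpl. fold x y. destruct (Ceq_dec x 0) as [E|E].
  - assert (Hy : y <> 0).
    { destruct (curve_neq_0 _ _ _ _ z (act_det2 phi)) as [N|N]; [|exact N].
      exfalso. apply N. replace (- mc phi * z + - ma phi) with (- x) by (unfold x; ring). rewrite E. ring. }
    unfold hom_fun. destruct (Ceq_dec y 0); [contradiction|]. rewrite E.
    replace (- 0 / y) with (RtoC 0) by (field; assumption). reflexivity.
  - rewrite hom_fun_chart2 by (assumption || now apply Copp_neq_0).
    replace (- - x) with x by ring. reflexivity.
Qed.

Lemma holomorphic_on_ext (U V : C -> Prop) (f g : C -> C) :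
  @open C_UniformSpace V -> (forall z, U z <-> V z) -> (forall z, V z -> f z = g z) ->
  holomorphic_on V g -> holomorphic_on U f.
Proof.
  intros HV H E Hg z Hz. apply (ex_Cderive_ext_loc g); [|now apply Hg, H].
  eapply filter_imp; [|apply HV, H, Hz]. intros w Hw. symmetry. now apply E.
Qed.

(** Openness and holomorphy come from [curve_open] and [curve_holomorphic]; passing to
    the other chart multiplies both coordinates by -1/z, so the transition law is
    homogeneity. *)
Lemma act_section q phi f : is_section q f -> is_section q (act q phi f).
Proof.
  intros Hf. pose proof (curve_open q f _ _ _ _ (act_det1 phi) Hf) as O1.
  pose proof (curve_open q f _ _ _ _ (act_det2 phi) Hf) as O2.
  assert (Esc : forall z : C, z <> 0 ->
    - mc phi * (- 1 / z) + - ma phi = - 1 / z * (ma phi * z + - mc phi) /\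
    md phi * (- 1 / z) + mb phi = - 1 / z * (- mb phi * z + md phi)).
  { intros z Hz. split; field; assumption. }
  split; [|split; [|split; [|split; [|split]]]].
  - eapply open_ext; [|exact O1]. intros z. symmetry. apply act_dom1.
  - eapply open_ext; [|exact O2]. intros z. symmetry. now apply act_dom2.
  - intros z Hz. rewrite act_dom1, act_dom2 by assumption.
    destruct (Esc z Hz) as [-> ->]. rewrite hom_dom_scale; [tauto|].
    apply Cdiv_neq_0; [apply Cm1_neq_0|assumption].
  - eapply holomorphic_on_ext; [exact O1| | |apply (curve_holomorphic q f _ _ _ _ (act_det1 phi) Hf)].
    + intros z. apply act_dom1.
    + intros z _. apply act_fun1.
  - eapply holomorphic_on_ext; [exact O2| | |apply (curve_holomorphic q f _ _ _ _ (act_det2 phi) Hf)].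
    + intros z. now apply act_dom2.
    + intros z Hz. now apply act_fun2.
  - intros z Hz Hd. apply act_dom1 in Hd.
    assert (Hk : - 1 / z <> 0) by (apply Cdiv_neq_0; [apply Cm1_neq_0|assumption]).
    destruct (Esc z Hz) as [E1 E2].
    rewrite act_fun1, act_fun2; [|assumption|].
    + rewrite E1, E2, hom_fun_scale by (assumption || apply curve_neq_0, act_det1).
      rewrite Cmult_assoc, <- Cpowz_add, Z.add_opp_diag_l by assumption. simpl. ring.
    + rewrite E1, E2. now apply hom_dom_scale.
Qed.

(** Both charts of the transformed pairing are restrictions to lines of determinant 1,
    where [transvectant_curve] applies. *)
Lemma transvectant_invariant q q' M :
  is_invariant q q' (q + q' - 2 * Z.of_nat M) (transvectant q q' M).
Proof.
  intros phi f g Hf Hg.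
  split; [|split; [|split]].
  - intros z. simpl. destruct (Ceq_dec (md phi - mb phi * z) 0); tauto.
  - intros z. simpl. destruct (Ceq_dec (mc phi * z + ma phi) 0); tauto.
  - intros z [Hz1 Hz2]. rewrite act_fun1. apply act_dom1 in Hz1. apply act_dom1 in Hz2.
    apply (transvectant_curve q q' M f g); try assumption.
    + apply act_det1.
    + intros t _. apply act_fun1.
    + intros t _. apply act_fun1.
  - intros z [Hz1 Hz2].
    apply act_dom2 in Hz1; [|assumption]. apply act_dom2 in Hz2; [|assumption].
    pose proof (transvectant_section q q' M f g Hf Hg) as HT.
    rewrite act_fun2.
    + apply (transvectant_curve q q' M f g); try assumption.
      * apply act_det2.
      * intros t Ht. now apply act_fun2.
      * intros t Ht. now apply act_fun2.
    + assumption.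
    + revert Hz1 Hz2. unfold hom_dom. destruct (Ceq_dec _ 0); simpl; tauto.
Qed.

Lemma transvectant_bidiff q q' M f g z :
  transvectant_expr q q' M f g z
  = bidiff_expr M (fun i j _ => if Nat.eq_dec (i + j) M then RtoC (gamma q q' M i) else RtoC 0) f g z.
Proof.
  unfold transvectant_expr, bidiff_expr. apply Csum_ext. intros i Hi.
  rewrite (Csum_single _ M (M - i)%nat); [|lia|].
  - destruct (Nat.eq_dec (i + (M - i)) M); [reflexivity|lia].
  - intros j Hj Hne. destruct (Nat.eq_dec (i + j) M); [lia|ring].
Qed.

Lemma transvectant_invariant_pairing q q' M :
  is_invariant_pairing_of_order M q q' (q + q' - 2 * Z.of_nat M) (transvectant q q' M).
Proof.
  split; [|split; [apply transvectant_invariant|reflexivity]].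
  split.
  - intros f g Hf Hg. split; [now apply transvectant_section|]. simpl. tauto.
  - exists M, (fun i j _ => if Nat.eq_dec (i + j) M then RtoC (gamma q q' M i) else RtoC 0),
      (fun i j _ => if Nat.eq_dec (i + j) M then RtoC (gamma q q' M i) else RtoC 0).
    intros f g _ _. split; intros z _; apply transvectant_bidiff.
Qed.

(** * Monomial sections and non-vanishing of the transvectant *)

Definition monomial (z0 : C) (k : nat) (z : C) : C := (z - z0) ^ k.

(** An entire function, seen as a section of O(q) away from z = infinity; the second
    chart is forced by the transition law. *)
Definition affine_section (q : Z) (h : C -> C) : local_data :=
  LocalData (fun _ => True) (fun zeta => zeta <> 0) h (fun zeta => Cpowz zeta q * h (- 1 / zeta)).

Lemma is_Cderive_monomial z0 k z :
  is_Cderive (monomial z0 (S k)) z (RtoC (INR (S k)) * monomial z0 k z).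
Proof.
  unfold monomial. induction k as [|k IH].
  - apply (is_Cderive_ext_loc (fun w => w - z0)).
    + apply filter_forall. intros w. now rewrite Cpow_1_r.
    + apply (is_Cderive_eq _ _ (1 - 0)).
      * apply (is_Cderive_minus (fun w => w) (fun _ => z0)); [apply is_Cderive_id|apply is_Cderive_const].
      * simpl. ring.
  - apply (is_Cderive_ext_loc (fun w => (w - z0) * (w - z0) ^ (S k))).
    + apply filter_forall. intros w. reflexivity.
    + eapply is_Cderive_eq.
      * apply (is_Cderive_mult (fun w => w - z0) (fun w => (w - z0) ^ (S k))); [|exact IH].
        apply (is_Cderive_minus (fun w => w) (fun _ => z0)); [apply is_Cderive_id|apply is_Cderive_const].
      * cbv beta. rewrite (S_INR (S k)), RtoC_plus, !Cpow_S. ring.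
Qed.

Lemma monomial_entire z0 k : holomorphic_on (fun _ => True) (monomial z0 k).
Proof.
  intros z _. destruct k as [|k].
  - apply ex_Cderive_const.
  - eexists. apply is_Cderive_monomial.
Qed.

Lemma monomial_derive_n z0 k n :
  C_derive_n (monomial z0 k) n z0 = if Nat.eq_dec n k then RtoC (INR (fact k)) else RtoC 0.
Proof.
  (* the n-th derivative of (z - z0)^k *)
  set (F := fun (n : nat) (z : C) => if le_dec n k
    then RtoC (INR (fact k) / INR (fact (k - n))) * monomial z0 (k - n) z else RtoC 0).
  assert (HF : forall m z, is_Cderive (F m) z (F (S m) z)).
  { intros m z. unfold F. destruct (le_dec m k) as [Hm|Hm]; destruct (le_dec (S m) k) as [Hs|Hs]; try lia.
    - replace (k - m)%nat with (S (k - S m)) by lia.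
      eapply is_Cderive_eq; [apply is_Cderive_cmult, is_Cderive_monomial|].
      rewrite Cmult_assoc, <- RtoC_mult. f_equal. f_equal.
      rewrite fact_simpl, mult_INR. field.
      split; [apply INR_fact_neq_0 | apply not_0_INR; lia].
    - replace (k - m)%nat with 0%nat by lia.
      eapply is_Cderive_eq; [apply is_Cderive_cmult; exact (is_Cderive_const 1 z)|ring].
    - apply is_Cderive_const. }
  rewrite (C_derive_n_unique (fun _ => True) (monomial z0 k) F open_true); [|intros z _|intros; apply HF|exact I].
  2: { unfold F. destruct (le_dec 0 k); [|lia]. rewrite Nat.sub_0_r.
    replace (INR (fact k) / INR (fact k))%R with 1%R by (field; apply INR_fact_neq_0). ring. }
  unfold F, monomial. destruct (Nat.eq_dec n k) as [->|E].
  - destruct (le_dec k k); [|lia]. rewrite Nat.sub_diag. simpl. 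
    replace (INR (fact k) / 1)%R with (INR (fact k)) by field. ring.
  - destruct (le_dec n k); [|reflexivity].
    replace (k - n)%nat with (S (k - S n)) by lia. rewrite Cpow_S. ring.
Qed.

Lemma affine_section_correct q h :
  holomorphic_on (fun _ => True) h -> is_section q (affine_section q h).
Proof.
  intros Hh. split; [apply open_true|]. split; [apply open_neq_0|].
  split. { intros z Hz. simpl. split; [intros _|tauto]. apply Cdiv_neq_0; [apply Cm1_neq_0|assumption]. }
  split; [exact Hh|]. split.
  - intros z Hz. simpl in *.
    apply (ex_Cderive_mult (fun zeta => Cpowz zeta q) (fun zeta => h (- 1 / zeta))).
    + eexists. now apply is_Cderive_Cpowz.
    + destruct (Hh (- 1 / z) I) as [l Hl]. eexists.
      apply (is_Cderive_comp h (fun zeta => - 1 / zeta)); [exact Hl|].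
      apply (is_Cderive_cmult (- 1) Cinv). now apply is_Cderive_inv.
  - intros z Hz _. simpl.
    assert (Hk : - 1 / z <> 0) by (apply Cdiv_neq_0; [apply Cm1_neq_0|assumption]).
    rewrite Cmult_assoc, <- Cpowz_add, Z.add_opp_diag_l by assumption. simpl (Cpowz _ 0).
    replace (- 1 / (- 1 / z)) with z by (field; assumption || (split; [assumption|apply Cm1_neq_0])). ring.
Qed.

(** Monomials centred at the point of evaluation isolate a single coefficient. *)
Lemma bidiff_monomials N a z0 k l :
  (k <= N)%nat -> (l <= N)%nat ->
  bidiff_expr N a (monomial z0 k) (monomial z0 l) z0
  = a k l z0 * RtoC (INR (fact k)) * RtoC (INR (fact l)).
Proof.
  intros Hk Hl. unfold bidiff_expr.
  rewrite (Csum_single _ N k Hk).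
  - rewrite (Csum_single _ N l Hl).
    + rewrite !monomial_derive_n.
      destruct (Nat.eq_dec k k); [|lia]. destruct (Nat.eq_dec l l); [|lia]. reflexivity.
    + intros j _ Hj. rewrite (monomial_derive_n z0 l j). destruct (Nat.eq_dec j l); [lia|ring].
  - intros i _ Hi. apply Csum_zero. intros j _. rewrite (monomial_derive_n z0 k i).
    destruct (Nat.eq_dec i k); [lia|ring].
Qed.

Lemma prod_range_neq_0 m n u : (forall i, (m <= i < n)%nat -> u i <> 0%R) -> prod_range m n u <> 0%R.
Proof.
  intros H. destruct (Nat.le_gt_cases n m) as [L|L].
  - rewrite prod_range_empty by assumption. lra.
  - replace n with (m + (n - m))%nat in * by lia.
    induction (n - m)%nat as [|k IH].
    + rewrite Nat.add_0_r, prod_range_empty by lia. lra.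
    + rewrite Nat.add_succ_r, prod_range_last by lia.
      apply Rmult_integral_contrapositive_currified.
      * destruct k as [|k]; [rewrite Nat.add_0_r, prod_range_empty by lia; lra|].
        apply IH; [|lia]. intros i Hi. apply H. lia.
      * apply H. lia.
Qed.

Lemma IZR_INR_neq q M i : ~ (0 <= q < Z.of_nat M)%Z -> (i < M)%nat -> (IZR q - INR i <> 0)%R.
Proof.
  intros Hq Hi E. apply Hq. rewrite INR_IZR_INZ in E.
  assert (E' : IZR q = IZR (Z.of_nat i)) by lra. apply eq_IZR in E'. lia.
Qed.

Lemma binomial_neq_0 n k : Binomial.C n k <> 0%R.
Proof.
  unfold Binomial.C, Rdiv. apply Rmult_integral_contrapositive_currified; [apply INR_fact_neq_0|].
  apply Rinv_neq_0_compat, Rmult_integral_contrapositive_currified; apply INR_fact_neq_0.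
Qed.

(** gamma_0 is the product of all the q - i, the product over q' being empty;
    symmetrically, gamma_M is up to sign the product of all the q' - i. *)
Lemma gamma_first_neq_0 q q' M :
  ~ (0 <= q < Z.of_nat M)%Z -> gamma q q' M 0 <> 0%R.
Proof.
  intros Hq. unfold gamma. rewrite (prod_range_empty (M - 0)), Rmult_1_r by lia.
  apply Rmult_integral_contrapositive_currified;
    [apply Rmult_integral_contrapositive_currified|].
  - simpl. lra.
  - apply binomial_neq_0.
  - apply prod_range_neq_0. intros i Hi. now apply (IZR_INR_neq q M).
Qed.

Lemma gamma_last_neq_0 q q' M :
  ~ (0 <= q' < Z.of_nat M)%Z -> gamma q q' M M <> 0%R.
Proof.
  intros Hq. unfold gamma. rewrite (prod_range_empty M M), Rmult_1_r by lia.
  apply Rmult_integral_contrapositive_currified;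
    [apply Rmult_integral_contrapositive_currified|].
  - apply pow_nonzero. lra.
  - apply binomial_neq_0.
  - apply prod_range_neq_0. intros i Hi. now apply (IZR_INR_neq q' M).
Qed.

(** The same recurrence as for the coefficients of any invariant pairing in
    [invariant_coefficients]. *)
Lemma gamma_recurrence q q' M j :
  (j < M)%nat ->
  (INR (S j) * (IZR q - INR j) * gamma q q' M (S j)
   + INR (M - j) * (IZR q' - INR (M - S j)) * gamma q q' M j = 0)%R.
Proof.
  intros Hj. unfold gamma.
  rewrite (prod_range_first j M) by assumption.
  rewrite (prod_range_first (M - S j) M) by lia.
  replace (S (M - S j)) with (M - j)%nat by lia.
  set (P := prod_range (S j) M _). set (P' := prod_range (M - j) M _).
  assert (E : (INR (S j) * Binomial.C M (S j) = INR (M - j) * Binomial.C M j)%R).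
  { unfold Binomial.C. replace (M - j)%nat with (S (M - S j)) by lia.
    rewrite !fact_simpl, !mult_INR. 
    pose proof (INR_fact_neq_0 j). pose proof (INR_fact_neq_0 (M - S j)).
    field. repeat split; try assumption; apply not_0_INR; lia. }
  simpl ((-1) ^ S j)%R.
  transitivity ((IZR q - INR j) * (IZR q' - INR (M - S j)) * (-1) ^ j * P * P'
    * (INR (M - j) * Binomial.C M j - INR (S j) * Binomial.C M (S j)))%R; [ring|].
  rewrite E. ring.
Qed.

Lemma transvectant_nonzero q q' M :
  ~ (0 <= q < Z.of_nat M)%Z \/ ~ (0 <= q' < Z.of_nat M)%Z ->
  is_nonzero_pairing q q' (transvectant q q' M).
Proof.
  intros Hq.
  assert (Hj : exists j, (j <= M)%nat /\ gamma q q' M j <> 0%R).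
  { destruct Hq as [H|H].
    - exists 0%nat. split; [lia|now apply gamma_first_neq_0].
    - exists M. split; [lia|now apply gamma_last_neq_0]. }
  destruct Hj as (j & Hj & Hg).
  exists (affine_section q (monomial 0 j)), (affine_section q' (monomial 0 (M - j))).
  split; [apply affine_section_correct, monomial_entire|].
  split; [apply affine_section_correct, monomial_entire|].
  left. exists (RtoC 0). split; [simpl; tauto|]. simpl.
  rewrite transvectant_bidiff, bidiff_monomials by lia.
  destruct (Nat.eq_dec (j + (M - j)) M); [|lia].
  repeat apply Cmult_neq_0; apply RtoC_neq_0; try apply INR_fact_neq_0. exact Hg.
Qed.

(** * Coefficients of an invariant pairing *)

(** Padding with zeros allows the order bound to exceed [M]. *)
Lemma bidiff_expr_extend N K a f g z :
  (N <= K)%nat ->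
  bidiff_expr N a f g z
  = bidiff_expr K (fun i j z => if le_dec i N then if le_dec j N then a i j z else RtoC 0 else RtoC 0) f g z.
Proof.
  intros H. unfold bidiff_expr. replace K with (N + (K - N))%nat by lia.
  rewrite Csum_trim_hi.
  - apply Csum_ext. intros i Hi. rewrite Csum_trim_hi.
    + apply Csum_ext. intros j Hj. destruct (le_dec i N); [|lia]. destruct (le_dec j N); [|lia]. reflexivity.
    + intros j Hj. destruct (le_dec i N); [|lia]. destruct (le_dec j N); [lia|]. ring.
  - intros i Hi. apply Csum_zero. intros j Hj. destruct (le_dec i N); [lia|]. ring.
Qed.

(** Only one term of [moebius_derive_n] survives for a monomial centred at the image
    of the point. *)
Lemma act_monomial_derive_n q phi z k i :
  let u := - mb phi * z + md phi in
  let w := moebius (ma phi) (- mc phi) (- mb phi) (md phi) z in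
  u <> 0 ->
  C_derive_n (fun1 (act q phi (affine_section q (monomial w k)))) i z
  = RtoC (moebius_coef q i k) * (- mb phi) ^ (i - k) * Cpowz u (q - Z.of_nat i - Z.of_nat k)
    * RtoC (INR (fact k)).
Proof.
  intros u w Hu.
  rewrite (moebius_derive_n (fun s => - mb phi * s + md phi <> 0 /\ True) (fun _ => True) (monomial w k)
    (fun1 (act q phi (affine_section q (monomial w k)))) q (ma phi) (- mc phi) (- mb phi) (md phi)).
  - fold u w. destruct (Nat.le_gt_cases k i) as [L|L].
    + rewrite (Csum_single _ i k L).
      * rewrite monomial_derive_n. destruct (Nat.eq_dec k k); [reflexivity|lia].
      * intros j _ Hj. rewrite monomial_derive_n. destruct (Nat.eq_dec j k); [lia|ring].
    + rewrite moebius_coef_gt by assumption. rewrite Csum_zero; [ring|].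
      intros j Hj. rewrite monomial_derive_n. destruct (Nat.eq_dec j k); [lia|ring].
  - apply act_det1.
  - apply open_true.
  - apply monomial_entire.
  - exact (open_moebius (fun _ => True) _ _ _ _ (act_det1 phi) open_true).
  - intros s [Hs _]. split; [assumption|]. split; [exact I|].
    rewrite act_fun1. unfold hom_fun. destruct (Ceq_dec (- mb phi * s + md phi) 0); [contradiction|].
    reflexivity.
  - split; [assumption|exact I].
Qed.

(** Invariance under [phi], applied to two monomials centred at the image [w] of [z], as
    an identity between coefficients at [z] and at [w].  All constraints on an
    invariant pairing are obtained from special choices of [phi]. *)
Lemma invariance_on_monomials q q' p Q K a :
  is_bidiff_pairing q q' p Q -> is_invariant q q' p Q ->
  (forall f g, is_section q f -> is_section q' g ->
     forall z, dom1 (Q f g) z -> fun1 (Q f g) z = bidiff_expr K a (fun1 f) (fun1 g) z) ->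
  forall phi z k l, (k <= K)%nat -> (l <= K)%nat ->
  let u := - mb phi * z + md phi in
  let w := moebius (ma phi) (- mc phi) (- mb phi) (md phi) z in
  u <> 0 ->
  Csum (fun i => Csum (fun j => a i j z
    * (RtoC (moebius_coef q i k) * (- mb phi) ^ (i - k) * Cpowz u (q - Z.of_nat i - Z.of_nat k))
    * (RtoC (moebius_coef q' j l) * (- mb phi) ^ (j - l) * Cpowz u (q' - Z.of_nat j - Z.of_nat l))) K) K
  = Cpowz u p * a k l w :> C.
Proof.
  intros [HQ _] Hinv Ha phi z k l Hk Hl u w Hu.
  set (f := affine_section q (monomial w k)). set (g := affine_section q' (monomial w l)).
  assert (Hf : is_section q f) by apply affine_section_correct, monomial_entire.
  assert (Hg : is_section q' g) by apply affine_section_correct, monomial_entire.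
  pose proof (act_section q phi f Hf) as Hf'. pose proof (act_section q' phi g Hg) as Hg'.
  destruct (HQ f g Hf Hg) as (HS & HD & _). destruct (HQ _ _ Hf' Hg') as (HS' & HD' & _).
  assert (Hz : dom1 (Q (act q phi f) (act q' phi g)) z).
  { apply HD'. rewrite !act_dom1. unfold hom_dom. fold u.
    destruct (Ceq_dec u 0); [contradiction|]. split; exact I. }
  assert (Hw : dom1 (Q f g) w) by (apply HD; split; exact I).
  destruct (Hinv phi f g Hf Hg) as (_ & _ & E & _). specialize (E z Hz).
  rewrite (Ha _ _ Hf' Hg' z Hz), act_fun1 in E. unfold hom_fun in E. fold u in E.
  destruct (Ceq_dec u 0); [contradiction|].
  change ((ma phi * z + - mc phi) / u) with w in E.
  rewrite (Ha f g Hf Hg w Hw) in E. simpl (fun1 f) in E. simpl (fun1 g) in E.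
  rewrite bidiff_monomials in E by assumption.
  (* both sides carry the factor k! l! from differentiating the monomials *)
  set (kl := RtoC (INR (fact k)) * RtoC (INR (fact l))).
  assert (Hkl : kl <> 0) by (apply Cmult_neq_0; apply RtoC_neq_0, INR_fact_neq_0).
  assert (Hcancel : forall x y : C, x * kl = y * kl -> x = y).
  { intros x y Hxy. rewrite <- (Cmult_1_r x), <- (Cmult_1_r y), <- (Cinv_r kl) by assumption.
    now rewrite !Cmult_assoc, Hxy. }
  apply Hcancel. transitivity (Cpowz u p * (a k l w * RtoC (INR (fact k)) * RtoC (INR (fact l))));
    [|unfold kl; ring].
  rewrite <- E. unfold bidiff_expr. rewrite Csum_mult_r. apply Csum_ext. intros i _.
  rewrite Csum_mult_r. apply Csum_ext. intros j _.
  unfold f, g. unfold w. rewrite !act_monomial_derive_n by assumption. fold u. unfold kl. ring.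
Qed.

Lemma Csum2_single (a : nat -> nat -> C) K k l :
  (k <= K)%nat -> (l <= K)%nat ->
  (forall i j, (i <= K)%nat -> (j <= K)%nat -> i <> k \/ j <> l -> a i j = 0) ->
  Csum (fun i => Csum (a i) K) K = a k l.
Proof.
  intros Hk Hl H. rewrite (Csum_single _ K k Hk).
  - apply (Csum_single (a k) K l Hl). intros j Hj Hne. apply H; auto.
  - intros i Hi Hne. apply Csum_zero. intros j Hj. apply H; auto.
Qed.

(** For an affine map ga = 0, and the transformed monomial keeps a single derivative;
    [- 0] is the entry [- mb phi] of such a map. *)
Lemma moebius_coef_affine q i k :
  i <> k -> RtoC (moebius_coef q i k) * (- 0) ^ (i - k) = 0.
Proof.
  intros Hne. destruct (Nat.lt_ge_cases i k).
  - rewrite moebius_coef_gt by assumption. ring.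
  - replace (i - k)%nat with (S (i - S k)) by lia. rewrite Cpow_S. ring.
Qed.

Lemma det_translation (c : C) : 1 * 1 - 0 * c = 1.
Proof. ring. Qed.

Lemma det_dilation : / 2 * 2 - 0 * 0 = 1.
Proof. field. Qed.

Lemma det_transvection : 1 * 1 - (- (1)) * 0 = 1.
Proof. ring. Qed.

Lemma moebius_coef_subdiag q k : moebius_coef q (S k) k = (INR (S k) * (IZR q - INR k))%R.
Proof.
  pose proof (moebius_coef_explicit q 1 k) as E.
  replace (k + 1)%nat with (S k) in E by lia.
  rewrite prod_range_last, prod_range_empty, (fact_simpl k), mult_INR in E by lia.
  pose proof (INR_fact_neq_0 k).
  apply (Rmult_eq_reg_l (INR (fact k))); [|assumption].
  change (INR (fact 1)) with 1%R in E. rewrite Rmult_1_l in E. rewrite E. ring.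
Qed.

Lemma Cpowz_2_inj n m : Cpowz 2 n = Cpowz 2 m -> n = m.
Proof.
  assert (H2 : RtoC 2 <> 0) by (apply RtoC_neq_0; lra).
  assert (H : forall k, Cpowz 2 (Z.of_nat k) = 1 -> k = 0%nat).
  { intros k Hk. rewrite Cpowz_of_nat, <- RtoC_pow in Hk. apply RtoC_inj in Hk.
    destruct k as [|k]; [reflexivity|].
    pose proof (Rlt_pow_R1 2 (S k) ltac:(lra) ltac:(lia)). lra. }
  intros E. 
  assert (E1 : Cpowz 2 (n - m) = 1).
  { unfold Z.sub. rewrite Cpowz_add, Cpowz_opp, E by assumption. apply Cinv_r. now apply Cpowz_nz. }
  assert (E2 : Cpowz 2 (m - n) = 1).
  { replace (m - n)%Z with (- (n - m))%Z by lia. rewrite Cpowz_opp, E1 by assumption. field. }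
  destruct (Z_le_gt_dec m n).
  - replace (n - m)%Z with (Z.of_nat (Z.to_nat (n - m))) in E1 by lia. apply H in E1. lia.
  - replace (m - n)%Z with (Z.of_nat (Z.to_nat (m - n))) in E2 by lia. apply H in E2. lia.
Qed.

(** Three kinds of group elements suffice: translations, one dilation and one
    element fixing 0 with nonzero second derivative there. *)
Lemma invariant_coefficients q q' M Q :
  is_invariant_pairing_of_order M q q' (q + q' - 2 * Z.of_nat M) Q ->
  exists c : nat -> C,
    (forall j, (j < M)%nat ->
       RtoC (INR (S j) * (IZR q - INR j)) * c (S j)
       + RtoC (INR (M - j) * (IZR q' - INR (M - S j))) * c j = 0) /\
    forall f g z, is_section q f -> is_section q' g -> dom1 (Q f g) z ->
      fun1 (Q f g) z
      = Csum (fun j => c j * C_derive_n (fun1 f) j z * C_derive_n (fun1 g) (M - j) z) M.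
Proof.
  intros (HQ & Hinv & _). set (p := (q + q' - 2 * Z.of_nat M)%Z) in *.
  pose proof HQ as (_ & N & a0 & b0 & Hab).
  (* a bound that leaves room for all indices up to [M] *)
  set (K := (N + M)%nat).
  set (a := fun i j z => if le_dec i N then if le_dec j N then a0 i j z else RtoC 0 else RtoC 0).
  assert (Ha : forall f g, is_section q f -> is_section q' g ->
     forall z, dom1 (Q f g) z -> fun1 (Q f g) z = bidiff_expr K a (fun1 f) (fun1 g) z).
  { intros f g Hf Hg z Hz. rewrite (proj1 (Hab f g Hf Hg) z Hz). apply bidiff_expr_extend. unfold K; lia. }
  pose proof (invariance_on_monomials q q' p Q K a HQ Hinv Ha) as star.
  (* translation by w at the point 0 *)
  assert (Hconst : forall k l w, (k <= K)%nat -> (l <= K)%nat -> a k l w = a k l 0).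
  { intros k l w Hk Hl.
    specialize (star (MkSL2C 1 0 (- w) 1 (det_translation (- w))) 0 k l Hk Hl). cbn [ma mb mc md] in star.
    replace (- 0 * 0 + 1) with (RtoC 1) in star by ring.
    replace (moebius 1 (- - w) (- 0) 1 0) with w in star by (unfold moebius; field).
    specialize (star C1_nz). rewrite Cpowz_1, Cmult_1_l in star. rewrite <- star.
    rewrite (Csum2_single _ K k l Hk Hl).
    - rewrite !moebius_coef_diag, !Nat.sub_diag, !Cpowz_1. simpl. ring.
    - intros i j _ _ [Hne|Hne]; rewrite (moebius_coef_affine _ _ _ Hne); ring. }
  (* the dilation z/4 at 0 scales the (k, l) coefficient by a power of 2 *)
  assert (Hdeg : forall k l, (k <= K)%nat -> (l <= K)%nat -> (k + l)%nat <> M -> a k l 0 = 0).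
  { intros k l Hk Hl Hkl.
    specialize (star (MkSL2C (/ 2) 0 0 2 det_dilation) 0 k l Hk Hl). cbn [ma mb mc md] in star.
    assert (H2 : RtoC 2 <> 0) by (apply RtoC_neq_0; lra).
    replace (- 0 * 0 + 2) with (RtoC 2) in star by ring.
    replace (moebius (/ 2) (- 0) (- 0) 2 0) with (RtoC 0) in star by (unfold moebius; field).
    specialize (star H2).
    rewrite (Csum2_single _ K k l Hk Hl) in star.
    - rewrite !moebius_coef_diag, !Nat.sub_diag in star. simpl (_ ^ 0) in star.
      set (n := (q - Z.of_nat k - Z.of_nat k + (q' - Z.of_nat l - Z.of_nat l))%Z).
      assert (E : (Cpowz 2 n - Cpowz 2 p) * a k l 0 = 0).
      { unfold n. rewrite Cpowz_add by assumption. rewrite Cmult_comm. unfold Cminus.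
        rewrite Cmult_plus_distr_l.
        transitivity (Cpowz 2 p * a k l 0 + a k l 0 * - Cpowz 2 p); [|ring].
        rewrite <- star. ring. }
      destruct (Ceq_dec (a k l 0) 0) as [|Hne]; [assumption|]. exfalso.
      destruct (Ceq_dec (Cpowz 2 n - Cpowz 2 p) 0) as [E'|E'].
      + apply Ceq_minus, Cpowz_2_inj in E'. unfold n, p in E'. lia.
      + revert E. now apply Cmult_neq_0.
    - intros i j _ _ [Hne|Hne]; rewrite (moebius_coef_affine _ _ _ Hne); ring. }
  exists (fun j => a j (M - j)%nat 0). split.
  - intros j Hj. set (l := (M - S j)%nat).
    assert (HjK : (S j <= K)%nat) by (unfold K; lia).
    assert (HlK : (S l <= K)%nat) by (unfold K, l; lia).
    specialize (star (MkSL2C 1 (- (1)) 0 1 det_transvection) 0 j l ltac:(lia) ltac:(lia)).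
    cbn [ma mb mc md] in star.
    replace (- - (1) * 0 + 1) with (RtoC 1) in star by ring.
    replace (moebius 1 (- 0) (- - (1)) 1 0) with (RtoC 0) in star.
    2: { unfold moebius. replace (- - (1) * 0 + 1) with (RtoC 1) by ring. field. }
    specialize (star C1_nz). rewrite (Hdeg j l) in star by (unfold l; lia). rewrite Cmult_0_r in star.
    (* z/(z + 1) at 0 on monomials of total degree M - 1: only the pairs (j + 1, l)
       and (j, l + 1) contribute *)
    set (T := fun i i' => a i i' 0
      * (RtoC (moebius_coef q i j) * (- - (1)) ^ (i - j) * Cpowz 1 (q - Z.of_nat i - Z.of_nat j))
      * (RtoC (moebius_coef q' i' l) * (- - (1)) ^ (i' - l) * Cpowz 1 (q' - Z.of_nat i' - Z.of_nat l))).
    assert (HT0 : forall i i', (i <= K)%nat -> (i' <= K)%nat ->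
      ~ (i = S j /\ i' = l) -> ~ (i = j /\ i' = S l) -> T i i' = 0).
    { intros i i' Hi Hi' N1 N2. unfold T.
      destruct (Nat.eq_dec (i + i') M) as [E|E]; [|rewrite Hdeg by assumption; ring].
      destruct (Nat.lt_ge_cases i j); [rewrite (moebius_coef_gt q i j) by assumption; ring|].
      rewrite (moebius_coef_gt q' i' l) by (unfold l in *; lia). ring. }
    transitivity (Csum (fun i => Csum (T i) K) K); [|exact star].
    transitivity (T (S j) l + T j (S l)).
    { unfold T. rewrite !moebius_coef_diag, !moebius_coef_subdiag, !Nat.sub_diag, !Cpowz_1.
      replace (S j - j)%nat with 1%nat by lia. replace (S l - l)%nat with 1%nat by lia.
      replace (M - j)%nat with (S l) by (unfold l; lia).
      simpl (_ ^ _). ring. }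
    symmetry.
    transitivity (Csum (fun i => Csum (fun i' =>
      (if Nat.eq_dec i (S j) then T i i' else RtoC 0) + (if Nat.eq_dec i (S j) then RtoC 0 else T i i')) K) K).
    { apply Csum_ext. intros i _. apply Csum_ext. intros i' _. destruct (Nat.eq_dec i (S j)); ring. }
    erewrite Csum_ext by (intros i _; apply Csum_plus).
    rewrite Csum_plus. f_equal.
    + rewrite (Csum2_single _ K (S j) l); [|lia|lia|].
      * destruct (Nat.eq_dec (S j) (S j)); [reflexivity|lia].
      * intros i i' Hi Hi' Hne. destruct (Nat.eq_dec i (S j)); [|reflexivity]. apply HT0; lia.
    + rewrite (Csum2_single _ K j (S l)); [|lia|lia|].
      * destruct (Nat.eq_dec j (S j)); [lia|reflexivity].
      * intros i i' Hi Hi' Hne. destruct (Nat.eq_dec i (S j)); [reflexivity|]. apply HT0; lia.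
  - intros f g z Hf Hg Hz. rewrite (Ha f g Hf Hg z Hz). unfold bidiff_expr.
    replace K with (M + N)%nat by (unfold K; lia). rewrite Csum_trim_hi.
    + apply Csum_ext. intros i Hi. rewrite (Csum_single _ (M + N) (M - i)%nat); [|lia|].
      * rewrite Hconst by (unfold K; lia). reflexivity.
      * intros j Hj Hne. rewrite Hconst, Hdeg by (unfold K; lia). ring.
    + intros i Hi. apply Csum_zero. intros j Hj. rewrite Hconst, Hdeg by (unfold K; lia). ring.
Qed.

(** * Uniqueness *)

(** Under the hypothesis on q the recurrence can be solved upwards from c_0, under the
    one on q' downwards from c_M. *)
Lemma recurrence_proportional q q' M (c : nat -> C) :
  ~ (0 <= q < Z.of_nat M)%Z \/ ~ (0 <= q' < Z.of_nat M)%Z ->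
  (forall j, (j < M)%nat ->
       RtoC (INR (S j) * (IZR q - INR j)) * c (S j)
       + RtoC (INR (M - j) * (IZR q' - INR (M - S j))) * c j = 0) ->
  exists k : C, forall j, (j <= M)%nat -> c j = k * RtoC (gamma q q' M j).
Proof.
  intros Hq Hc.
  assert (Hg : forall j, (j < M)%nat ->
       RtoC (INR (S j) * (IZR q - INR j)) * RtoC (gamma q q' M (S j))
       + RtoC (INR (M - j) * (IZR q' - INR (M - S j))) * RtoC (gamma q q' M j) = 0).
  { intros j Hj. rewrite <- !RtoC_mult, <- RtoC_plus. f_equal. now apply gamma_recurrence. }
  assert (Hcancel : forall s x : C, s <> 0 -> s * x = 0 -> x = 0).
  { intros s x Hs E. destruct (Ceq_dec x 0); [assumption|]. exfalso. revert E. now apply Cmult_neq_0. }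
  destruct Hq as [Hq|Hq].
  - pose proof (RtoC_neq_0 _ (gamma_first_neq_0 q q' M Hq)) as H0.
    exists (c 0%nat / RtoC (gamma q q' M 0)). set (k := c 0%nat / RtoC (gamma q q' M 0)).
    intros j. induction j as [|j IH]; intros Hj.
    + unfold k. field. assumption.
    + apply Ceq_minus. apply (Hcancel (RtoC (INR (S j) * (IZR q - INR j)))).
      { apply RtoC_neq_0, Rmult_integral_contrapositive_currified;
          [apply not_0_INR; lia|apply (IZR_INR_neq q M); [assumption|lia]]. }
      specialize (Hc j Hj). specialize (Hg j Hj). rewrite IH in Hc by lia.
      transitivity (RtoC (INR (S j) * (IZR q - INR j)) * c (S j)
       + RtoC (INR (M - j) * (IZR q' - INR (M - S j))) * (k * RtoC (gamma q q' M j))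
       - k * (RtoC (INR (S j) * (IZR q - INR j)) * RtoC (gamma q q' M (S j))
       + RtoC (INR (M - j) * (IZR q' - INR (M - S j))) * RtoC (gamma q q' M j))); [ring|].
      rewrite Hc, Hg. ring.
  - pose proof (RtoC_neq_0 _ (gamma_last_neq_0 q q' M Hq)) as H0.
    exists (c M / RtoC (gamma q q' M M)). set (k := c M / RtoC (gamma q q' M M)).
    (* the same step, taken downwards *)
    assert (Hdown : forall i, (i <= M)%nat -> c (M - i)%nat = k * RtoC (gamma q q' M (M - i))).
    { induction i as [|i IH]; intros Hi.
      - rewrite Nat.sub_0_r. unfold k. field. assumption.
      - set (j := (M - S i)%nat). replace (M - i)%nat with (S j) in IH by (unfold j; lia).
        assert (Hj : (j < M)%nat) by (unfold j; lia).
        apply Ceq_minus. apply (Hcancel (RtoC (INR (M - j) * (IZR q' - INR (M - S j))))).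
        { apply RtoC_neq_0, Rmult_integral_contrapositive_currified;
            [apply not_0_INR; lia|apply (IZR_INR_neq q' M); [assumption|lia]]. }
        specialize (Hc j Hj). specialize (Hg j Hj). rewrite IH in Hc by lia.
        transitivity (RtoC (INR (S j) * (IZR q - INR j)) * (k * RtoC (gamma q q' M (S j)))
         + RtoC (INR (M - j) * (IZR q' - INR (M - S j))) * c j
         - k * (RtoC (INR (S j) * (IZR q - INR j)) * RtoC (gamma q q' M (S j))
         + RtoC (INR (M - j) * (IZR q' - INR (M - S j))) * RtoC (gamma q q' M j))); [ring|].
        rewrite Hc, Hg. ring. }
    intros j Hj. replace j with (M - (M - j))%nat by lia. apply Hdown. lia.
Qed.

Lemma continuous_eq_at (f g : C -> C) (z : C) (d : R) :
  (0 < d)%R -> Ccontinuous f z -> Ccontinuous g z ->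
  (forall w, w <> z -> (Cmod (w - z) < d)%R -> f w = g w) -> f z = g z.
Proof.
  intros Hd Hf Hg H. apply Ceq_minus, Cmod_eq_0, Rle_antisym; [|apply Cmod_ge_0].
  apply Rnot_lt_le. intros Hp. set (e := (Cmod (f z - g z) / 2)%R).
  assert (He : (0 < e)%R) by (unfold e; lra).
  destruct (proj1 (Ccontinuous_Cmod f z) Hf e He) as [d1 [Hd1 H1]].
  destruct (proj1 (Ccontinuous_Cmod g z) Hg e He) as [d2 [Hd2 H2]].
  set (r := (Rmin d (Rmin d1 d2) / 2)%R).
  assert (Hr : (0 < r)%R) by (unfold r; assert (0 < Rmin d (Rmin d1 d2))%R by (repeat apply Rmin_pos; assumption); lra).
  assert (B : (r < d /\ r < d1 /\ r < d2)%R).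
  { pose proof (Rmin_l d (Rmin d1 d2)). pose proof (Rmin_r d (Rmin d1 d2)).
    pose proof (Rmin_l d1 d2). pose proof (Rmin_r d1 d2). unfold r in *. lra. }
  set (w := z + RtoC r).
  assert (Ew : w - z = RtoC r) by (unfold w; ring).
  assert (Mw : Cmod (w - z) = r) by (rewrite Ew, Cmod_R; apply Rabs_pos_eq; lra).
  assert (Hw : w <> z).
  { intros E. rewrite E in Mw. replace (z - z) with (RtoC 0) in Mw by ring. rewrite Cmod_0 in Mw. lra. }
  specialize (H1 w ltac:(lra)). specialize (H2 w ltac:(lra)). rewrite (H w Hw ltac:(lra)) in H1.
  assert (T : (Cmod (f z - g z) <= Cmod (g w - f z) + Cmod (g w - g z))%R).
  { rewrite <- (Cmod_opp (g w - f z)).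
    replace (f z - g z) with (- (g w - f z) + (g w - g z)) by ring. apply Cmod_triangle. }
  unfold e in *. lra.
Qed.

(** Off zeta = 0 the second chart is computed from the first; at zeta = 0, which the
    first chart misses, continuity decides. *)
Lemma section_chart2_determined p f g :
  is_section p f -> is_section p g ->
  (forall z, dom1 f z -> dom1 g z) -> (forall z, dom2 f z -> dom2 g z) ->
  (forall z, dom1 f z -> fun1 f z = fun1 g z) ->
  forall z, dom2 f z -> fun2 f z = fun2 g z.
Proof.
  intros (_ & Fo & Fd & _ & Fh & Ft) (_ & _ & _ & _ & Gh & Gt) D1 D2 E.
  assert (Hne : forall z : C, z <> 0 -> dom2 f z -> fun2 f z = fun2 g z).
  { intros z Hz Hd.
    assert (Hk : - 1 / z <> 0) by (apply Cdiv_neq_0; [apply Cm1_neq_0|assumption]).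
    assert (Ez : - 1 / (- 1 / z) = z) by (field; assumption || (split; [assumption|apply Cm1_neq_0])).
    assert (Hd1 : dom1 f (- 1 / z)) by (apply Fd; [assumption|now rewrite Ez]).
    pose proof (Ft _ Hk Hd1) as E1. pose proof (Gt _ Hk (D1 _ Hd1)) as E2.
    rewrite E, E2 in E1 by assumption. rewrite Ez in E1.
    pose proof (Cpowz_nz z (- p) Hz) as Hp.
    apply (f_equal (Cmult (/ Cpowz z (- p)))) in E1.
    now rewrite !Cmult_assoc, Cinv_l, !Cmult_1_l in E1 by assumption. }
  intros z Hz. destruct (Ceq_dec z 0) as [->|Hz0]; [|now apply Hne].
  destruct (proj1 (locally_Cmod (RtoC 0) _) (Fo (RtoC 0) Hz)) as [d [Hd HU]].
  apply (continuous_eq_at _ _ 0 d Hd).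
  - now apply ex_Cderive_continuous, Fh.
  - now apply ex_Cderive_continuous, Gh, D2.
  - intros w Hw Hwd. apply Hne; [assumption|now apply HU].
Qed.

Lemma scale_section p k f : is_section p f -> is_section p (scale k f).
Proof.
  intros (O1 & O2 & D & H1 & H2 & T).
  split; [assumption|]. split; [assumption|]. split; [assumption|]. split; [|split].
  - intros z Hz. apply (ex_Cderive_mult (fun _ => k) (fun1 f)); [apply ex_Cderive_const|now apply H1].
  - intros z Hz. apply (ex_Cderive_mult (fun _ => k) (fun2 f)); [apply ex_Cderive_const|now apply H2].
  - intros z Hz Hd. simpl. rewrite (T z Hz Hd). ring.
Qed.

Theorem theorem1 (q q' : Z) (M : nat)
  (Hq : ~ (0 <= q < Z.of_nat M)%Z \/ ~ (0 <= q' < Z.of_nat M)%Z) :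
  is_invariant_pairing_of_order M q q' (q + q' - 2 * Z.of_nat M)
    (transvectant q q' M) /\
  is_nonzero_pairing q q' (transvectant q q' M) /\
  (forall (p : Z) (Q : local_data -> local_data -> local_data),
     is_invariant_pairing_of_order M q q' p Q ->
     is_nonzero_pairing q q' Q ->
     exists c : C, c <> RtoC 0 /\
       forall f g : local_data, is_section q f -> is_section q' g ->
         sec_eq (Q f g) (scale c (transvectant q q' M f g))).
Proof.
  split; [apply transvectant_invariant_pairing|].
  split; [now apply transvectant_nonzero|].
  intros p Q HQ Hnz. pose proof HQ as ((HP & _) & _ & ->).
  destruct (invariant_coefficients q q' M Q HQ) as (c & Hrec & Hc).
  destruct (recurrence_proportional q q' M c Hq Hrec) as (k & Hk).
  assert (HE : forall f g, is_section q f -> is_section q' g ->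
    sec_eq (Q f g) (scale k (transvectant q q' M f g))).
  { intros f g Hf Hg. destruct (HP f g Hf Hg) as (HS & D1 & D2).
    assert (E1 : forall z, dom1 (Q f g) z -> fun1 (Q f g) z = fun1 (scale k (transvectant q q' M f g)) z).
    { intros z Hz. rewrite (Hc f g z Hf Hg Hz). simpl. unfold transvectant_expr.
      rewrite Csum_mult_l. apply Csum_ext. intros j Hj. rewrite Hk by assumption. ring. }
    split; [exact D1|]. split; [exact D2|]. split; [exact E1|].
    apply (section_chart2_determined (q + q' - 2 * Z.of_nat M)); try assumption.
    - apply scale_section. now apply transvectant_section.
    - intros z Hz. now apply D1.
    - intros z Hz. now apply D2. }
  exists k. split; [|exact HE].
  intros ->. destruct Hnz as (f & g & Hf & Hg & Hne).
  destruct (HE f g Hf Hg) as (_ & _ & E1 & E2).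
  destruct Hne as [(z & Hz & Hne)|(z & Hz & Hne)]; apply Hne.
  - rewrite (E1 z Hz). simpl. ring.
  - rewrite (E2 z Hz). simpl. ring.
Qed.
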